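(* Let $\omega$ be a locally bounded nonnegative function on $(0,\infty)$, and define functions $W^{(\omega)}_n$ on $[0,\infty)$ by \[W^{(\omega)}_0(x)=1,\qquad W^{(\omega)}_{n+1}(x)=\int_x^\infty W(z-x)\,\omega(z)\,W^{(\omega)}_n(z)\,\mathrm{d}z,\quad x\ge0,\ n\ge0.\] Let $b\ge0$. If $\sum_{n=0}^\infty W^{(\omega)}_n(b)<\infty$, then for all $x\ge b$, \[\mathbb{E}_x\left[\exp\left(-\int_0^{\tau_b^-}\omega(Z_s)\,\mathrm{d}s\right);\ \tau_b^-<\infty\right]=\frac{\sum_{n=0}^\infty W^{(\omega)}_n(x)}{\sum_{n=0}^\infty W^{(\omega)}_n(b)}.\]
   Context: Let $\Psi(\lambda)=\gamma\lambda+\frac{\sigma^2}{2}\lambda^2+\int_0^\infty(e^{-\lambda z}-1+\lambda z)\,\pi(\mathrm{d}z)$ for $\lambda\ge0$, with $\gamma\ge0$, $\sigma\ge0$, $\pi$ a measure on $(0,\infty)$ with $\int_0^\infty(z\wedge z^2)\pi(\mathrm{d}z)<\infty$. $Z$ is a spectrally positive Lévy process with $\mathbb{E}[e^{-\lambda Z_1}\mid Z_0=x]=e^{-\lambda x+\Psi(\lambda)}$, and $\mathbb{P}_x,\mathbb{E}_x$ refer to $Z_0=x$. $\tau_b^-=\inf\{t\ge0:Z_t<b\}$. $W$ is the scale function: $W(x)=0$ for $x<0$, $W$ continuous strictly increasing on $[0,\infty)$ with $\int_0^\infty e^{-qy}W(y)\,\mathrm{d}y=1/\Psi(q)$ for $q>0$.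 *)

(* Defs.v *)
From mathcomp Require Import all_boot all_order all_algebra.
From mathcomp Require Import all_classical all_reals all_analysis.
Set Implicit Arguments. Unset Strict Implicit. Unset Printing Implicit Defensive.
Import Order.TTheory GRing.Theory Num.Theory.
Import numFieldNormedType.Exports.
Local Open Scope classical_set_scope.
Local Open Scope ring_scope.

Section defs.
Context {R : realType}.
Local Notation leb := (@lebesgue_measure R).

Definition Psi (g s : R) (pi : {measure set R -> \bar R}) (l : R) : R :=
  g * l + s ^+ 2 / 2 * l ^+ 2 +
  fine (\int[pi]_(z in `]0%R, +oo[) (expR (- (l * z)) - 1 + l * z)%:E)%E.

Definition levy_triplet (g s : R) (pi : {measure set R -> \bar R}) : Prop :=
  0 <= g /\ 0 <= s /\
  (\int[pi]_(z in `]0%R, +oo[) (Num.min z (z ^+ 2))%:E < +oo)%E.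

Definition scale_function (Ps : R -> R) (W : R -> R) : Prop :=
  (forall x, x < 0 -> W x = 0) /\
  {within `[0%R, +oo[, continuous W} /\
  (forall a b, 0 <= a -> a < b -> W a < W b) /\
  (forall q, 0 < q ->
     (\int[leb]_(y in `[0%R, +oo[) (expR (- (q * y)) * W y)%:E)%E = ((Ps q)^-1)%:E).

Context {d : measure_display} {T : measurableType d}.

Definition incr (X : R -> T -> R) (u v : R) : T -> R := fun w => X v w - X u w.

(* X is a Levy process started at 0 on (T, P) with Laplace exponent Ps:
   E[exp(-l X_1)] = exp(Ps l) for l >= 0. The process started at x is x + X. *)
Definition levy_process (P : probability T R) (X : R -> T -> R) (Ps : R -> R) : Prop :=
  (forall t, measurable_fun setT (X t)) /\
  (forall w, X 0 w = 0) /\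
  (forall w t, 0 <= t -> (fun s => X s w) @ t^'+ --> X t w) /\
  (forall w t, 0 < t -> cvg ((fun s => X s w) @ t^'-)) /\
  (forall s t (B : set R), 0 <= s -> 0 <= t -> measurable B ->
     P ((fun w => X (s + t) w - X s w) @^-1` B) = P (X t @^-1` B)) /\
  (forall (n : nat) (t : nat -> R) (B : nat -> set R),
     0 <= t 0%N -> (forall i, t i < t i.+1) -> (forall i, measurable (B i)) ->
     P (\bigcap_(i in `I_n) (incr X (t i) (t i.+1) @^-1` B i)) =
     (\prod_(i < n) P (incr X (t i) (t i.+1) @^-1` B i))%E) /\
  (forall l, 0 <= l ->
     (\int[P]_w (expR (- (l * X 1 w)))%:E)%E = (expR (Ps l))%:E).

Definition tau_below (X : R -> T -> R) (x b : R) (w : T) : \bar R :=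
  ereal_inf (EFin @` [set t | 0 <= t /\ x + X t w < b]).

Definition occ_set (X : R -> T -> R) (x b : R) (w : T) : set R :=
  `[0%R, fine (tau_below X x b w)[.

Definition killed_laplace (P : probability T R) (X : R -> T -> R) (om : R -> R)
    (x b : R) : \bar R :=
  (\int[P]_(w in [set w | tau_below X x b w < +oo])
     expeR (- \int[leb]_(s in occ_set X x b w) (om (x + X s w))%:E))%E.
End defs.

Fixpoint Wom {R : realType} (W om : R -> R) (n : nat) (x : R) : \bar R :=
  match n with
  | 0%N => 1%E
  | n'.+1 => (\int[@lebesgue_measure R]_(z in `[x, +oo[)
                 ((W (z - x) * om z)%:E * Wom W om n' z))%E
  end.

(* Main.v *)
From HB Require Import structures.
Require Import Defs.
From mathcomp Require Import all_boot all_order all_algebra.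
From mathcomp Require Import all_classical all_reals all_analysis.
From mathcomp Require Import measurable_realfun ring lra.
Import Order.TTheory GRing.Theory Num.Theory.
Import numFieldNormedType.Exports.
Local Open Scope classical_set_scope.
Local Open Scope ring_scope.

(* Write tau for tau_b^-. For l >= 0 the process e^{-l Z_t} minus Psi(l) times its
   time integral is a martingale, so stopping at tau, where Z_tau = b because Z has
   no negative jumps, gives tau < oo almost surely and
     E_x int_0^tau e^{-l Z_s} ds = (e^{-l b} - e^{-l x}) / Psi(l).
   The right-hand side is the Laplace transform of W(y - b) - W(y - x), which is
   therefore the density of the expected occupation measure of Z before tau.
   Let h(x) be the left-hand side of the theorem and A the integral of om(Z_s) up
   to tau. Integrating 1 - e^{-A} = int_0^tau om(Z_s) e^{-(A - A_s)} ds and using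
   the Markov property at each fixed time s gives
     h(x) = 1 - int om(y) h(y) (W(y - b) - W(y - x)) dy = c + int_x^oo W(y - x) om(y) h(y) dy
   with c independent of x. Iterating, h = c sum_n W_n, because the remainders are
   at most W_n(x) <= W_n(b) --> 0; and h(b) = 1 determines c. The strong Markov
   property is never needed: stopping is done on dyadic grids. *)

Section translation.
Context {R : realType}.
Local Notation leb := (@lebesgue_measure R).

Lemma lebesgue_measure_shift (c : R) (A : set R) : measurable A ->
  leb ((fun x : R => x + c) @^-1` A) = leb A.
Proof.
move=> mA.
have mf : measurable_fun setT (fun x : measurableTypeR R => x + c : measurableTypeR R).
  by apply: measurable_funD.
pose mf' := isMeasurableFun.Build _ _ _ _ _ mf.
pose f' : {mfun measurableTypeR R >-> measurableTypeR R} :=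
  HB.pack (fun x : measurableTypeR R => x + c : measurableTypeR R) mf'.
apply/esym; apply: (@lebesgue_measure_unique R (pushforward leb f')) => //= _ [[a b]] _ <-.
rewrite /pushforward.
have -> : f' @^-1` `]a, b] = `]a - c, b - c]%classic.
  by apply/seteqP; split => x /=; rewrite !in_itv/= ltrBlDr lerBrDr.
rewrite !lebesgue_measure_itv/= !lte_fin ltrD2r.
by case: ifP => // _; rewrite -!EFinB opprB addrA subrK.
Qed.

Lemma ge0_integral_shift (c : R) (f : R -> \bar R) : measurable_fun setT f ->
  (forall x, 0 <= f x)%E ->
  (\int[leb]_x f (x + c)%R = \int[leb]_x f x)%E.
Proof.
move=> mf f0.
have ms : measurable_fun setT (fun x : measurableTypeR R => x + c : measurableTypeR R).
  by apply: measurable_funD.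
have := @ge0_integral_pushforward _ _ _ _ R _ ms leb setT f measurableT mf
  (fun y _ => f0 y).
rewrite preimage_setT /comp => <-.
apply: eq_measure_integral => //= A mA _.
exact: lebesgue_measure_shift.
Qed.
End translation.

Section density.
Context d (T : measurableType d) (R : realType).
Variables (mu : {measure set T -> \bar R}) (f : T -> R).
Hypotheses (mf : measurable_fun setT f) (f0 : forall x, 0 <= f x).

Definition density of measurable_fun setT f & (forall x, 0 <= f x) :=
  fun A : set T => (\int[mu]_(x in A) (f x)%:E)%E.

Local Notation nu := (density mf f0).

Let nu0 : nu set0 = 0%E. Proof. exact: integral_set0. Qed.

Let nu_ge0 A : (0 <= nu A)%E.
Proof. by apply: integral_ge0 => x _; rewrite lee_fin. Qed.

Let nu_sigma_additive : semi_sigma_additive nu.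
Proof.
move=> F mF tF mUF; rewrite /density ge0_integral_bigcup//.
- by apply: is_cvg_nneseries => n _ _; exact: nu_ge0.
- apply: (measurable_funS measurableT) => //; exact/measurable_EFinP.
- by move=> x _; rewrite lee_fin.
Qed.

HB.instance Definition _ := isMeasure.Build _ _ _ nu nu0 nu_ge0 nu_sigma_additive.

Import HBNNSimple.

Lemma ge0_integral_density (g : T -> \bar R) :
  measurable_fun setT g -> (forall x, 0 <= g x)%E ->
  (\int[nu]_x g x = \int[mu]_x (g x * (f x)%:E))%E.
Proof.
move=> mg g0.
pose h := nnsfun_approx measurableT mg.
have hg x : EFin (h n x) @[n --> \oo] --> g x by exact: cvg_nnsfun_approx.
have hE x : g x = lim (EFin (h n x) @[n --> \oo]).
  by apply/esym/cvg_lim => //; exact: hg.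
have -> : (\int[nu]_x g x = lim ((\int[nu]_x (EFin (h n x))) @[n --> \oo]))%E.
  under eq_integral => x _ do rewrite hE.
  apply: monotone_convergence => //.
  - by move=> n; exact/measurable_EFinP.
  - by move=> n x Ex //=; rewrite lee_fin.
  - by move=> x Ex a b ab; rewrite lee_fin; exact/lefP/nd_nnsfun_approx.
have -> : (\int[mu]_x (g x * (f x)%:E) =
    lim ((\int[mu]_x (EFin (h n x) * (f x)%:E)) @[n --> \oo]))%E.
  rewrite -monotone_convergence//.
  - apply: eq_integral => x _ /=; apply/esym/cvg_lim => //.
    by apply: cvgeZr => //; exact: hg.
  - by move=> n; apply/measurable_EFinP; exact: measurable_funM.
  - by move=> n x _; rewrite -EFinM lee_fin mulr_ge0.
  - move=> x _ a b ab; rewrite -!EFinM lee_fin ler_wpM2r//.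
    exact/lefP/nd_nnsfun_approx.
congr (limn _); apply/funext => n.
rewrite [LHS](eq_integral (fun x => (\sum_(y \in range (h n)) (y * \1_(h n @^-1` [set y]) x)%:E)%E)); last first.
  by move=> x _; rewrite fimfunE -fsumEFin//.
rewrite ge0_integral_fsum//; last 2 first.
  - by move=> r; apply/measurable_EFinP; exact: measurable_funM.
  - by move=> r x _; exact: nnfun_muleindic_ge0.
rewrite [RHS](eq_integral (fun x => (\sum_(y \in range (h n)) ((y * \1_(h n @^-1` [set y]) x)%:E * (f x)%:E))%E)); last first.
  move=> x _; rewrite fimfunE -fsumEFin// ge0_mule_fsuml// => r.
  exact: nnfun_muleindic_ge0.
rewrite ge0_integral_fsum//; last 2 first.
  - move=> r; apply/measurable_EFinP; apply: measurable_funM => //.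
    exact: measurable_funM.
  - by move=> r x _; apply: mule_ge0; [exact: nnfun_muleindic_ge0|rewrite lee_fin].
apply: eq_fsbigr => r rhn.
rewrite integralZl_indic_nnsfun// integral_indic// setIT.
under [RHS]eq_integral do rewrite EFinM -muleA.
have [->|r0] := eqVneq r 0%R.
  by rewrite mul0e; under eq_integral do rewrite mul0e; rewrite integral0.
have r_ge0 : 0 <= r by move: rhn; rewrite inE => -[x _ <-].
rewrite ge0_integralZl_EFin//.
- congr (_ * _)%E; rewrite /density [LHS]integral_mkcond; apply: eq_integral => x _.
  by rewrite epatch_indic muleC.
- by move=> x _; rewrite mule_ge0// lee_fin.
- by apply/measurable_EFinP; exact: measurable_funM.
Qed.
End density.

(** * Laplace exponent and scale function *)

Section laplace_exponent.
Context {R : realType}.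
Variables (g s : R) (pi : {measure set R -> \bar R}).
Hypothesis Hpi : levy_triplet g s pi.

Lemma Psi_ge0 (l : R) : 0 <= l -> 0 <= Psi g s pi l.
Proof.
case: Hpi => g0 [s0 _] l0; rewrite /Psi !addr_ge0 ?mulr_ge0 ?sqr_ge0//.
apply: fine_ge0; apply: integral_ge0 => z _; rewrite lee_fin.
have := expR_ge1Dx (- (l * z)); lra.
Qed.

Lemma expR_compensated_le (l z : R) : 1 <= l -> 0 < z ->
  expR (- (l * z)) - 1 + l * z <= l ^+ 2 * Num.min z (z ^+ 2).
Proof.
move=> l1 z0; have lz0 : 0 <= l * z by rewrite mulr_ge0//; lra.
have e1 : expR (- (l * z)) <= 1 by rewrite -expR0 ler_expR; lra.
have e2 : expR (- (l * z)) <= 1 - l * z + (l * z) ^+ 2.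
  rewrite expRN -[_^-1]mul1r ler_pdivrMr ?expR_gt0//.
  apply: (@le_trans _ _ ((1 - l * z + (l * z) ^+ 2) * (1 + l * z))).
    rewrite -subr_ge0; have -> : (1 - l * z + (l * z) ^+ 2) * (1 + l * z) - 1 = (l * z) ^+ 3 by ring.
    exact: exprn_ge0.
  by apply: ler_wpM2l; [nra|exact: expR_ge1Dx].
have [zle|zle] := leP z (z ^+ 2).
- apply: (@le_trans _ _ (l * z)); first lra.
  by apply: ler_wpM2r; [lra|nra].
- rewrite -exprMn; lra.
Qed.

Lemma Psi_le_sqr : exists C : R, forall l, 1 <= l -> Psi g s pi l <= C * l ^+ 2.
Proof.
case: Hpi => g0 [s0 I].
set D : set R := `]0%R, +oo[%classic in I *.
have mD : measurable D by exact: measurable_itv.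
set J := (\int[pi]_(z in _) _)%E in I.
have min0 (z : R) : D z -> (0 <= (Num.min z (z ^+ 2))%:E)%E.
  by rewrite /D/= in_itv/= andbT => z0; rewrite lee_fin le_min sqr_ge0 ltW.
have J0 : (0 <= J)%E by exact: integral_ge0.
have Jfin : J \is a fin_num by rewrite ge0_fin_numE.
exists (g + s ^+ 2 / 2 + fine J) => l l1.
have mz : measurable_fun D (fun z : R => (Num.min z (z ^+ 2))%:E).
  apply/measurable_EFinP; apply: measurable_minr; first exact: measurable_id.
  by apply: measurable_funX; exact: measurable_id.
rewrite /Psi !mulrDl -/D lerD// ?lerD//.
  by apply: ler_wpM2l => //; nra.
set K := (\int[pi]_(z in D) (expR (- (l * z)) - 1 + l * z)%:E)%E.
have K0 : (0 <= K)%E.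
  apply: integral_ge0 => z _; rewrite lee_fin.
  have := expR_ge1Dx (- (l * z)); lra.
have KJ : (K <= (l ^+ 2)%:E * J)%E.
  rewrite /J -ge0_integralZl_EFin ?sqr_ge0//.
  apply: ge0_le_integral => //.
  - move=> z _; rewrite lee_fin.
    have := expR_ge1Dx (- (l * z)); lra.
  - apply/measurable_EFinP; apply: measurable_funD.
      apply: measurable_funB => //; apply: measurableT_comp => //.
      by apply: measurable_funN; apply: measurable_funM => //; exact: measurable_id.
    by apply: measurable_funM => //; exact: measurable_id.
  - exact: measurable_funeM.
  - move=> z; rewrite /D/= in_itv/= andbT => z0; rewrite -EFinM lee_fin.
    exact: expR_compensated_le.
have lJ : ((l ^+ 2)%:E * J)%E \is a fin_num by rewrite fin_numM.
rewrite mulrC -[l ^+ 2]/(fine (l ^+ 2)%:E) -fineM//.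
apply: fine_le => //.
by rewrite ge0_fin_numE// (le_lt_trans KJ)// -ge0_fin_numE// mule_ge0 ?lee_fin ?sqr_ge0.
Qed.

End laplace_exponent.

Section scale_function_theory.
Context {R : realType}.
Local Notation leb := (@lebesgue_measure R).

Lemma integral_expR_itv (q : R) : 0 < q ->
  (\int[leb]_(y in `[0%R, +oo[) (expR (- (q * y)))%:E = (q^-1)%:E)%E.
Proof.
move=> q0.
have := @integral_exponential_pdf R q q0.
rewrite (_ : (fun x => _) = (fun x : R => q%:E * (expR (- (q * x)))%:E)%E \_ `[0%R, +oo[); last first.
  apply/funext => x; rewrite /exponential_pdf !patchE; case: ifPn => // _.
  by rewrite -EFinM mulNr.
rewrite -integral_mkcond ge0_integralZl_EFin ?(ltW q0)//.
- set I := (\int[_]_(_ in _) _)%E => qI.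
  have q1 : ((q^-1)%:E * q%:E = 1 :> \bar R)%E by rewrite -EFinM mulVf// gt_eqF.
  by rewrite -[I]mul1e -q1 -muleA qI mule1.
- apply/measurable_EFinP; apply: measurableT_comp => //.
  by apply: measurable_funN; apply: measurable_funM => //; exact: measurable_id.
Qed.

Variables (Ps : R -> R) (W : R -> R).
Hypotheses (HW : scale_function Ps W) (Ps0 : forall l, 0 <= l -> 0 <= Ps l).

Let W_lt0 x : x < 0 -> W x = 0. Proof. by case: HW => + _; exact. Qed.

Let W_incr a b : 0 <= a -> a < b -> W a < W b.
Proof. by case: HW => _ [_ [+ _]]; exact. Qed.

Let W_laplace q : 0 < q ->
  (\int[leb]_(y in `[0%R, +oo[) (expR (- (q * y)) * W y)%:E)%E = ((Ps q)^-1)%:E.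
Proof. by case: HW => _ [_ [_ +]]; exact. Qed.

Lemma measurable_scale_pos : measurable_fun (`[0%R, +oo[%classic : set R) W.
Proof.
apply: (eq_measurable_fun (fun x : R => W (Num.max 0 x))).

  by move=> x; rewrite inE/= in_itv/= andbT => x0; rewrite max_r.
apply: nondecreasing_measurable => // x y xy.
have [->//|xy'] := eqVneq (Num.max 0 x) (Num.max 0 y).
apply/ltW/W_incr; first by rewrite le_max lexx.
by rewrite lt_neqAle xy'/= ge_max !le_max lexx xy orbT.
Qed.

Lemma scale0_ge0 : 0 <= W 0.
Proof.
rewrite leNgt; apply/negP => W0.
have [e e0 We] : exists2 e, 0 < e & forall y, 0 <= y -> y <= e -> W y <= W 0 / 2.
  have [_ [/continuous_within_itvcyP[_ W0c] _]] := HW.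
  have W02 : 0 < - (W 0 / 2) by lra.
  have /cvgrPdist_lt/(_ _ W02) := W0c.
  case=> e /= e0 He; exists (e / 2); first lra.
  move=> y; rewrite le_eqVlt => /predU1P[<-|y0] ye; first lra.
  have := He y; rewrite /= sub0r normrN gtr0_norm// => /(_ _ y0).
  by move=> /(_ ltac:(lra)); rewrite ltr_norml; lra.
pose p q (y : R) := (expR (- (q * y)) * Num.max 0 (W y))%:E.
pose n q (y : R) := (expR (- (q * y)) * Num.max 0 (- W y))%:E.
pose D : set R := `[0%R, +oo[%classic.
have mD : measurable D by exact: measurable_itv.
have mexp q : measurable_fun D (fun y : R => expR (- (q * y))).
  apply: measurableT_comp => //.
  by apply: measurable_funN; apply: measurable_funM => //; exact: measurable_id.
have mW : measurable_fun D W by exact: measurable_scale_pos.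
have mp q : measurable_fun D (p q).
  apply/measurable_EFinP; apply: measurable_funM => //.
  by apply: measurable_maxr.
have mn q : measurable_fun D (n q).
  apply/measurable_EFinP; apply: measurable_funM => //.
  by apply: measurable_maxr => //; exact: measurable_funN.
have p0 q y : (0 <= p q y)%E by rewrite lee_fin mulr_ge0 ?expR_ge0// le_max lexx.
have n0 q y : (0 <= n q y)%E by rewrite lee_fin mulr_ge0 ?expR_ge0// le_max lexx.
have pn q : 0 < q -> (\int[leb]_(y in D) p q y - \int[leb]_(y in D) n q y = ((Ps q)^-1)%:E)%E.
  move=> q0; rewrite -W_laplace// [RHS]integralE; congr (_ - _)%E.
  - apply: eq_integral => y _; rewrite /p funeposE/=.
    by rewrite -EFin_max; congr EFin; rewrite maxC maxr_pMr ?expR_ge0// mulr0.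
  - apply: eq_integral => y _; rewrite /n funenegE/=.
    by rewrite -EFin_max; congr EFin; rewrite maxC maxr_pMr ?expR_ge0// mulr0 mulrN.
have np q : 0 < q -> (\int[leb]_(y in D) n q y <= \int[leb]_(y in D) p q y)%E /\
    (\int[leb]_(y in D) p q y < +oo)%E.
  move=> q0; have := pn _ q0.
  have : (0 <= \int[leb]_(y in D) p q y)%E by exact: integral_ge0.
  have : (0 <= \int[leb]_(y in D) n q y)%E by exact: integral_ge0.
  case: (\int[leb]_(y in D) p q y)%E => [a| |]; case: (\int[leb]_(y in D) n q y)%E => [c| |]//.
  move=> _ _ [] ac; split; last exact: ltry.
  by rewrite lee_fin -subr_ge0 ac invr_ge0 Ps0// ltW.

pose M := fine (\int[leb]_(y in D) p 1%R y)%E.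
have key q : 1 <= q -> e^-1 <= q -> - W 0 / 2 * expR (- 1) * q^-1 <= expR (- ((q - 1) * e)) * M.
  move=> q1 qe; have q0 : 0 < q by lra.
  have [npq pq] := np q q0.
  have [_ p1] := np 1 ltr01.
  rewrite -lee_fin [leRHS]EFinM fineK; last by rewrite ge0_fin_numE// integral_ge0.
  apply: (@le_trans _ _ (\int[leb]_(y in D) p q y)%E).
    apply: le_trans npq.
    have qi0 : 0 < q^-1 by rewrite invr_gt0.
    pose E : set R := `[0%R, q^-1]%classic.
    have mE : measurable E by exact: measurable_itv.

    apply: (@le_trans _ _ (\int[leb]_(y in E) n q y)%E); last first.
      apply: ge0_subset_integral => //; first exact: mn.
      by move=> y; rewrite /D/E/= !in_itv/= andbT => /andP[].
    apply: (@le_trans _ _ (\int[leb]_(y in E) (- W 0 / 2 * expR (- 1))%:E)%E).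
      by rewrite integral_cst//= lebesgue_measure_itv/= lte_fin qi0 -EFinB subr0 -EFinM.
    apply: ge0_le_integral => //.
    - by move=> y _; rewrite lee_fin mulr_ge0 ?expR_ge0//; lra.
    - by apply: measurable_funS (mn q) => // y; rewrite /D/E/= !in_itv/= andbT => /andP[].
    - move=> y; rewrite /E/= in_itv/= => /andP[y0 yq]; rewrite lee_fin mulrC.
      have qy1 : q * y <= 1 by rewrite -(mulfV (lt0r_neq0 q0)) ler_wpM2l// ltW.
      apply: ler_pM; rewrite ?expR_ge0//; first lra.
        by rewrite ler_expR lerN2.
      have ye : y <= e by rewrite (le_trans yq)// -[e]invrK lef_pV2// posrE invr_gt0.
      by have := We _ y0 ye; rewrite le_max; lra.
  rewrite -ge0_integralZl_EFin ?expR_ge0//.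
  apply: ge0_le_integral => //; [exact: mp|by apply: measurable_funeM; exact: mp|].
  move=> y; rewrite /D/= in_itv/= andbT => y0; rewrite -EFinM lee_fin.
  have [ye|ye] := leP y e.
    suff Wy0 : W y <= 0 by rewrite max_l// !mulr0.
    by have := We _ y0 ye; lra.
  rewrite mulrA ler_wpM2r ?le_max ?lexx// -expRD ler_expR.
  by nra.
  exact: mp.
have M0 : 0 <= M by rewrite fine_ge0// integral_ge0.
pose c := - W 0 / 2 * expR (- 1).
have c0 : 0 < c by rewrite mulr_gt0 ?expR_gt0//; lra.
pose B := 2 * M * expR e / e ^+ 2.
have B0 : 0 <= B by rewrite !mulr_ge0 ?expR_ge0 ?invr_ge0 ?sqr_ge0.
pose q := 1 + e^-1 + B / c.
have Bc : 0 <= B / c by rewrite mulr_ge0// invr_ge0 ltW.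
have ei : 0 < e^-1 by rewrite invr_gt0.
have q1 : 1 <= q by rewrite /q; lra.
have qe : e^-1 <= q by rewrite /q; lra.
have q0 : 0 < q by lra.
have := key q q1 qe; rewrite -/c.
have -> : expR (- ((q - 1) * e)) = expR e / expR (q * e).
  by rewrite -expRN -expRD; congr expR; ring.
have eqe : (q * e) ^+ 2 / 2 <= expR (q * e).
  have := @expR_ge1Dxn R (q * e) 1 (mulr_ge0 (ltW q0) (ltW e0)).
  by rewrite -[_`!]/2%N; lra.
have qe2 : 0 < (q * e) ^+ 2 / 2 by rewrite divr_gt0// exprn_gt0// mulr_gt0.
apply/negP; rewrite -ltNge.
apply: (@le_lt_trans _ _ (expR e / ((q * e) ^+ 2 / 2) * M)).
  by rewrite ler_wpM2r// ler_wpM2l ?expR_ge0// lef_pV2 ?posrE ?expR_gt0.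
have -> : expR e / ((q * e) ^+ 2 / 2) * M = B / q / q.
  by rewrite /B; field; rewrite !gt_eqF.
rewrite ltr_pM2r ?invr_gt0// ltr_pdivrMr//.
have -> : B = c * (B / c) by field; rewrite gt_eqF.
by rewrite ltr_pM2l// /q; lra.
Qed.

Lemma scale_ge0 x : 0 <= W x.
Proof.
have [x0|x0|->] := ltgtP x 0; [by rewrite W_lt0| |exact: scale0_ge0].
by rewrite (le_trans scale0_ge0)// ltW// W_incr.
Qed.

Lemma scale_nondecreasing : {homo W : x y / x <= y}.
Proof.
move=> x y; rewrite le_eqVlt => /predU1P[->//|xy].
have [x0|x0] := ltP x 0; first by rewrite W_lt0// scale_ge0.
by rewrite ltW// W_incr.
Qed.

Lemma measurable_scale : measurable_fun setT W.
Proof. exact: nondecreasing_measurable scale_nondecreasing. Qed.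

Lemma exponent_gt0 q : 0 < q -> 0 < Ps q.
Proof.
move=> q0; rewrite lt_neqAle Ps0 ?ltW// andbT; apply/eqP => P0.
have := W_laplace _ q0; rewrite -P0 invr0 => I0.
pose E : set R := `[1%R, 2%R]%classic.
have mE : measurable E by exact: measurable_itv.
have : (0 < \int[leb]_(y in `[0%R, +oo[) (expR (- (q * y)) * W y)%:E)%E; last by rewrite I0 ltxx.
have W1 : 0 < W 1 by rewrite (le_lt_trans scale0_ge0)// W_incr.
have mf : measurable_fun setT (fun y : R => (expR (- (q * y)) * W y)%:E).
  apply/measurable_EFinP; apply: measurable_funM; last exact: measurable_scale.
  apply: measurableT_comp => //.
  by apply: measurable_funN; apply: measurable_funM => //; exact: measurable_id.
apply: (@lt_le_trans _ _ (\int[leb]_(y in E) (expR (- (q * 2)) * W 1)%:E)%E).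
  rewrite integral_cst//= lebesgue_measure_itv/= lte_fin ltr1n -EFinB -EFinM lte_fin.
  by rewrite mulr_gt0// ?mulr_gt0 ?expR_gt0//; lra.
apply: (@le_trans _ _ (\int[leb]_(y in E) (expR (- (q * y)) * W y)%:E)%E).
  apply: ge0_le_integral => //.
  - by move=> y _; rewrite lee_fin mulr_ge0 ?expR_ge0 ?scale_ge0.
  - exact: measurable_funS mf.
  - move=> y; rewrite /E/= in_itv/= => /andP[y1 y2]; rewrite lee_fin.
    apply: ler_pM; rewrite ?expR_ge0 ?scale_ge0//; last exact: scale_nondecreasing.
    by rewrite ler_expR lerN2 ler_wpM2l// ltW.
apply: ge0_subset_integral => //.
- exact: measurable_funS mf.
- by move=> y _; rewrite lee_fin mulr_ge0 ?expR_ge0 ?scale_ge0.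
- move=> y; rewrite /E/= !in_itv/= andbT => /andP[y1 _]; lra.
Qed.

Lemma scale_laplaceT q b : 0 < q ->
  (\int[leb]_y (expR (- (q * y)) * W (y - b))%:E = (expR (- (q * b)) / Ps q)%:E)%E.
Proof.
move=> q0.
have mf c : measurable_fun setT (fun y : R => (expR (- (q * y)) * W (y - c))%:E).
  apply/measurable_EFinP; apply: measurable_funM.
    apply: measurableT_comp => //.
    by apply: measurable_funN; apply: measurable_funM => //; exact: measurable_id.
  apply: measurableT_comp; first exact: measurable_scale.
  by apply: measurable_funB => //; exact: measurable_id.
rewrite -(ge0_integral_shift b) => [|//|y]; last first.
  by rewrite lee_fin mulr_ge0 ?expR_ge0 ?scale_ge0.
have E y : (expR (- (q * (y + b))) * W (y + b - b))%:E =
  ((expR (- (q * b)))%:E * (expR (- (q * y)) * W y)%:E)%E.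
  by rewrite addrK -EFinM mulrA -expRD; congr (expR _ * _)%:E; ring.
under eq_integral do rewrite E.
have mf0 : measurable_fun setT (fun y : R => (expR (- (q * y)) * W y)%:E).
  by have := mf 0; under eq_fun do rewrite subr0.
rewrite ge0_integralZl_EFin ?expR_ge0//; last first.
  by move=> y _; rewrite lee_fin mulr_ge0 ?expR_ge0 ?scale_ge0.
rewrite EFinM -W_laplace// [in RHS]integral_mkcond; congr (_ * _)%E.
apply: eq_integral => y _; rewrite patchE; case: ifPn => //.
rewrite notin_setE/= in_itv/= andbT => /negP; rewrite -ltNge => y0.
by rewrite W_lt0// mulr0.
Qed.

End scale_function_theory.

(** * Uniqueness of Laplace transforms *)

Section bernstein.
Context {R : realType}.

(* The expectation of f at a binomial variable with parameters n and u. *)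
Fixpoint bernstein (n : nat) (f : nat -> R) (u : R) : R :=
  if n is n'.+1 then (1 - u) * bernstein n' f u + u * bernstein n' (f \o succn) u
  else f 0%N.

Lemma bernstein_le n f h u : 0 <= u <= 1 -> (forall j, f j <= h j) ->
  bernstein n f u <= bernstein n h u.
Proof.
move=> u01; elim: n f h => [|n IH] f h fh //=.
have [u0 u1] := andP u01.
by apply: lerD; apply: ler_wpM2l; rewrite ?subr_ge0//; apply: IH => j; exact: fh.
Qed.

Lemma bernstein_cst n c u : bernstein n (fun=> c) u = c.
Proof. by elim: n => [//|n /= IH]; rewrite [X in u * X]IH IH; ring. Qed.

Lemma bernsteinD n f h u :
  bernstein n (fun j => f j + h j) u = bernstein n f u + bernstein n h u.
Proof. by elim: n f h => [//|n IH] f h /=; rewrite (IH (f \o succn)) IH; ring. Qed.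

Lemma bernsteinZ n c f u :
  bernstein n (fun j => c * f j) u = c * bernstein n f u.
Proof. by elim: n f => [//|n IH] f /=; rewrite (IH (f \o succn)) IH; ring. Qed.

Lemma bernstein_variance n a u : bernstein n (fun j => (j%:R - a) ^+ 2) u =
  (n%:R * u - a) ^+ 2 + n%:R * (u * (1 - u)).
Proof.
elim: n a => [|n IH] a /=; first by ring.
rewrite IH (_ : _ \o _ = fun j : nat => (j%:R - (a - 1)) ^+ 2); last first.
  by apply/funext => j /=; rewrite -natr1; ring.
by rewrite IH -natr1; ring.
Qed.

Lemma bernstein_lipschitz (K e u : R) (n : nat) (g : R -> R) :
  (0 < n)%N -> 0 <= K -> 0 < e -> 0 <= u <= 1 ->
  (forall x y, `|g x - g y| <= K * `|x - y|) ->
  `|bernstein n (fun j => g (j%:R / n%:R)) u - g u| <= K * (e + (e * n%:R)^-1).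
Proof.
move=> n0 K0 e0 u01 gK.
have n0' : 0 < n%:R :> R by rewrite ltr0n.
pose G (j : nat) : R := K * e + (K / e / n%:R ^+ 2) * (j%:R - n%:R * u) ^+ 2.
have EG : bernstein n G u = K * e + K / e / n%:R * (u * (1 - u)).
  by rewrite /G bernsteinD bernstein_cst bernsteinZ bernstein_variance; field; rewrite !gt_eqF.
have gG j : `|g (j%:R / n%:R) - g u| <= G j.
  apply: le_trans (gK _ _) _; set d := j%:R / n%:R - u.
  have -> : G j = K * (e + d ^+ 2 / e).
    by rewrite /G /d; field; rewrite !gt_eqF.
  apply: ler_wpM2l => //.
  have [de|/ltW de] := leP `|d| e.
    by rewrite (le_trans de)// lerDl divr_ge0 ?sqr_ge0// ltW.
  apply: (@le_trans _ _ (d ^+ 2 / e)); last by rewrite lerDr ltW.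
  by rewrite ler_pdivlMr// -[d ^+ 2]real_normK ?num_real// expr2 ler_wpM2l.
have EGle : bernstein n G u <= K * (e + (e * n%:R)^-1).
  have -> : K * (e + (e * n%:R)^-1) = K * e + K / e / n%:R * 1.
    by field; rewrite !gt_eqF.
  rewrite EG lerD2l ler_wpM2l//.
    by rewrite !mulr_ge0// invr_ge0 ltW.
  by have [u0 u1] := andP u01; nra.
have L1 : g u <= bernstein n (fun j => g (j%:R / n%:R)) u + bernstein n G u.
  rewrite -bernsteinD -[leLHS](bernstein_cst n _ u); apply: bernstein_le => // j.
  by have := gG j; rewrite ler_norml; lra.
have L2 : bernstein n (fun j => g (j%:R / n%:R)) u <= g u + bernstein n G u.
  rewrite -[g u in leRHS](bernstein_cst n _ u) -bernsteinD; apply: bernstein_le => // j.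
  by have := gG j; rewrite ler_norml; lra.
rewrite ler_norml; lra.
Qed.
End bernstein.

Section laplace_uniqueness.
Context {R : realType}.

Lemma maxr0_lipschitz (p q : R) : `|Num.max 0 p - Num.max 0 q| <= `|p - q|.
Proof.
by rewrite /Num.max; case: ltP => ?; case: ltP => ?; rewrite ?subrr ?normr0//;
  rewrite ler_norml; have [?|?] := ger0P (p - q); lra.
Qed.

Lemma minr1_lipschitz (p q : R) : `|Num.min 1 p - Num.min 1 q| <= `|p - q|.
Proof.
by rewrite /Num.min; case: ltP => ?; case: ltP => ?; rewrite ?subrr ?normr0//;
  rewrite ler_norml; have [?|?] := ger0P (p - q); lra.
Qed.

Local Notation D := (`[0%R, +oo[%classic : set R).

Let mD : measurable D. Proof. exact: measurable_itv. Qed.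

Let u (y : R) := expR (- y).

Let mu_ (A : set R) : measurable_fun A u.
Proof.
by apply: measurableT_comp.
Qed.

Let u01 y : D y -> 0 <= u y <= 1.
Proof.
rewrite /= in_itv/= andbT => y0.
by rewrite expR_ge0 -expR0 ler_expR oppr_le0.
Qed.

Lemma integrable_bounded (m : {measure set R -> \bar R}) (f : R -> R) (M : R) :
  (m D < +oo)%E -> measurable_fun D f -> (forall y, D y -> `|f y| <= M) ->
  m.-integrable D (EFin \o f).
Proof.
move=> mDfin mf fM; apply: measurable_bounded_integrable => //.
exists M; split; first exact: num_real.
by move=> N MN y Dy /=; apply: le_trans (fM _ Dy) _; exact: ltW.
Qed.

Variables m1 m2 : {measure set R -> \bar R}.
Hypotheses (m1fin : (m1 D < +oo)%E) (m2fin : (m2 D < +oo)%E).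
Hypothesis m12 : forall k : nat,
  (\int[m1]_(y in D) (expR (- (k%:R * y)))%:E = \int[m2]_(y in D) (expR (- (k%:R * y)))%:E)%E.

Local Notation I1 f := (Rintegral m1 D f).
Local Notation I2 f := (Rintegral m2 D f).

Let mono j l y := u y ^+ j * (1 - u y) ^+ l.

Let mono_le1 j l y : D y -> `|mono j l y| <= 1.
Proof.
move=> /u01/andP[u0 u1]; rewrite ger0_norm ?mulr_ge0 ?exprn_ge0 ?subr_ge0//.
by rewrite mulr_ile1 ?exprn_ge0 ?exprn_ile1 ?subr_ge0//; lra.
Qed.

Let mmono j l A : measurable_fun A (mono j l).
Proof.
apply: measurable_funM; first by apply: measurable_funX; exact: mu_.
by apply: measurable_funX; apply: measurable_funB => //; exact: mu_.
Qed.

Let mono_eq j l : I1 (mono j l) = I2 (mono j l).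
Proof.
elim: l j => [|l IH] j.
  have E y : mono j 0 y = expR (- (j%:R * y)).
    by rewrite /mono expr0 mulr1 /u -expRM_natl; congr expR; ring.
  by rewrite /Rintegral; under eq_integral do rewrite E; rewrite m12;
     under [in RHS]eq_integral do rewrite E.
have E y : mono j l.+1 y = mono j l y - mono j.+1 l y.
  by rewrite /mono !exprS; ring.
have E' (m : {measure set R -> \bar R}) : Rintegral m D (mono j l.+1) =
    Rintegral m D (fun y => mono j l y - mono j.+1 l y).
  by apply: eq_Rintegral => y _; exact: E.
rewrite !E'.
have i1 j' : m1.-integrable D (EFin \o mono j' l).
  by apply: (@integrable_bounded _ _ 1); [|exact: mmono|exact: mono_le1].
have i2 j' : m2.-integrable D (EFin \o mono j' l).
  by apply: (@integrable_bounded _ _ 1); [|exact: mmono|exact: mono_le1].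
by rewrite RintegralB// RintegralB// !IH.
Qed.

Let bern n f j l y := mono j l y * bernstein n f (u y).

Let mbern n f j l A : measurable_fun A (bern n f j l).
Proof.
apply: measurable_funM; first exact: mmono.
elim: n f => [|n IH] f; first exact: measurable_cst.
by apply: measurable_funD; apply: measurable_funM; first apply: measurable_funB;
  rewrite //; try exact: mu_.
Qed.

Let bern_bound n f : exists M, forall y, D y -> `|bernstein n f (u y)| <= M.
Proof.
elim: n f => [|n IH] f; first by exists `|f 0%N| => y _ /=.
have [M1 H1] := IH f; have [M2 H2] := IH (f \o succn); exists (M1 + M2) => y Dy /=.
have /andP[u0 u1] := u01 _ Dy.
rewrite (le_trans (ler_normD _ _))// lerD// normrM.
- apply: le_trans (H1 _ Dy); rewrite ler_piMl// ger0_norm; lra.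
- by apply: le_trans (H2 _ Dy); rewrite ler_piMl// ger0_norm.
Qed.

Let ibern (m : {measure set R -> \bar R}) n f j l : (m D < +oo)%E ->
  m.-integrable D (EFin \o bern n f j l).
Proof.
move=> mfin; have [M HM] := bern_bound n f.
apply: (@integrable_bounded m _ M); [by []|exact: mbern|].
move=> y Dy; rewrite /bern normrM.
by apply: le_trans (HM _ Dy); rewrite ler_piMl// mono_le1.
Qed.

Let bern_eq n f j l : I1 (bern n f j l) = I2 (bern n f j l).
Proof.
elim: n f j l => [|n IH] f j l.
  have i1 : m1.-integrable D (EFin \o mono j l).
    by apply: (@integrable_bounded _ _ 1); [|exact: mmono|exact: mono_le1].
  have i2 : m2.-integrable D (EFin \o mono j l).
    by apply: (@integrable_bounded _ _ 1); [|exact: mmono|exact: mono_le1].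
  by rewrite /bern/= !RintegralZr// mono_eq.
have E (m : {measure set R -> \bar R}) : Rintegral m D (bern n.+1 f j l) =
    Rintegral m D (fun y => bern n f j l.+1 y + bern n (f \o succn) j.+1 l y).
  by apply: eq_Rintegral => y _; rewrite /bern/mono/= !exprS; ring.
rewrite !E.
by rewrite !RintegralD//; try exact: ibern; rewrite !IH.
Qed.

Let lipschitz_eq (K : R) (g : R -> R) : 0 <= K -> measurable_fun setT g ->
  (forall x y, `|g x - g y| <= K * `|x - y|) -> I1 (g \o u) = I2 (g \o u).
Proof.
move=> K0 mg gK.
have mgu : measurable_fun D (g \o u) by apply: measurableT_comp => //; exact: mu_.
have ig (m : {measure set R -> \bar R}) : (m D < +oo)%E -> m.-integrable D (EFin \o (g \o u)).
  move=> mfin; apply: (@integrable_bounded _ _ (`|g 0| + K)) => // y Dy /=.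
  rewrite -[g _](subrK (g 0)) addrC (le_trans (ler_normD _ _))// lerD2l.
  rewrite (le_trans (gK _ _))// subr0 -[leRHS]mulr1 ler_wpM2l//.
  by have /andP[u0 u1] := u01 _ Dy; rewrite ger0_norm.
pose M1 := fine (m1 D); pose M2 := fine (m2 D).
have approx (m : {measure set R -> \bar R}) (e : R) n : (m D < +oo)%E -> (0 < n)%N -> 0 < e ->
    `|Rintegral m D (g \o u) - Rintegral m D (bern n (fun j => g (j%:R / n%:R)) 0 0)|
    <= K * (e + (e * n%:R)^-1) * fine (m D).
  move=> mfin n0 e0.
  set B := bern n _ 0 0.
  have iB : m.-integrable D (EFin \o B) by exact: ibern.
  rewrite -RintegralB//; last exact: ig.
  have idiff : m.-integrable D (EFin \o (fun y => (g \o u) y - B y)).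
    rewrite (_ : _ \o _ = ((EFin \o (g \o u)) \- (EFin \o B))%E); last first.
      by apply/funext => y /=; rewrite EFinB.
    by apply: integrableB => //; exact: ig.
  rewrite (le_trans (le_normr_Rintegral _ _))//.
  rewrite -[leRHS]Rintegral_cst//.
  apply: le_Rintegral => //.
  - exact: integrable_norm.
  - by apply: (@integrable_bounded _ _ `|K * (e + (e * n%:R)^-1)|).
  - move=> y Dy; rewrite /B /bern /mono !expr0 !mul1r distrC.
    exact: bernstein_lipschitz (u01 _ Dy) gK.
apply/eqP; rewrite -subr_eq0 -normr_le0; apply/ler_addgt0Pl => e e0; rewrite addr0.
pose M := K * (M1 + M2) + 1.
have M10 : 0 <= M1 by exact: fine_ge0.
have M20 : 0 <= M2 by exact: fine_ge0.
have M0 : 0 < M by rewrite ltr_wpDl// mulr_ge0// addr_ge0.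
have [e' e'0 eE] : exists2 e', 0 < e' & e = 2 * e' * M.
  exists (e / (2 * M)); first by rewrite divr_gt0// mulr_gt0.
  by field; rewrite gt_eqF.
pose n := (Num.truncn (e' ^+ 2)^-1).+1.
have n0 : (0 < n)%N by [].
have ne : (e' * n%:R)^-1 <= e'.
  have := truncnS_gt (e' ^+ 2)^-1; rewrite -/n => H.
  have n0' : 0 < n%:R :> R by rewrite ltr0n.
  have H2 : 1 <= e' ^+ 2 * n%:R by rewrite -ler_pdivrMl ?exprn_gt0// mulr1 ltW.
  rewrite -[leLHS]div1r ler_pdivrMr ?mulr_gt0//.
  by have -> : e' * (e' * n%:R) = e' ^+ 2 * n%:R by ring.
have A1 := approx m1 e' n m1fin n0 e'0.
have A2 := approx m2 e' n m2fin n0 e'0.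
move: A1 A2; rewrite bern_eq; set J := Rintegral m2 D (bern _ _ _ _) => A1 A2.
have -> : I1 (g \o u) - I2 (g \o u) = (I1 (g \o u) - J) - (I2 (g \o u) - J) by ring.
rewrite (le_trans (ler_normB _ _))// (le_trans (lerD A1 A2))// -mulrDr -/M1 -/M2.
apply: (@le_trans _ _ (2 * e' * (K * (M1 + M2)))).
  rewrite mulrAC mulrC; apply: ler_wpM2r; first by rewrite mulr_ge0// addr_ge0.
  lra.
by rewrite eE ler_wpM2l ?mulr_ge0 ?(ltW e'0)// lerDl.
Qed.

Let half_line_eq a : m1 (D `&` `]-oo, a[) = m2 (D `&` `]-oo, a[).
Proof.
pose c := expR (- a).
pose g (k : nat) (x : R) := Num.min 1 (k%:R * Num.max 0 (x - c)).
have mg k : measurable_fun setT (g k).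
  apply: measurable_minr => //; apply: measurable_funM => //.
  by apply: measurable_maxr => //; apply: measurable_funB => //; exact: measurable_id.
have g0 k x : 0 <= g k x by rewrite le_min ler01 mulr_ge0// le_max lexx.
have g1 k x : g k x <= 1 by rewrite ge_min lexx.
have g_nd x : {homo g ^~ x : k l / (k <= l)%N >-> k <= l}.
  move=> k l kl; rewrite le_min ge_min lexx/= ge_min; apply/orP; right.
  by rewrite ler_wpM2r ?le_max ?lexx// ler_nat.
have gK k x y : `|g k x - g k y| <= k%:R * `|x - y|.
  apply: (le_trans (minr1_lipschitz _ _)); rewrite -mulrBr normrM ger0_norm//.
  apply: ler_wpM2l => //; apply: (le_trans (maxr0_lipschitz _ _)).
  by rewrite opprB addrA subrK.
have mgu k : measurable_fun D (g k \o u) by apply: measurableT_comp => //; exact: mu_.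
have ge k : (\int[m1]_(y in D) (g k (u y))%:E = \int[m2]_(y in D) (g k (u y))%:E)%E.
  have ig (m : {measure set R -> \bar R}) : (m D < +oo)%E -> m.-integrable D (EFin \o (g k \o u)).
    move=> mfin; apply: (@integrable_bounded _ _ 1) => // y _ /=.
    by rewrite ger0_norm.
  have := @lipschitz_eq k%:R (g k) (ler0n _ _) (mg k) (gK k).
  rewrite /Rintegral => E.
  rewrite -[LHS]fineK ?E ?fineK//; apply: integrable_fin_num => //; exact: ig.
have lim (m : {measure set R -> \bar R}) :
   (\int[m]_(y in D) (g k (u y))%:E @[k --> \oo] --> m (D `&` `]-oo, a[))%E.
  have -> : m (D `&` `]-oo, a[) = (\int[m]_(y in D) limn (fun k => (g k (u y))%:E))%E.
    transitivity (\int[m]_(y in D) (\1_(`]-oo, a[%classic : set R) y)%:E)%E.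
      by rewrite integral_indic// setIC.
    apply: eq_integral => y _; apply/esym/cvg_lim => //.
    have [ya|ya] := ltP y a; last first.
      rewrite indicE memNset /=; last by rewrite in_itv/= ltNge ya.
      rewrite (_ : (fun k => _) = cst 0%E); first exact: cvg_cst.
      apply/funext => k; rewrite /g max_l ?mulr0 ?min_r//.
      by rewrite subr_le0 /u /c ler_expR lerN2.
    rewrite indicE mem_set /=; last by rewrite in_itv/=.
    have uc : 0 < u y - c by rewrite subr_gt0 /u /c ltr_expR ltrN2.
    apply: cvg_near_cst; exists (Num.truncn (u y - c)^-1).+1 => // k /= kn.
    congr EFin; rewrite /g max_r ?(ltW uc)// min_l//.
    rewrite -ler_pdivrMr// div1r (le_trans (ltW (truncnS_gt _)))// ler_nat//.
  apply: cvg_monotone_convergence => //.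
  - by move=> k; apply/measurable_EFinP; exact: mgu.
  - by move=> k y _; rewrite lee_fin.
  - by move=> y _ k l kl; rewrite lee_fin; exact: g_nd.
have := lim m1; rewrite (eq_cvg _ _ ge) => l1.
exact: (cvg_unique _ l1 (lim m2)).
Qed.

Theorem laplace_unique A : measurable A -> m1 (D `&` A) = m2 (D `&` A).
Proof.
move=> mA.
pose r1 : {measure set R -> \bar R} := mrestr m1 mD.
pose r2 : {measure set R -> \bar R} := mrestr m2 mD.
rewrite ![D `&` A]setIC; change (r1 A = r2 A).
apply: (measure_unique (@RGenInftyO.G R) (fun k : nat => `]-oo, (k%:R : R)[%classic : set R)) => //.
- exact: RGenInftyO.measurableE.
- move=> _ _ [x ->] [y ->]; exists (Num.min x y); apply/seteqP; split => z /=;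
    by rewrite !in_itv/= lt_min => /andP.
- by move=> k; exists k%:R.
- apply/seteqP; split => // z _; exists (Num.truncn `|z|).+1 => //=; rewrite in_itv/=.
  by rewrite (le_lt_trans (ler_norm _))// truncnS_gt.
- by move=> B [x ->]; rewrite /r1 /r2 /= /mrestr ![_ `&` D]setIC half_line_eq.
- move=> k; rewrite /r1/= /mrestr (le_lt_trans _ m1fin)// le_measure// inE//.
  by apply: measurableI => //; exact: measurable_itv.
Qed.

End laplace_uniqueness.

Section exponential_tail.
Context {R : realType}.
Local Notation leb := (@lebesgue_measure R).

Lemma integral_expR_tail (c : R) :
  (\int[leb]_v (if c <= v then expR (- v) else 0)%:E = (expR (- c))%:E)%E.
Proof.
have me : measurable_fun setT (fun v : R => (if c <= v then expR (- v) else 0)%:E).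
  apply/measurable_EFinP; apply: measurable_fun_ifT => //.
  - by apply: measurable_fun_ler.
  - by apply: measurableT_comp.
have pos v : (0 <= (if c <= v then expR (- v) else 0)%:E)%E.
  by case: ifP => // _; rewrite lee_fin expR_ge0.
rewrite -(ge0_integral_shift c)//.
transitivity (\int[leb]_x ((expR (- c))%:E * ((fun x => (expR (- (1 * x)))%:E) \_ (`[0%R, +oo[%classic : set R)) x))%E.
  apply: eq_integral => v _; rewrite patchE lerDr.
  case: ifPn => v0; last first.
    by rewrite memNset ?mule0//= in_itv/= andbT; exact/negP.
  by rewrite mem_set/= ?in_itv/= ?v0// -EFinM -expRD mul1r addrC opprD.
rewrite ge0_integralZl_EFin ?expR_ge0//.
- by rewrite -integral_mkcond integral_expR_itv// invr1 mule1.
- by move=> x _; apply: erestrict_ge0 => y _; rewrite lee_fin expR_ge0.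
- have mD : measurable (`[0%R, +oo[%classic : set R) by exact: measurable_itv.
  apply/(measurable_restrictT _ mD).
  apply/measurable_EFinP; apply: measurableT_comp => //.
  by apply: measurable_funN; apply: measurable_funM => //; exact: measurable_id.
Qed.

Variable nu : {finite_measure set R -> \bar R}.
Hypothesis nu1 : forall c : R, nu [set c] = 0%E.

Let A := fine (nu setT).
Let K (s : R) := fine (nu (`[s, +oo[%classic : set R)).

Let mitv (i : interval R) : measurable ([set` i] : set R).
Proof. exact: measurable_itv. Qed.

Let KE s : (K s)%:E = nu (`[s, +oo[%classic : set R).
Proof. by rewrite /K fineK// fin_num_measure. Qed.

Let AE : A%:E = nu setT.
Proof. by rewrite /A fineK// fin_num_measure. Qed.

Let K_ge0 s : 0 <= K s. Proof. exact: fine_ge0. Qed.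

Let K_noninc s t : s <= t -> K t <= K s.
Proof.
move=> st; rewrite -lee_fin !KE le_measure ?inE//.
by move=> x /=; rewrite !in_itv/= !andbT; exact: le_trans.
Qed.

Let measurable_K : measurable_fun setT K.
Proof.
rewrite (_ : K = fun s => - (- K s)); last by apply/funext => s; rewrite opprK.
apply: measurable_funN; apply: nondecreasing_measurable => // s t st.
by rewrite lerN2; exact: K_noninc.
Qed.

Let tail_measure v : 0 < v -> nu [set s | K s <= v] = (Num.min v A)%:E.
Proof.
move=> v0.
have [Av|vA] := leP A v.
  rewrite AE; congr (nu _); apply/seteqP; split => // s _ /=.
  apply: le_trans Av; rewrite -lee_fin KE AE.
  by apply: le_measure; rewrite ?inE.
pose S : set R := [set s | K s <= v].
have mS : measurable S.
  rewrite [S](_ : _ = setT `&` (fun s => K s <= v) @^-1` [set true]); last first.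
    by apply/seteqP; split => s /=; rewrite /S/=; tauto.
  by apply: measurable_fun_ler.
have Sup s t : S s -> s <= t -> S t.
  by rewrite /S/= => Ss st; apply: le_trans Ss; exact: K_noninc.
have S0 : S !=set0.
  have : nu \o (fun n : nat => `[n%:R, +oo[%classic : set R) @ \oo --> nu (\bigcap_n (`[n%:R, +oo[%classic : set R)).
    apply: nonincreasing_cvg_mu => //.
    - by rewrite -ge0_fin_numE// fin_num_measure.
    - exact: bigcapT_measurable.
    - move=> m n mn; apply/subsetPset => x /=; rewrite !in_itv/= !andbT.
      by apply: le_trans; rewrite ler_nat.
  rewrite (_ : \bigcap_n _ = set0) ?measure0; last first.
    apply/seteqP; split => // x /(_ (Num.truncn `|x|).+1 Logic.I) /=.
    rewrite in_itv/= andbT => /(le_trans)/(_ (ler_norm x)).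
    by rewrite leNgt truncnS_gt.
  move=> /fine_cvgP[_] /cvgrPdist_lt/(_ _ v0)[N _ /(_ N (leqnn N))] /=.
  by rewrite sub0r normrN => H; exists N%:R; rewrite /S/= ltW// (le_lt_trans (ler_norm _) H).
have lS : has_lbound S.
  have : nu \o (fun n : nat => `[- n%:R, +oo[%classic : set R) @ \oo --> nu (\bigcup_n (`[- n%:R, +oo[%classic : set R)).
    apply: nondecreasing_cvg_mu => //.
    - exact: bigcupT_measurable.
    - move=> m n mn; apply/subsetPset => x /=; rewrite !in_itv/= !andbT.
      by apply: le_trans; rewrite lerN2 ler_nat.
  rewrite (_ : \bigcup_n _ = setT); last first.
    apply/seteqP; split => // x _; exists (Num.truncn `|x|).+1 => //=.
    by rewrite in_itv/= andbT lerNl (le_trans (ler_norm _))// normrN ltW// truncnS_gt.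
  rewrite -AE => /fine_cvgP[_] /cvgrPdist_lt/(_ (A - v)).
  rewrite subr_gt0 => /(_ vA)[N _ /(_ N (leqnn N))] /= H.
  exists (- N%:R) => s Ss; rewrite leNgt; apply/negP => sN.
  have KN : K (- N%:R) <= v by apply: Sup Ss (ltW sN).
  move: H; rewrite -/(K _) => H.
  by have := le_lt_trans (ler_norm _) H; lra.
pose c := inf S.
have cS s : c < s -> S s.
  move=> cs; have [t St tc] : exists2 t, S t & t < s by exact: inf_lt.
  by apply: Sup St (ltW tc).
have Sc s : S s -> c <= s by move=> Ss; exact: ge_inf.
have sub1 : (`]c, +oo[%classic : set R) `<=` S.
  by move=> s /=; rewrite in_itv/= andbT => /cS.
have sub2 : S `<=` (`[c, +oo[%classic : set R).
  by move=> s Ss /=; rewrite in_itv/= andbT Sc.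
have nuc : nu (`[c, +oo[%classic : set R) = nu (`]c, +oo[%classic : set R).
  rewrite -(@setU1itv _ _ +oo%O c false)// measureU//.
  - by rewrite [X in (X + _)%E]nu1 add0e.
  - by apply/seteqP; split => // x /= [->]; rewrite in_itv/= ltxx.
apply/eqP; rewrite eq_le; apply/andP; split.
  have : nu \o (fun n : nat => `[c + n.+1%:R^-1, +oo[%classic : set R) @ \oo --> nu (\bigcup_n (`[c + n.+1%:R^-1, +oo[%classic : set R)).
    apply: nondecreasing_cvg_mu => //.
    - exact: bigcupT_measurable.
    - move=> m n mn; apply/subsetPset => x /=; rewrite !in_itv/= !andbT.
      by apply: le_trans; rewrite lerD2l lef_pV2 ?posrE// ler_nat.
  move=> H.
  apply: (@le_trans _ _ (nu (`]c, +oo[%classic : set R))).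
    by rewrite -nuc le_measure ?inE.
  have -> : (`]c, +oo[%classic : set R) = \bigcup_n (`[c + n.+1%:R^-1, +oo[%classic : set R).
    apply/seteqP; split => x /=.
      rewrite in_itv/= andbT => cx; exists (Num.truncn (x - c)^-1) => //=.
      rewrite in_itv/= andbT -lerBrDl invf_ple ?posrE ?subr_gt0//.
      by rewrite ltW// truncnS_gt.
    by move=> [n _ /=]; rewrite !in_itv/= !andbT; apply: lt_le_trans; rewrite ltrDl.
  rewrite -(cvg_lim _ H)//; apply: lime_le; first exact: cvgP H.
  apply: nearW => n /=; rewrite -KE lee_fin; apply: (cS).
  by rewrite ltrDl.
have : nu \o (fun n : nat => `[c - n.+1%:R^-1, +oo[%classic : set R) @ \oo --> nu (\bigcap_n (`[c - n.+1%:R^-1, +oo[%classic : set R)).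
  apply: nonincreasing_cvg_mu => //.
  - by rewrite -ge0_fin_numE// fin_num_measure.
  - exact: bigcapT_measurable.
  - move=> m n mn; apply/subsetPset => x /=; rewrite !in_itv/= !andbT.
    by apply: le_trans; rewrite lerD2l lerN2 lef_pV2 ?posrE// ler_nat.
have -> : \bigcap_n (`[c - n.+1%:R^-1, +oo[%classic : set R) = (`[c, +oo[%classic : set R).
  apply/seteqP; split => x /=.
    move=> H; rewrite in_itv/= andbT leNgt; apply/negP => xc.
    have := H (Num.truncn (c - x)^-1) Logic.I; rewrite /= in_itv/= andbT.
    rewrite lerBlDl -lerBlDr leNgt => /negP; apply.
    by rewrite invf_plt ?posrE ?subr_gt0// truncnS_gt.
  rewrite !in_itv/= !andbT => cx n _ /=; rewrite in_itv/= andbT.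
  by rewrite lerBlDr (le_trans cx)// lerDl.
move=> H.
apply: (@le_trans _ _ (nu (`[c, +oo[%classic : set R))); last first.
  by rewrite nuc le_measure ?inE.
rewrite -(cvg_lim _ H)//; apply: lime_ge; first exact: cvgP H.
apply: nearW => n /=.
rewrite -KE lee_fin leNgt; apply/negP => Hn.
have := Sc _ (ltW Hn); rewrite leNgt => /negP; apply.
by rewrite ltrBlDr ltrDl.
Qed.

Lemma integral_expR_tail_measure :
  (\int[nu]_s (expR (- fine (nu (`[s, +oo[%classic : set R))))%:E =
   (1 - expR (- fine (nu setT)))%:E)%E.
Proof.
rewrite -/A; under eq_integral do rewrite -/(K _).
have mfK : measurable_fun setT (fun z : R * R => (if K z.1 <= z.2 then expR (- z.2) else 0)%:E).
  apply/measurable_EFinP; apply: measurable_fun_ifT => //.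
  - apply: measurable_fun_ler => //.
    by apply: measurableT_comp => //; exact: measurable_K.
  - by apply: measurableT_comp => //; apply: measurable_funN.
have mfA : measurable_fun setT (fun z : R * R => (if z.1 <= z.2 then expR (- z.2) else 0)%:E *
    (\1_(`[0%R, A]%classic : set R) z.1)%:E)%E.
  apply: emeasurable_funM.
    apply/measurable_EFinP; apply: measurable_fun_ifT => //.
    - exact: measurable_fun_ler.
    - by apply: measurableT_comp => //; apply: measurable_funN.
  apply/measurable_EFinP.
  exact: (measurableT_comp (measurable_indic (mitv _)) measurable_fst).
have fK0 z : (0 <= (if K z.1 <= z.2 then expR (- z.2) else 0)%:E :> \bar R)%E.
  by case: ifP => // _; rewrite lee_fin expR_ge0.
have fA0 z : (0 <= (if z.1 <= z.2 then expR (- z.2) else 0)%:E * (\1_(`[0%R, A]%classic : set R) z.1)%:E :> \bar R)%E.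
  by apply: mule_ge0; [case: ifP => // _; rewrite lee_fin expR_ge0|rewrite lee_fin].
have A0 : 0 <= A by exact: fine_ge0.
transitivity (\int[leb]_v (if (0 < v)%R then (expR (- v) * Num.min v A)%:E else 0))%E.
  under eq_integral do rewrite -integral_expR_tail.
  have H (v : R) : v != 0 -> (\int[nu]_s (if K s <= v then expR (- v) else 0)%:E =
      if (0 < v)%R then (expR (- v) * Num.min v A)%:E else 0)%E.
  move=> v0; rewrite (eq_integral (fun s => (expR (- v))%:E * (\1_[set s | K s <= v] s)%:E)%E); last first.
    move=> s _; rewrite indicE; case: ifPn => sv.
      by rewrite mem_set// mule1.
    by rewrite memNset ?mule0//; exact/negP.
  have mS : measurable [set s | K s <= v].
    rewrite (_ : [set s | _] = setT `&` (fun s => K s <= v) @^-1` [set true]); last first.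
      by apply/seteqP; split => s /=; tauto.
    by apply: measurable_fun_ler.
  rewrite ge0_integralZl_EFin ?expR_ge0//; last first.
    by apply/measurable_EFinP; exact: measurable_indic.
  rewrite integral_indic// setIT.
  have [vgt0|vle0] := ltP 0 v.
    by apply: (etrans (congr1 (fun t => (expR (- v))%:E * t)%E (tail_measure v vgt0))); rewrite EFinM.
  rewrite (_ : [set s | K s <= v] = set0) ?measure0 ?mule0//.
  apply/seteqP; split => // s /= Ks.
  by have := K_ge0 s; move/eqP: v0; lra.
  apply: (etrans (@fubini_tonelli _ _ _ _ R nu leb _ mfK fK0)) => /=.
  apply: ae_eq_integral => //.
  - exact: (measurable_fun_fubini_tonelli_G (fun z : R * R => (if K z.1 <= z.2 then expR (- z.2) else 0)%:E)).
  - apply: measurable_fun_ifT => //; first exact: measurable_fun_ltr.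
    apply/measurable_EFinP; apply: measurable_funM; first by apply: measurableT_comp.
    by apply: measurable_minr.
  exists ([set 0%R] : set R); split; [exact: measurable_set1|exact: lebesgue_measure_set1|].
  by move=> v /= /not_implyP[_]; apply: contra_notP => /eqP/H.
have <- : (\int[leb]_(c in `[0%R, A]) (expR (- c))%:E)%E = (1 - expR (- A))%:E.
  move: A0; rewrite le_eqVlt => /predU1P[<-|A0].
    by rewrite set_itv1 integral_set1 oppr0 expR0 subrr.
  rewrite EFinB -[A in RHS]mul1r -mulNr -exponential_prob_itv0c// /exponential_prob.
  apply: eq_integral => c; rewrite inE/= in_itv/= => /andP[c0 _].
  by rewrite exponential_pdfE// mul1r mulN1r.
have H2 (v : R) : (\int[leb]_c ((if c <= v then expR (- v) else 0)%:E * (\1_(`[0%R, A]%classic : set R) c)%:E) =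
    if (0 < v)%R then (expR (- v) * Num.min v A)%:E else 0)%E.
  transitivity (\int[leb]_c ((expR (- v))%:E * (\1_(`[0%R, Num.min v A]%classic : set R) c)%:E))%E.
    apply: eq_integral => c _; rewrite !indicE !mem_setE !in_itv/= le_min.
    by case: (c <= v); rewrite ?mul0e ?andbF ?mule0//=.
  rewrite ge0_integralZl_EFin ?expR_ge0//; last first.
    by apply/measurable_EFinP; apply: measurable_indic.
  rewrite integral_indic// setIT.
  rewrite [X in (_ * X)%E](lebesgue_measure_itv `[0%R, Num.min v A]) /= lte_fin lt_min.
  have [v0|v0] := ltP 0 v; last by rewrite mule0.
  move: A0; rewrite le_eqVlt => /predU1P[<-|->] /=.
    by rewrite ltxx mule0 min_r ?(ltW v0)// mulr0.
  by rewrite -EFinB subr0 -EFinM.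
transitivity (\int[leb]_c \int[leb]_v ((if c <= v then expR (- v) else 0)%:E *
    (\1_(`[0%R, A]%classic : set R) c)%:E))%E; last first.
  rewrite [RHS]integral_mkcond; apply: eq_integral => c _; rewrite ge0_integralZr//; last 2 first.
  - apply/measurable_EFinP; apply: measurable_fun_ifT => //.
    + by apply: measurable_fun_ler.
    + by apply: measurableT_comp.
  - by move=> v _; case: ifP => // _; rewrite lee_fin expR_ge0.
  rewrite integral_expR_tail patchE indicE.
  by case: ifP => _; rewrite ?mule1 ?mule0.
apply: (etrans _ (esym (@fubini_tonelli _ _ _ _ R leb leb _ mfA fA0))) => /=.
by apply: eq_integral => v _; rewrite H2.
Qed.

End exponential_tail.

(** * Path space and the Markov property *)

Section path_space.
Context {R : realType}.

Definition cylinder (I : Type) : set (set (I -> R)) :=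
  [set C | exists n (t : nat -> I) (B : nat -> set R),
    (forall i, measurable (B i)) /\
    C = [set e | forall i, (i < n)%N -> B i (e (t i))]].

Definition path_space (I : Type) := g_sigma_algebraType (cylinder I).

HB.instance Definition _ (I : Type) := Measurable.on (path_space I).

Lemma cylinderT (I : Type) (i0 : I) : cylinder I setT.
Proof.
exists 0%N, (fun=> i0), (fun=> setT); split; first by move=> _; exact: measurableT.
by apply/seteqP; split.
Qed.

Lemma cylinderI (I : Type) : setI_closed (cylinder I).
Proof.
move=> _ _ [n1 [t1 [B1 [mB1 ->]]]] [n2 [t2 [B2 [mB2 ->]]]].
exists (n1 + n2)%N, (fun i => if (i < n1)%N then t1 i else t2 (i - n1)%N),
  (fun i => if (i < n1)%N then B1 i else B2 (i - n1)%N).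
split; first by move=> i; case: ifP.
apply/seteqP; split => e /=.
  move=> [H1 H2] i ilt; case: ifPn => i1; first exact: H1.
  by apply: H2; rewrite -leqNgt in i1; rewrite ltn_subLR.
move=> H; split => i ilt.
  by have := H i (ltn_addr _ ilt); rewrite ilt.
have := H (n1 + i)%N; rewrite ltn_add2l => /(_ ilt).
by rewrite ltnNge leq_addr/= addKn.
Qed.

Lemma measurable_eval (I : Type) (t : I) :
  measurable_fun setT (fun e : path_space I => (e t : R)).
Proof.
move=> _ B mB; rewrite setTI; apply: sub_sigma_algebra.
exists 1%N, (fun=> t), (fun=> B); split => //.
apply/seteqP; split => e /=; first by move=> ? [].
by move=> /(_ 0%N isT).
Qed.

Lemma measurable_to_path_space (I : Type) d (T : measurableType d)
    (f : T -> path_space I) :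
  (forall t, measurable_fun setT (fun w => (f w t : R))) -> measurable_fun setT f.
Proof.
move=> mf; apply: (@measurability _ _ T (path_space I) setT f (cylinder I) erefl).
move=> _ [_ [n [t [B [mB ->]]]] <-]; rewrite setTI.
rewrite (_ : _ @^-1` _ = \bigcap_i (if (i < n)%N then (fun w => f w (t i)) @^-1` B i else setT)).
  apply: bigcapT_measurable => i; case: ifP => // _.
  by rewrite -[X in measurable X]setTI; exact: mf.
apply/seteqP; split => w /= H i.
  by move=> _; case: ifP => // ilt; exact: H.
by move=> ilt; have := H i Logic.I; rewrite ilt.
Qed.

Let rectangles (I J : Type) : set (set (path_space I * path_space J)) :=
  [set X | exists2 A, cylinder I A & exists2 B, cylinder J B & X = A `*` B].

Lemma measurable_path_prod (I J : Type) (i0 : I) (j0 : J) :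
  @measurable _ (path_space I * path_space J)%type = <<s rectangles I J >>.
Proof.
rewrite eqEsubset; split; last first.
  apply: smallest_sub; first exact: sigma_algebra_measurable.
  by move=> _ [A cA [B cB ->]]; apply: measurableX; exact: sub_sigma_algebra.
pose G := g_sigma_algebraType (rectangles I J).
have m1 : measurable_fun setT (fst : G -> path_space I).
  apply: (@measurability _ _ G (path_space _) setT _ (cylinder _) erefl).
  move=> _ [A cA <-]; rewrite setTI; apply: sub_sigma_algebra.
  exists A => //; exists setT; first exact: cylinderT.
  by apply/seteqP; split => // -[a b] [].
have m2 : measurable_fun setT (snd : G -> path_space J).
  apply: (@measurability _ _ G (path_space _) setT _ (cylinder _) erefl).
  move=> _ [A cA <-]; rewrite setTI; apply: sub_sigma_algebra.
  exists setT; first exact: cylinderT.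
  exists A => //.
  by apply/seteqP; split => // -[a b] [].
apply: smallest_sub; first exact: smallest_sigma_algebra.
rewrite subUset; split.
- by move=> _ [A mA <-]; exact: m1.
- by move=> _ [A mA <-]; exact: m2.
Qed.

Lemma path_prod_measure_unique (I J : Type) (i0 : I) (j0 : J)
    (m1 m2 : {measure set (path_space I * path_space J) -> \bar R}) :
  (m1 setT < +oo)%E ->
  (forall A B, cylinder I A -> cylinder J B -> m1 (A `*` B) = m2 (A `*` B)) ->
  forall X, measurable X -> m1 X = m2 X.
Proof.
move=> m1fin m12 X mX.
apply: (@measure_unique _ R _ (rectangles I J) (fun=> setT)) => //.
- exact: measurable_path_prod.
- move=> _ _ [A cA [B cB ->]] [A' cA' [B' cB' ->]].
  exists (A `&` A'); first exact: cylinderI.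
  exists (B `&` B'); first exact: cylinderI.
  by rewrite setXI.
- move=> _; exists setT; first exact: cylinderT.
  by exists setT; [exact: cylinderT|rewrite setXTT].
- by apply/seteqP; split => // x _; exists 0%N.
- by move=> _ [A cA [B cB ->]]; exact: m12.
Qed.

End path_space.

Lemma time_grid {R : realType} (n : nat) (u : nat -> R) :
  (forall i, (i < n)%N -> 0 <= u i) ->
  exists t : nat -> R, [/\ t 0%N = 0, forall i, t i < t i.+1 &
    forall i, (i < n)%N -> exists a, u i = t a].
Proof.
move=> u0.
pose l := sort <=%O (undup (0 :: mkseq u n)).
have lsort : sorted <%O l by rewrite sort_lt_sorted undup_uniq.
have meml x : (x \in l) = (x \in 0 :: mkseq u n) by rewrite mem_sort mem_undup.
have l_ge0 x : x \in l -> 0 <= x.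
  rewrite meml inE => /predU1P[->//|/mapP[i]].
  by rewrite mem_iota add0n => /andP[_ /u0 +] ->.
have l0 : 0 \in l by rewrite meml inE eqxx.
have szl : (0 < size l)%N by case: (l) l0.
pose t i := if (i < size l)%N then nth 0 l i else nth 0 l (size l).-1 + (i - size l).+1%:R.
have nth0l : nth 0 l 0 = 0.
  apply/eqP; rewrite eq_le l_ge0 ?mem_nth// andbT.
  rewrite -[leRHS](nth_index 0 l0) lt_sorted_leq_nth// inE ?index_mem//.
exists t; split.
- by rewrite /t szl.
- move=> i; rewrite /t; have [il|il] := ltnP i.+1 (size l).
    by rewrite (ltn_trans (ltnSn i) il) lt_sorted_ltn_nth// inE// (ltn_trans (ltnSn i) il).
  have [il'|il'] := ltnP i (size l).
    have -> : i = (size l).-1 by apply/eqP; rewrite -eqSS prednK// eqn_leq il il'.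
    by rewrite prednK// subnn ltrDl.
  by rewrite ltrD2l ltr_nat subSn.
- move=> i ilt; have ul : u i \in l.
    by rewrite meml inE; apply/orP; right; apply/mapP; exists i => //; rewrite mem_iota.
  by exists (index (u i) l); rewrite /t index_mem ul nth_index.
Qed.

Section markov.
Context {R : realType} {d : measure_display} {T : measurableType d}.
Variables (P : probability T R) (X : R -> T -> R) (Ps : R -> R).
Hypothesis HX : levy_process P X Ps.

Lemma levy_measurable t : measurable_fun setT (X t).
Proof. by case: HX => + _; exact. Qed.

Lemma levy0 w : X 0 w = 0.
Proof. by case: HX => _ [+ _]; exact. Qed.

Lemma measurable_incr u v : measurable_fun setT (incr X u v).
Proof. by apply: measurable_funB; exact: levy_measurable. Qed.

Lemma levy_stationary s t (B : set R) : 0 <= s -> s <= t -> measurable B ->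
  P (incr X s t @^-1` B) = P (X (t - s) @^-1` B).
Proof.
move=> s0 st mB; case: HX => _ [_ [_ [_ [+ _]]]] => /(_ s (t - s) B s0).
by rewrite subr_ge0 => /(_ st mB); rewrite addrC subrK.
Qed.

Lemma levy_indep n (t : nat -> R) (B : nat -> set R) :
  0 <= t 0%N -> (forall i, t i < t i.+1) -> (forall i, measurable (B i)) ->
  P [set w | forall i, (i < n)%N -> B i (incr X (t i) (t i.+1) w)] =
  (\prod_(i < n) P (X (t i.+1 - t i) @^-1` B i))%E.
Proof.
move=> t0 tS mB; case: HX => _ [_ [_ [_ [_ [+ _]]]]] => /(_ n t B t0 tS mB) H.
have tge0 i : 0 <= t i by elim: i => [//|i IH]; rewrite (le_trans IH)// ltW.
rewrite (_ : [set w | _] = \bigcap_(i in `I_n) (incr X (t i) (t i.+1) @^-1` B i))//.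
rewrite H; apply: eq_bigr => i _.
by rewrite levy_stationary// ltW.
Qed.

Section blocks.
Variables (t : nat -> R) (K : nat).
Hypotheses (t0 : t 0%N = 0) (tS : forall i, t i < t i.+1).

Let t_homo : {homo t : i j / (i <= j)%N >-> i <= j}.
Proof. by apply: homo_leq => [//|x y z|i]; [exact: le_trans|exact: ltW]. Qed.

Let head (w : T) : path_space nat :=
  fun i => if (i < K)%N then incr X (t i) (t i.+1) w else 0.
Let tail (w : T) : path_space nat :=
  fun j => incr X (t (K + j)) (t (K + j).+1) w.
Let tail0 (w : T) : path_space nat :=
  fun j => incr X (t (K + j)%N - t K) (t (K + j.+1)%N - t K) w.

Let mhead : measurable_fun setT head.
Proof.
apply: measurable_to_path_space => i; rewrite /head.
by case: (i < K)%N => //; exact: measurable_incr.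
Qed.
Let mtail : measurable_fun setT tail.
Proof. by apply: measurable_to_path_space => i; exact: measurable_incr. Qed.
Let mtail0 : measurable_fun setT tail0.
Proof. by apply: measurable_to_path_space => i; exact: measurable_incr. Qed.

Let cond (n : nat) (tau : nat -> nat) (A : nat -> set R) (k : nat) : set R :=
  [set x | forall i, (i < n)%N -> tau i = k -> A i x].

Let mcond n tau A k : (forall i, measurable (A i)) -> measurable (cond n tau A k).
Proof.
move=> mA.
rewrite (_ : cond _ _ _ _ = \bigcap_i (if ((i < n)%N && (tau i == k)) then A i else setT)).
  by apply: bigcapT_measurable => i; case: ifP.
apply/seteqP; split => x /= H i.
  by move=> _; case: ifP => // /andP[ilt /eqP]; exact: H.
by move=> ilt /eqP ik; have := H i Logic.I; rewrite ilt ik.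
Qed.

Let blocks_cylinder A C : cylinder nat A -> cylinder nat C ->
  P (head @^-1` A `&` tail @^-1` C) = (P (head @^-1` A) * P (tail0 @^-1` C))%E.
Proof.
move=> [n [tau [A' [mA ->]]]] [m [sg [C' [mC ->]]]].
pose N := (\max_(j < m) sg j).+1.
pose cA := cond n tau A'; pose cC := cond m sg C'.
have sgN j : (j < m)%N -> (sg j < N)%N.
  by move=> jm; rewrite ltnS; exact: (leq_bigmax (Ordinal jm)).
pose b := forall i, (i < n)%N -> (K <= tau i)%N -> A' i 0.
have headE w : (forall i, (i < n)%N -> A' i (head w (tau i))) <->
    b /\ forall k, (k < K)%N -> cA k (incr X (t k) (t k.+1) w).
  split.
    move=> H; split=> [i ilt Ki|k kK i ilt tk].
      by have := H i ilt; rewrite /head ltnNge Ki.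
    by have := H i ilt; rewrite /head tk kK.
  move=> [H1 H2] i ilt; rewrite /head; case: ifPn => tK; first exact: (H2 _ tK).
  by apply: H1; rewrite // leqNgt.
have tailE (g : T -> nat -> R) w : (forall j, (j < m)%N -> C' j (g w (sg j))) <->
    forall k, (k < N)%N -> cC k (g w k).
  split; first by move=> H k kN j jm <-; exact: H.
  by move=> H j jm; apply: (H _ (sgN _ jm)).
have [bT|bF] := pselect b; last first.
  rewrite (_ : head @^-1` _ = set0) ?set0I ?measure0 ?mul0e//.
  by apply/seteqP; split => // w /= /headE[].
pose D i := if (i < K)%N then cA i else cC (i - K)%N.
have mD i : measurable (D i) by rewrite /D; case: ifP => _; exact: mcond.
have -> : head @^-1` [set e | forall i, (i < n)%N -> A' i (e (tau i))] =
    [set w | forall k, (k < K)%N -> cA k (incr X (t k) (t k.+1) w)].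
  by apply/seteqP; split => w /=; [move=> /headE[]|move=> H; apply/headE].
have -> : tail @^-1` [set e | forall j, (j < m)%N -> C' j (e (sg j))] =
    [set w | forall k, (k < N)%N -> cC k (tail w k)].
  by apply/seteqP; split => w /=; move/(tailE tail).
have -> : tail0 @^-1` [set e | forall j, (j < m)%N -> C' j (e (sg j))] =
    [set w | forall k, (k < N)%N -> cC k (tail0 w k)].
  by apply/seteqP; split => w /=; move/(tailE tail0).
have -> : [set w | forall k, (k < K)%N -> cA k (incr X (t k) (t k.+1) w)] `&`
    [set w | forall k, (k < N)%N -> cC k (tail w k)] =
    [set w | forall i, (i < K + N)%N -> D i (incr X (t i) (t i.+1) w)].
  apply/seteqP; split => w /=.
    move=> [H1 H2] i ilt; rewrite /D; case: ifPn => iK; first exact: H1.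
    rewrite -leqNgt in iK.
    have := H2 (i - K)%N; rewrite ltn_subLR// => /(_ ilt).
    by rewrite /tail subnKC.
  move=> H; split=> [k kK|k kN].
    by have := H k (ltn_addr _ kK); rewrite /D kK.
  have := H (K + k)%N; rewrite ltn_add2l => /(_ kN).
  by rewrite /D ltnNge leq_addr/= addKn.
rewrite (levy_indep (K + N) t D) ?t0//.
have mcA k : measurable (cA k) by exact: mcond.
rewrite (levy_indep K t cA) ?t0//.
rewrite big_split_ord/=; congr (_ * _)%E.
  by apply: eq_bigr => i _; rewrite /D ltn_ord.
have mcC k : measurable (cC k) by exact: mcond.
have s0 : 0 <= t (K + 0)%N - t K by rewrite addn0 subrr.
have sS i : t (K + i)%N - t K < t (K + i.+1)%N - t K by rewrite addnS ltrD2r.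
apply: (etrans _ (esym (levy_indep N (fun j => t (K + j)%N - t K) cC s0 sS mcC))).
apply: eq_bigr => i _; rewrite /D ltnNge leq_addr/= addKn addnS.
by have -> : t (K + i).+1 - t K - (t (K + i)%N - t K) = t (K + i).+1 - t (K + i)%N by ring.
Qed.

Lemma blocks_indep A C : measurable A -> measurable C ->
  P (head @^-1` A `&` tail @^-1` C) = (P (head @^-1` A) * P (tail0 @^-1` C))%E.
Proof.
move=> mA mC.
pose fh : {mfun T >-> path_space nat} := HB.pack head (isMeasurableFun.Build _ _ _ _ _ mhead).
pose ft0 : {mfun T >-> path_space nat} := HB.pack tail0 (isMeasurableFun.Build _ _ _ _ _ mtail0).
have mht := measurable_fun_pair mhead mtail.
pose fht : {mfun T >-> (path_space nat * path_space nat)%type} :=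
  HB.pack (fun w => (head w, tail w)) (isMeasurableFun.Build _ _ _ _ _ mht).
transitivity ((distribution P fh \x distribution P ft0)%E (A `*` C)); last exact: product_measure1E.
change (distribution P fht (A `*` C) = (distribution P fh \x distribution P ft0)%E (A `*` C)).
apply: (@path_prod_measure_unique R nat nat 0%N 0%N); last exact: measurableX.
- by rewrite /= /distribution /pushforward preimage_setT probability_setT ltry.
- move=> A' C' cA cC; apply: (etrans (blocks_cylinder _ _ cA cC)).
  by apply/esym/product_measure1E; exact: sub_sigma_algebra.
Qed.

End blocks.

Definition past (s : R) (w : T) : path_space R :=
  fun u => X (Num.min (Num.max u 0) s) w.
Definition future (s : R) (w : T) : path_space R :=
  fun v => X (s + Num.max v 0) w - X s w.
Definition levy_path (w : T) : path_space R := fun v => X (Num.max v 0) w.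

Lemma measurable_past s : measurable_fun setT (past s).
Proof. by apply: measurable_to_path_space => u; exact: levy_measurable. Qed.

Lemma measurable_future s : measurable_fun setT (future s).
Proof. by apply: measurable_to_path_space => u; exact: measurable_incr. Qed.

Lemma measurable_levy_path : measurable_fun setT levy_path.
Proof. by apply: measurable_to_path_space => u; exact: levy_measurable. Qed.

Let measurable_partial_sum n (a : nat -> nat) (A : nat -> set R) :
  (forall i, measurable (A i)) ->
  measurable [set e : path_space nat | forall i, (i < n)%N -> A i (\sum_(k < a i) e k)].
Proof.
move=> mA.
rewrite (_ : [set e | _] = \bigcap_i (if (i < n)%N then
    (fun e : path_space nat => \sum_(k < a i) e k) @^-1` A i else setT)).
  apply: bigcapT_measurable => i; case: ifP => // _.
  rewrite -[X in measurable X]setTI.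
  have : measurable_fun setT (fun e : path_space nat => \sum_(k < a i) (e k : R)).
    by apply: measurable_sum => k; exact: measurable_eval.
  by apply.
apply/seteqP; split => e /= H i; first by move=> _; case: ifP => // ilt; exact: H.
by move=> ilt; have := H i Logic.I; rewrite ilt.
Qed.

Let past_future_cylinder s A C : 0 <= s -> cylinder R A -> cylinder R C ->
  P (past s @^-1` A `&` future s @^-1` C) =
  (P (past s @^-1` A) * P (levy_path @^-1` C))%E.
Proof.
move=> s0 [n [u [A' [mA ->]]]] [m [v [C' [mC ->]]]].
pose u' i := Num.min (Num.max (u i) 0) s.
pose v' j := s + Num.max (v j) 0.
pose U i := if (i < n)%N then u' i else if (i < n + m)%N then v' (i - n)%N else s.
have u'0 i : 0 <= u' i by rewrite le_min le_max lexx orbT.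
have v'0 i : s <= v' i by rewrite lerDl le_max lexx orbT.
have U0 i : (i < (n + m).+1)%N -> 0 <= U i.
  by move=> _; rewrite /U; case: ifP => // _; case: ifP => // _; rewrite (le_trans s0).
have [t [t0 tS Ut]] := time_grid _ U U0.
have t_homo : {homo t : i j / (i < j)%N >-> i < j} by exact: homo_ltn lt_trans tS.
have [K sK] : exists K, s = t K.
  by have := Ut (n + m)%N (ltnSn _); rewrite /U ltnn ltnNge leq_addr.
have tK a : t a <= s -> (a <= K)%N.
  by move=> ta; rewrite leqNgt; apply/negP => /t_homo; rewrite -sK ltNge ta.
have Kt a : s <= t a -> (K <= a)%N.
  by move=> ta; rewrite leqNgt; apply/negP => /t_homo; rewrite -sK ltNge ta.
have /choice[a Ha] : forall i, exists a, (i < n)%N -> u' i = t a /\ (a <= K)%N.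
  move=> i; have [ilt|ilt] := ltnP i n; last by exists 0%N.
  have [a E] := Ut i (ltn_trans ilt (leq_addr _ _)).
  move: E; rewrite /U ilt => E; exists a => _; split => //.
  by apply: tK; rewrite -E ge_min lexx orbT.
have /choice[c Hc] : forall j, exists c, (j < m)%N -> v' j = t (K + c)%N.
  move=> j; have [jlt|jlt] := ltnP j m; last by exists 0%N.
  have lt1 : (n + j < (n + m).+1)%N by rewrite ltnS leq_add2l ltnW.
  have [b E] := Ut _ lt1.
  move: E; rewrite /U ltnNge leq_addr/= ltn_add2l jlt addKn => E.
  by exists (b - K)%N => _; rewrite subnKC// Kt// -E.
have tele f k0 k : \sum_(i < k) (f (k0 + i.+1)%N - f (k0 + i)%N) = f (k0 + k)%N - f k0 :> R.
  elim: k => [|k IH]; first by rewrite big_ord0 addn0 subrr.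
  by rewrite big_ord_recr/= IH; ring.
have Xa w k : (k <= K)%N -> X (t k) w =
    \sum_(i < k) (if (i < K)%N then incr X (t i) (t i.+1) w else 0).
  move=> kK; rewrite (eq_bigr (fun i : 'I_k => X (t (0 + i.+1)%N) w - X (t (0 + i)%N) w)).
    by rewrite (tele (fun i => X (t i) w)) t0 levy0 subr0.
  by move=> i _; rewrite (leq_trans (ltn_ord i) kK).
have Xt w k : X (t (K + k)%N) w - X (t K) w = \sum_(i < k) incr X (t (K + i)%N) (t (K + i).+1) w.
  rewrite -(tele (fun i => X (t i) w)); apply: eq_bigr => i _.
  by rewrite /incr addnS.
have Xt0 w k : X (t (K + k)%N - t K) w = \sum_(i < k) incr X (t (K + i)%N - t K) (t (K + i.+1)%N - t K) w.
  rewrite (eq_bigr (fun i : 'I_k => X (t (K + i.+1)%N - t K) w - X (t (K + i)%N - t K) w))//.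
  by rewrite (tele (fun i => X (t i - t K) w)) subrr levy0 subr0.
have := blocks_indep t K t0 tS _ _ (measurable_partial_sum n a A' mA) (measurable_partial_sum m c C' mC).
set h1 := (fun w : T => _) @^-1` _; set h2 := (fun w : T => _) @^-1` _; set h3 := (fun w : T => _) @^-1` _.
have -> : h1 = past s @^-1` [set e | forall i, (i < n)%N -> A' i (e (u i))].
  apply/seteqP; split => w /= H i ilt; have [E aK] := Ha i ilt.
    by rewrite /past -/(u' i) E Xa//; exact: H.
  by rewrite -Xa// -E; exact: H.
have -> : h2 = future s @^-1` [set e | forall i, (i < m)%N -> C' i (e (v i))].
  apply/seteqP; split => w /= H i ilt; have E := Hc i ilt.
    by rewrite /future -/(v' i) E {1}sK Xt; exact: H.
  by rewrite -Xt -sK -E; exact: H.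
have -> // : h3 = levy_path @^-1` [set e | forall i, (i < m)%N -> C' i (e (v i))].
have Hc' j : (j < m)%N -> Num.max (v j) 0 = t (K + c j)%N - t K.
  by move=> jm; rewrite -Hc// /v' -sK addrC addKr.
apply/seteqP; split => w /= H i ilt.
  by rewrite /levy_path Hc'// Xt0; exact: H.
by rewrite -Xt0 -Hc'//; exact: H.
Qed.

Theorem markov_property (s : R) (g : path_space R * path_space R -> \bar R) : 0 <= s ->
  measurable_fun setT g -> (forall z, 0 <= g z)%E ->
  (\int[P]_w g (past s w, future s w) =
   \int[P]_w \int[P]_w' g (past s w, levy_path w'))%E.
Proof.
move=> s0 mg g0.
pose fp : {mfun T >-> path_space R} :=
  HB.pack (past s) (isMeasurableFun.Build _ _ _ _ _ (measurable_past s)).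
pose fy : {mfun T >-> path_space R} :=
  HB.pack levy_path (isMeasurableFun.Build _ _ _ _ _ measurable_levy_path).
have mpf := measurable_fun_pair (measurable_past s) (measurable_future s).
pose fpf : {mfun T >-> (path_space R * path_space R)%type} :=
  HB.pack (fun w => (past s w, future s w)) (isMeasurableFun.Build _ _ _ _ _ mpf).
have E Z : measurable Z -> distribution P fpf Z = (distribution P fp \x distribution P fy)%E Z.
  apply: (@path_prod_measure_unique R R R 0 0).
  - by rewrite /= /distribution /pushforward preimage_setT probability_setT ltry.
  - move=> A' C' cA cC; apply: (etrans (past_future_cylinder _ _ _ s0 cA cC)).
    by apply/esym/product_measure1E; exact: sub_sigma_algebra.
transitivity (\int[distribution P fpf]_z g z)%E.
  by rewrite ge0_integral_distribution.
rewrite (eq_measure_integral (distribution P fp \x distribution P fy)%E); last first.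
  by move=> Z mZ _; exact: E.
rewrite fubini_tonelli1// ge0_integral_distribution//.
- apply: eq_integral => w _ /=; rewrite /fubini_F ge0_integral_distribution//.
  exact: measurableT_comp.
- exact: measurable_fun_fubini_tonelli_F.
- by move=> x; apply: integral_ge0.
Qed.

End markov.

(** * First passage below a level *)

Section right_continuous_path.
Context {R : realType}.
Local Notation leb := (@lebesgue_measure R).

Definition dyadic_up (n : nat) (s : R) : R := (Num.truncn (s * 2 ^+ n)).+1%:R / 2 ^+ n.

Lemma pow2_gt0 n : 0 < 2 ^+ n :> R. Proof. by rewrite exprn_gt0. Qed.

Lemma dyadic_up_gt n s : s < dyadic_up n s.
Proof. by rewrite /dyadic_up ltr_pdivlMr ?pow2_gt0// truncnS_gt. Qed.

Lemma dyadic_up_le n s : 0 <= s -> dyadic_up n s <= s + (2 ^+ n)^-1.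
Proof.
move=> s0; have s2 : 0 <= s * 2 ^+ n by rewrite mulr_ge0// ltW// pow2_gt0.
rewrite /dyadic_up -natr1 mulrDl div1r lerD2r ler_pdivrMr ?pow2_gt0//.
by rewrite truncn_le.
Qed.

Lemma pow2_inv_lt (e : R) : 0 < e -> exists N, forall n, (N <= n)%N -> (2 ^+ n)^-1 < e.
Proof.
move=> e0; exists (Num.truncn e^-1).+1 => n Nn.
rewrite invf_plt ?posrE ?pow2_gt0//.
apply: (lt_le_trans (truncnS_gt _)); apply: (@le_trans _ _ n%:R); first by rewrite ler_nat.
by rewrite -natrX ler_nat ltnW// ltn_expl.
Qed.

Variables (z : R -> R) (b : R).
Hypothesis z_rc : forall t, 0 <= t -> z s @[s --> t^'+] --> z t.

Lemma rc_dist t e : 0 <= t -> 0 < e ->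
  exists2 h, 0 < h & forall s, t <= s -> s < t + h -> `|z s - z t| < e.
Proof.
move=> t0 e0; have /cvgrPdist_lt/(_ _ e0)[h /= h0 H] := z_rc _ t0.
exists h => // s; rewrite le_eqVlt => /predU1P[<- _|ts sth].
  by rewrite subrr normr0.
rewrite distrC; apply: H => //=.
by rewrite distrC gtr0_norm ?subr_gt0//; lra.
Qed.

Lemma rc_cvg (t : R) (u : nat -> R) : 0 <= t -> (forall n, t <= u n) ->
  u n @[n --> \oo] --> t -> z (u n) @[n --> \oo] --> z t.
Proof.
move=> t0 tu ut; apply/cvgrPdist_lt => e e0.
have [h h0 H] := rc_dist _ _ t0 e0.
have /cvgrPdist_lt/(_ _ h0)[N _ HN] := ut.
exists N => // n Nn; rewrite /= distrC; apply: H => //.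
have := HN _ Nn; rewrite /= distrC => /(le_lt_trans (ler_norm _)).
by rewrite ltrBlDl.
Qed.

Lemma dyadic_up_cvg s : 0 <= s -> dyadic_up n s @[n --> \oo] --> s.
Proof.
move=> s0; apply/cvgrPdist_lt => e e0; have [N HN] := pow2_inv_lt _ e0.
exists N => // n Nn /=; rewrite distrC gtr0_norm ?subr_gt0 ?dyadic_up_gt//.
by have := HN _ Nn; have := dyadic_up_le n _ s0; lra.
Qed.

Lemma rc_below u : 0 <= u -> z u < b ->
  exists2 h, 0 < h & forall s, u <= s -> s < u + h -> z s < b.
Proof.
move=> u0 zu; have [||h h0 H] := rc_dist u (b - z u) => //; first by rewrite subr_gt0.
exists h => // s us sh; have := H s us sh.
by move=> /(le_lt_trans (ler_norm _)); lra.
Qed.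

Definition hitting : \bar R := ereal_inf (EFin @` [set t | 0 <= t /\ z t < b]).

Lemma hitting_ge0 : (0 <= hitting)%E.
Proof. by apply: le_ereal_inf_tmp => _ [t [t0 _] <-]; rewrite lee_fin. Qed.

Lemma hitting_le u : 0 <= u -> z u < b -> (hitting <= u%:E)%E.
Proof. by move=> u0 zu; apply: ereal_inf_lbound; exists u. Qed.

Lemma hitting_lt s : (hitting < s%:E)%E -> exists u, [/\ 0 <= u, u < s & z u < b].
Proof.
move=> /ereal_inf_lt[_ [u [u0 zu] <-]]; rewrite lte_fin => us.
by exists u.
Qed.

Lemma hitting_geP s : (s%:E <= hitting)%E <-> forall u, 0 <= u -> u < s -> b <= z u.
Proof.
split=> [H u u0 us|H].
  rewrite leNgt; apply/negP => zu.
  by have := le_trans H (hitting_le _ u0 zu); rewrite lee_fin leNgt us.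
rewrite leNgt; apply/negP => /hitting_lt[u [u0 us]].
by rewrite ltNge H.
Qed.

Definition alive (s : R) : bool :=
  `[< forall q : rat, 0 <= ratr q :> R -> ratr q < s :> R -> b <= z (ratr q) >].

Lemma aliveP s : alive s <-> (s%:E <= hitting)%E.
Proof.
rewrite hitting_geP; split=> [/asboolP H u u0 us|H]; last first.
  by apply/asboolP => q; exact: H.
rewrite leNgt; apply/negP => zu.
have [h h0 Hh] := rc_below _ u0 zu.
have : u < Num.min s (u + h) by rewrite lt_min us ltrDl.
move=> /rat_in_itvoo[q]; rewrite in_itv/= lt_min => /and3P[uq qs qh].
have := H q (le_trans u0 (ltW uq)) qs.
by rewrite leNgt Hh// ltW.
Qed.

Lemma le_z_hitting t : hitting = t%:E -> z t <= b.
Proof.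
move=> ht; have t0 : 0 <= t by rewrite -lee_fin -ht hitting_ge0.
rewrite leNgt; apply/negP => bz.
have [||h h0 H] := rc_dist t (z t - b) => //; first by rewrite subr_gt0.
have : (hitting < (t + h)%:E)%E by rewrite ht lte_fin ltrDl.
move=> /hitting_lt[u [u0 uth zu]].
have tu : t <= u by rewrite -lee_fin -ht hitting_le.
have := H u tu uth; rewrite ltr_norml; lra.
Qed.

Lemma dyadic_after u h : 0 <= u -> 0 < h ->
  exists N, forall n, (N <= n)%N -> u <= dyadic_up n u /\ dyadic_up n u < u + h.
Proof.
move=> u0 h0; have [N HN] := pow2_inv_lt _ h0; exists N => n Nn.
split; first exact/ltW/dyadic_up_gt.
by rewrite (le_lt_trans (dyadic_up_le _ _ u0))// ltrD2l HN.
Qed.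

Definition grid_alive (n k : nat) : bool :=
  all (fun j : nat => b <= z (j%:R / 2 ^+ n)) (iota 0 k.+1).

(* The first j <= N such that z (j / 2 ^ n) < b, or N if there is none. *)
Fixpoint grid_stop (n N : nat) : nat :=
  if N is N'.+1 then if grid_alive n N' then N else grid_stop n N' else 0.

Lemma grid_aliveP n k : reflect (forall j, (j <= k)%N -> b <= z (j%:R / 2 ^+ n)) (grid_alive n k).
Proof.
apply: (iffP allP) => H j; last by rewrite mem_iota add0n ltnS; exact: H.
by move=> jk; apply: H; rewrite mem_iota add0n ltnS.
Qed.

Lemma grid_stop_alive n N : grid_alive n N -> grid_stop n N = N.
Proof.
case: N => [//|N] /grid_aliveP H /=.
case: ifP => // /negP[]; apply/grid_aliveP => j jN; apply: H.
exact: leqW.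
Qed.

Lemma grid_stop_leq n N : (grid_stop n N <= N)%N.
Proof. by elim: N => //= N IH; case: ifP => // _; exact: leqW. Qed.

Lemma grid_stop_before n N j : (j < grid_stop n N)%N -> b <= z (j%:R / 2 ^+ n).
Proof.
elim: N => //= N IH; case: ifPn => // /grid_aliveP H; rewrite ltnS; exact: H.
Qed.

Lemma grid_stop_lt n N : (grid_stop n N < N)%N -> z ((grid_stop n N)%:R / 2 ^+ n) < b.
Proof.
elim: N => //= N IH; case: ifPn => [_|]; first by rewrite ltnn.
move=> aN; rewrite ltnS leq_eqVlt => /predU1P[sN|]; last exact: IH.
rewrite ltNge; apply: contra aN => bz; apply/grid_aliveP => j.
rewrite leq_eqVlt => /predU1P[->|jN]; first by rewrite -sN.
by apply: (grid_stop_before _ N); rewrite sN.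
Qed.

Variable T0 : R.
Hypothesis T0_ge0 : 0 <= T0.

Definition grid_horizon (n : nat) : nat := (Num.truncn (T0 * 2 ^+ n)).+1.

Definition stopped : R := fine (mine hitting T0%:E).

Let stoppedE : stopped%:E = mine hitting T0%:E.
Proof.
rewrite /stopped fineK//; have := hitting_ge0.
case: hitting => [r|_|//]; last by rewrite min_r ?leey.
by rewrite -EFin_min.
Qed.

Lemma stopped_ge0 : 0 <= stopped.
Proof. by rewrite -lee_fin stoppedE le_min hitting_ge0 lee_fin. Qed.

Lemma stopped_hit : (hitting <= T0%:E)%E -> hitting = stopped%:E.
Proof. by move=> hT; rewrite stoppedE min_l. Qed.

Lemma stopped_alive : (T0%:E < hitting)%E -> stopped = T0.
Proof. by move=> hT; apply: EFin_inj; rewrite stoppedE min_r// ltW. Qed.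

Let theta n : R := (grid_stop n (grid_horizon n))%:R / 2 ^+ n.

Lemma grid_stop_ge n : stopped <= theta n.
Proof.
rewrite -lee_fin stoppedE ge_min.
have := grid_stop_leq n (grid_horizon n); rewrite leq_eqVlt => /predU1P[E|lt].
  by apply/orP; right; rewrite lee_fin /theta E ltW// dyadic_up_gt.
apply/orP; left; apply: hitting_le; first by rewrite divr_ge0// ltW// pow2_gt0.
exact: grid_stop_lt.
Qed.

Lemma grid_stop_cvg : theta n @[n --> \oo] --> stopped.
Proof.
apply/cvgrPdist_lt => e e0.
suff [N HN] : exists N, forall n, (N <= n)%N -> theta n < stopped + e.
  exists N => // n Nn /=; rewrite distrC ger0_norm ?subr_ge0 ?grid_stop_ge//.
  by rewrite ltrBlDl HN.
have [hT|hT] := ltP T0%:E hitting.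
  have [N HN] := pow2_inv_lt _ e0; exists N => n Nn; rewrite stopped_alive//.
  apply: (@le_lt_trans _ _ (dyadic_up n T0)).
    by rewrite ler_pM2r ?invr_gt0 ?pow2_gt0// ler_nat grid_stop_leq.
  by rewrite (le_lt_trans (dyadic_up_le _ _ T0_ge0))// ltrD2l HN.
have : (hitting < (stopped + e)%:E)%E by rewrite stopped_hit// lte_fin ltrDl.
move=> /hitting_lt[u [u0 us zu]].
have [h h0 Hh] := rc_below _ u0 zu.
have [|N HN] := dyadic_after u (Num.min h (stopped + e - u)) u0.
  by rewrite lt_min h0 subr_gt0.
exists N => n Nn; have [uD Du] := HN n Nn.
have Dh : dyadic_up n u < u + h by rewrite (lt_le_trans Du)// lerD2l ge_min lexx.
have De : dyadic_up n u < stopped + e.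
  by rewrite (lt_le_trans Du)// -lerBrDl ge_min lexx orbT.
apply: le_lt_trans De; rewrite /theta /dyadic_up ler_pM2r ?invr_gt0 ?pow2_gt0// ler_nat.
rewrite leqNgt; apply/negP => /grid_stop_before.
by rewrite leNgt (Hh (dyadic_up n u)).
Qed.

Lemma z_grid_stop_cvg : z (theta n) @[n --> \oo] --> z stopped.
Proof. exact: rc_cvg stopped_ge0 grid_stop_ge grid_stop_cvg. Qed.

End right_continuous_path.

Section path_functionals.
Context {R : realType}.
Local Notation leb := (@lebesgue_measure R).
Local Notation path := (@path_space R R).

(* Evaluation at a time is not jointly measurable in (time, path); this version
   is, and it agrees with evaluation on right-continuous paths. *)
Definition regularize (e : R -> R) (s : R) : R :=
  fine (limn_esup (fun n => (e (dyadic_up n s))%:E)).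

Lemma regularizeE (e : R -> R) (s : R) : 0 <= s ->
  (forall t, 0 <= t -> e s @[s --> t^'+] --> e t) -> regularize e s = e s.
Proof.
move=> s0 rc; rewrite /regularize.
have H : (fun n => (e (dyadic_up n s))%:E) n @[n --> \oo] --> (e s)%:E.
  apply: cvg_EFin; first by apply: nearW.
  apply: (rc_cvg _ rc) => //; last exact: dyadic_up_cvg.
  by move=> n; exact/ltW/dyadic_up_gt.
by rewrite is_cvg_limn_esupE; [rewrite (cvg_lim _ H)|exact: cvgP H].
Qed.

Lemma measurable_dyadic_index n k :
  measurable [set s : R | Num.truncn (s * 2 ^+ n) = k].
Proof.
have mt : measurable_fun setT (fun s : R => (Num.truncn (s * 2 ^+ n))%:R : R).
  apply: nondecreasing_measurable => // x y xy.
  by rewrite ler_nat le_truncn// ler_wpM2r// ltW// pow2_gt0.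
rewrite (_ : [set s | _] = setT `&` (fun s : R => (Num.truncn (s * 2 ^+ n))%:R : R) @^-1` [set k%:R]).
  exact: mt.
by apply/seteqP; split => s /=; [move=> ->|move=> [_ /eqP]; rewrite eqr_nat => /eqP].
Qed.

Lemma measurable_dyadic_eval n :
  measurable_fun setT (fun p : path * R => (p.1 : R -> R) (dyadic_up n p.2)).
Proof.
move=> _ B mB; rewrite setTI.
rewrite (_ : _ @^-1` B = \bigcup_k (((fun e : path => (e (k.+1%:R / 2 ^+ n) : R)) @^-1` B) `*`
   [set s : R | Num.truncn (s * 2 ^+ n) = k])).
  apply: bigcupT_measurable => k; apply: measurableX; last exact: measurable_dyadic_index.
  by rewrite -[X in measurable X]setTI; exact: measurable_eval.
apply/seteqP; split => -[e s] /=.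
  by move=> Bes; exists (Num.truncn (s * 2 ^+ n)).
by move=> [k _ [/= Be sk]]; rewrite /dyadic_up sk.
Qed.

Lemma measurable_regularize :
  measurable_fun setT (fun p : path * R => regularize p.1 p.2).
Proof.
apply: measurableT_comp; first exact: fine_measurable.
apply: measurable_fun_limn_esup => n; apply/measurable_EFinP.
exact: measurable_dyadic_eval.
Qed.

Lemma measurable_alive (b : R) :
  measurable_fun setT (fun p : (R * path) * R => alive (fun t => p.1.1 + p.1.2 t) b p.2).
Proof.
apply: (measurable_fun_bool true); rewrite setTI.
rewrite (_ : _ @^-1` _ = ~` \bigcup_(q : rat) (if (0 <= ratr q :> R) then
   [set p : (R * path) * R | ratr q < p.2] `&` [set p | p.1.1 + p.1.2 (ratr q) < b] else set0)).
  apply: measurableC; apply: bigcupT_measurable_rat => q; case: ifP => // _.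
  apply: measurableI.
    rewrite (_ : [set p | _] = setT `&` (fun p : (R * path) * R => ratr q < p.2) @^-1` [set true]).
      by apply: measurable_fun_ltr.
    by apply/seteqP; split => p /=; tauto.
  rewrite (_ : [set p | _] = setT `&` (fun p : (R * path) * R => p.1.1 + p.1.2 (ratr q) < b) @^-1` [set true]).
    apply: measurable_fun_ltr => //; apply: measurable_funD.
      by apply: measurableT_comp.
    have m12 : measurable_fun setT (fun p : (R * path) * R => (p.1.2 : path)).
      exact: (measurableT_comp measurable_snd measurable_fst).
    exact: (measurableT_comp (measurable_eval R (ratr q : R)) m12).
  by apply/seteqP; split => p /=; tauto.
apply/seteqP; split => p /=.
  move=> /asboolP H [q _]; case: ifP => // q0 [/= qp].
  by rewrite ltNge (H q q0 qp).
move=> H; apply/asboolP => q q0 qp; rewrite leNgt; apply/negP => zb.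
by apply: H; exists q => //; rewrite q0.
Qed.

Definition occupation (b : R) (f : R -> \bar R) (x : R) (e : R -> R) : \bar R :=
  (\int[leb]_s (if (0 <= s)%R && alive (fun t => x + e t)%R b s
                then f (x + regularize e s)%R else 0))%E.

Variables (b : R) (f : R -> \bar R).
Hypothesis mf : measurable_fun setT f.

Lemma measurable_occupation_integrand :
  measurable_fun setT (fun p : (R * path) * R =>
    (if (0 <= p.2)%R && alive (fun t => p.1.1 + p.1.2 t)%R b p.2
     then f (p.1.1 + regularize p.1.2 p.2)%R else 0)%E).
Proof.
apply: measurable_fun_ifT => //.
  apply: measurable_and; last exact: measurable_alive.
  exact: measurable_fun_ler.
apply: (measurableT_comp mf); apply: measurable_funD; first exact: measurableT_comp.
have m12 : measurable_fun setT (fun p : (R * path) * R => (p.1.2 : path, p.2)).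
  apply: measurable_fun_pair => //.
  exact: (measurableT_comp measurable_snd measurable_fst).
exact: (measurableT_comp measurable_regularize m12).
Qed.

Hypothesis f0 : forall y, (0 <= f y)%E.

Lemma measurable_occupation :
  measurable_fun setT (fun p : R * path => occupation b f p.1 p.2).
Proof.
have H (p : (R * path) * R) : (0 <= (if (0 <= p.2)%R && alive (fun t => p.1.1 + p.1.2 t)%R b p.2
     then f (p.1.1 + regularize p.1.2 p.2)%R else 0))%E by case: ifP.
exact: (@measurable_fun_fubini_tonelli_F _ _ _ _ _ leb _ measurable_occupation_integrand H).
Qed.

End path_functionals.

Section levy_paths.
Context {R : realType} {d : measure_display} {T : measurableType d}.
Variables (P : probability T R) (X : R -> T -> R) (Ps : R -> R).
Hypothesis HX : levy_process P X Ps.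

Lemma levy_rc w t : 0 <= t -> X s w @[s --> t^'+] --> X t w.
Proof. by case: HX => _ [_ [+ _]] => /(_ w t). Qed.

Lemma levy_rc_shift x w t : 0 <= t -> x + X s w @[s --> t^'+] --> x + X t w.
Proof. by move=> t0; apply: cvgD; [exact: cvg_cst|exact: levy_rc]. Qed.

Lemma levy_path_rc w t : 0 <= t -> levy_path X w s @[s --> t^'+] --> levy_path X w t.
Proof.
move=> t0; rewrite {2}/levy_path max_l//.
apply: cvg_trans (levy_rc w t t0); apply: near_eq_cvg.
near=> s; rewrite /levy_path max_l//; apply: (le_trans t0).
by near: s; exact: nbhs_right_ge.
Unshelve. all: by end_near. Qed.

Lemma regularize_levy w s : 0 <= s -> regularize (levy_path X w) s = X s w.
Proof.
move=> s0; rewrite regularizeE//; last exact: levy_path_rc.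
by rewrite /levy_path max_l.
Qed.

Lemma alive_levy x b w s :
  alive (fun t => x + levy_path X w t) b s <-> (s%:E <= tau_below X x b w)%E.
Proof.
rewrite -(aliveP _ b (levy_rc_shift x w)); split => /asboolP H; apply/asboolP => q q0 qs.
  by have := H q q0 qs; rewrite /levy_path max_l.
by rewrite /levy_path max_l//; exact: H.
Qed.

End levy_paths.

Section exponential_moments.
Context {R : realType} {d : measure_display} {T : measurableType d}.
Variables (P : probability T R) (X : R -> T -> R) (Ps : R -> R).
Hypothesis HX : levy_process P X Ps.
Local Notation path := (@path_space R R).

Let measurable_expR_eval (l t : R) :
  measurable_fun setT (fun e : path => (expR (- (l * e t)))%:E).
Proof.
apply/measurable_EFinP; apply: measurableT_comp => //; apply: measurable_funN.
by apply: measurable_funM => //; exact: (measurable_eval R t).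
Qed.

Lemma markov_increment (F : path -> \bar R) (l s h : R) : 0 <= s -> 0 <= h ->
  measurable_fun setT F -> (forall e, 0 <= F e)%E ->
  (\int[P]_w (F (past X s w) * (expR (- (l * (X (s + h) w - X s w))))%:E) =
   (\int[P]_w F (past X s w)) * (\int[P]_w (expR (- (l * X h w)))%:E))%E.
Proof.
move=> s0 h0 mF F0.
pose g (p : path * path) : \bar R := (F p.1 * (expR (- (l * p.2 h)))%:E)%E.
have mg : measurable_fun setT g.
  apply: emeasurable_funM; first exact: (measurableT_comp mF measurable_fst).
  exact: (measurableT_comp (measurable_expR_eval l h) measurable_snd).
have g0 p : (0 <= g p)%E by rewrite mule_ge0// lee_fin expR_ge0.
have := markov_property _ _ _ HX s g s0 mg g0.
rewrite /g /= /future /levy_path max_l// => ->.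
have mE : measurable_fun setT (fun w => (expR (- (l * X h w)))%:E).
  apply/measurable_EFinP; apply: measurableT_comp => //; apply: measurable_funN.
  by apply: measurable_funM => //; exact: (levy_measurable _ _ _ HX).
under eq_integral => w _ do rewrite ge0_integralZl//.
rewrite ge0_integralZr//.
- exact: (measurableT_comp mF (measurable_past _ _ _ HX s)).
- by apply: integral_ge0 => w _; rewrite lee_fin expR_ge0.
Qed.

Lemma mgf_dyadic (l : R) n : 0 <= l ->
  (\int[P]_w (expR (- (l * X (2 ^+ n)^-1 w)))%:E = (expR ((2 ^+ n)^-1 * Ps l))%:E)%E.
Proof.
move=> l0; elim: n => [|n IH].
  rewrite expr0 invr1 mul1r.
  by case: HX => _ [_ [_ [_ [_ [_ +]]]]]; exact.
set h : R := (2 ^+ n.+1)^-1.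
have h0 : 0 <= h by rewrite invr_ge0 ltW// pow2_gt0.
have hh : (2 ^+ n)^-1 = h + h :> R.
  by rewrite /h exprS invfM; field; rewrite expf_neq0.
move: IH; rewrite hh.
pose F (e : path) := (expR (- (l * e h)))%:E.
have FE w : F (past X h w) = (expR (- (l * X h w)))%:E.
  by rewrite /F /past max_l// minxx.
have mF : measurable_fun setT F by exact: measurable_expR_eval.
have F0 e : (0 <= F e)%E by rewrite lee_fin expR_ge0.
have := markov_increment F l h h h0 h0 mF F0.
under eq_integral => w _ do rewrite FE -EFinM -expRD -opprD -mulrDr addrC subrK.
move=> -> ; under eq_integral do rewrite FE.
set I := (\int[P]_w _)%E.
have : (0 <= I)%E by apply: integral_ge0 => w _; rewrite lee_fin expR_ge0.
move: I => I I0 II; have Ifin : I \is a fin_num.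
  by rewrite ge0_fin_numE// ltNge leye_eq; apply/eqP => Iy; move: II; rewrite Iy mulyy.
move: I0 II; rewrite -(fineK Ifin) lee_fin -EFinM; set r := fine I => r0 [rr]; congr EFin.
apply/eqP; rewrite -(@eqrXn2 _ 2)// ?expR_ge0//; apply/eqP.
by rewrite expr2 rr expr2 -expRD mulrDl.
Qed.

End exponential_moments.
Section no_overshoot.
Context {R : realType} {d : measure_display} {T : measurableType d}.
Variables (P : probability T R) (X : R -> T -> R) (Ps : R -> R) (C : R).
Hypothesis HX : levy_process P X Ps.
Hypothesis PsC : forall l, 1 <= l -> Ps l <= C * l ^+ 2.

Let bad (i n : nat) (e : R) : set T :=
  \bigcup_(k in `I_(i * 2 ^ n)) [set w | incr X (k%:R / 2 ^+ n) (k.+1%:R / 2 ^+ n) w <= - e].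

Let measurable_incr_le u v e : measurable [set w | incr X u v w <= - e].
Proof.
rewrite (_ : [set w | _] = setT `&` incr X u v @^-1` `]-oo, - e]%classic).
  by apply: (measurable_incr _ _ _ HX) => //; exact: measurable_itv.
by apply/seteqP; split => w /=; rewrite in_itv/=; tauto.
Qed.

Let measurable_bad i n e : measurable (bad i n e).
Proof. by apply: bigcup_measurable => k _; exact: measurable_incr_le. Qed.

(* Chernoff bound at the exponent 2 ^ p, for increments over time 4 ^ (- p):
   then h * Ps l <= C while l * e tends to infinity. *)
Let incr_bound p k e :
  (P [set w | (incr X (k%:R / 2 ^+ (p.*2)) (k.+1%:R / 2 ^+ (p.*2)) w <= - e)%R] <=
   (expR (C - 2 ^+ p * e))%:E)%E.
Proof.
set h : R := (2 ^+ (p.*2))^-1; set l : R := 2 ^+ p.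
have h0 : 0 < h by rewrite invr_gt0 pow2_gt0.
have l1 : 1 <= l by rewrite exprn_ege1// ler1n.
have l0 : 0 <= l by lra.
have hl : h * l ^+ 2 = 1.
  by rewrite /h /l -exprM muln2 mulVf// gt_eqF// pow2_gt0.
rewrite (_ : [set w | _] = incr X (k%:R / 2 ^+ (p.*2)) (k.+1%:R / 2 ^+ (p.*2)) @^-1` `]-oo, - e]%classic); last first.
  by apply/seteqP; split => w /=; rewrite in_itv.
rewrite (levy_stationary _ _ _ HX) ?measurable_itv ?mulr_ge0 ?(ltW h0)//; last first.
  by rewrite ler_wpM2r ?(ltW h0)// ler_nat.
have -> : k.+1%:R / 2 ^+ (p.*2) - k%:R / 2 ^+ (p.*2) = h.
  by rewrite -mulrBl -natr1 addrAC subrr add0r mul1r.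
have mA : measurable (X h @^-1` `]-oo, - e]%classic).
  by rewrite -[X in measurable X]setTI; apply: (levy_measurable _ _ _ HX) => //; exact: measurable_itv.
have -> : P (X h @^-1` `]-oo, - e]%classic) = (\int[P]_w (\1_(X h @^-1` `]-oo, - e]%classic) w)%:E)%E.
  by rewrite integral_indic// setIT.
have mE : measurable_fun setT (fun w => (expR (- (l * X h w)))%:E).
  apply/measurable_EFinP; apply: measurableT_comp => //; apply: measurable_funN.
  by apply: measurable_funM => //; exact: (levy_measurable _ _ _ HX).
apply: (@le_trans _ _ (\int[P]_w ((expR (- (l * e)))%:E * (expR (- (l * X h w)))%:E))%E).
  apply: ge0_le_integral => //.
  - by apply/measurable_EFinP; exact: measurable_indic.
  - exact: measurable_funeM.
  - move=> w _; rewrite -EFinM lee_fin indicE -expRD.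
    have [|] := boolP (w \in _); last by rewrite expR_ge0.
    rewrite inE/= in_itv/= => Xe.
    by rewrite -expR0 ler_expR; nra.
rewrite ge0_integralZl ?lee_fin ?expR_ge0// (mgf_dyadic _ _ _ HX)// -EFinM -expRD lee_fin ler_expR.
rewrite addrC mulrC lerD2r -/h.
apply: (@le_trans _ _ (C * l ^+ 2 * h)); first by rewrite ler_wpM2r ?(ltW h0)// PsC.
by rewrite -mulrA [_ * h]mulrC hl mulr1.
Qed.

Let bad_bound i p e : 0 < e ->
  (P (bad i p.*2 e) <= (i%:R * expR C * 6 / e ^+ 3 / 2 ^+ p)%:E)%E.
Proof.
move=> e0.
pose F (k : nat) : set T := [set w | incr X (k%:R / 2 ^+ p.*2) (k.+1%:R / 2 ^+ p.*2) w <= - e].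
rewrite /bad (bigcup_mkord _ F).
have mF k : (k < i * 2 ^ p.*2)%N -> measurable (F k) by move=> _; exact: measurable_incr_le.
apply: (@le_trans _ _ (\sum_(k < i * 2 ^ p.*2) P (F k))%E).
  exact: (@Boole_inequality _ _ _ P _ _ mF).
apply: (@le_trans _ _ (\sum_(k < i * 2 ^ p.*2) (expR (C - 2 ^+ p * e))%:E)%E).
  by apply: lee_sum => k _; exact: incr_bound.
rewrite sumEFin lee_fin sumr_const card_ord -[_ *+ (i * _)%N]mulr_natr natrM natrX.
have y0 : 0 < 2 ^+ p * e by rewrite mulr_gt0// pow2_gt0.
have := @expR_ge1Dxn R (2 ^+ p * e) 2 (ltW y0).
rewrite (_ : 3`!%:R = 6%:R)// => ey.
rewrite expRD expRN.
have ey2 : (2 ^+ p * e) ^+ 3 / 6 <= expR (2 ^+ p * e) by lra.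
have pos : 0 < (2 ^+ p * e) ^+ 3 / 6 by rewrite divr_gt0// exprn_gt0.
apply: (@le_trans _ _ (expR C * ((2 ^+ p * e) ^+ 3 / 6)^-1 * (i%:R * 2 ^+ p.*2))).
  apply: ler_wpM2r; first by rewrite mulr_ge0// ltW// pow2_gt0.
  by rewrite ler_wpM2l ?expR_ge0// lef_pV2 ?posrE ?expR_gt0.
rewrite le_eqVlt; apply/orP; left; apply/eqP.
rewrite -addnn exprD; field.
by rewrite !gt_eqF// pow2_gt0.
Qed.

Let bad_liminf i m K : P.-negligible (\bigcap_(n in [set n | (K <= n)%N]) bad i n m.+1%:R^-1).
Proof.
have mB : measurable (\bigcap_(n in [set n | (K <= n)%N]) bad i n m.+1%:R^-1).
  by apply: bigcap_measurable => [|n _]; [exists K => /=|exact: measurable_bad].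
apply/negligibleP => //; apply/eqP; rewrite -measure_le0.
apply/lee_addgt0Pr => eta eta0; rewrite add0e.
set e : R := m.+1%:R^-1.
have e0 : 0 < e by rewrite invr_gt0.
pose c := i%:R * expR C * 6 / e ^+ 3 + 1.
have c0 : 0 < c by rewrite ltr_wpDl// !mulr_ge0 ?expR_ge0// invr_ge0 exprn_ge0// ltW.
have ec : 0 < eta / c by rewrite divr_gt0.
have [N HN] := pow2_inv_lt _ ec.
pose p := maxn N K.
apply: (@le_trans _ _ (P (bad i p.*2 e))).
  apply: le_measure; rewrite ?inE//.
  by apply: bigcap_inf => /=; rewrite -addnn (leq_trans (leq_maxr N K))// leq_addr.
apply: (le_trans (bad_bound _ _ _ e0)); rewrite lee_fin.
have /ltW := HN p (leq_maxl _ _).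
rewrite ler_pdivlMr// => H; apply: le_trans H; rewrite mulrC.
by rewrite ler_wpM2l ?invr_ge0 ?exprn_ge0// /c lerDl.
Qed.

Lemma no_overshoot : {ae P, forall w, forall x b t, b <= x ->
  tau_below X x b w = t%:E -> x + X t w = b}.
Proof.
have : P.-negligible (\bigcup_i \bigcup_m \bigcup_K
    \bigcap_(n in [set n | (K <= n)%N]) bad i n m.+1%:R^-1).
  by apply: negligible_bigcup => i; apply: negligible_bigcup => m;
     apply: negligible_bigcup => K; exact: bad_liminf.
apply: negligibleS => w /= nw; apply: contrapT => nbad; apply: nw => x b t bx taut.
have rc := levy_rc_shift _ _ _ HX x w.
pose z s := x + X s w.
have zt : z t <= b by exact: (le_z_hitting z b rc).
apply/eqP; rewrite eq_le zt/= leNgt; apply/negP => ztb.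
have t0 : 0 <= t by rewrite -lee_fin -taut; exact: (hitting_ge0 z b).
have {}t0 : 0 < t.
  rewrite lt_neqAle t0 andbT; apply/eqP => t00.
  by move: ztb; rewrite /z -t00 (levy0 _ _ _ HX) addr0 ltNge bx.
have before u : 0 <= u -> u < t -> b <= z u.
  have ht : hitting z b = t%:E := taut.
  by move: u; apply/(hitting_geP z b); rewrite ht.
pose e := (b - z t) / 2.
have e0 : 0 < e by rewrite divr_gt0// subr_gt0.
apply: nbad.
exists (Num.truncn t).+1 => //; exists (Num.truncn e^-1) => //.
have [h h0 Hh] := rc_dist z rc t e (ltW t0) e0.
have [K HK] := pow2_inv_lt _ h0.
exists K => // n /= Kn; have dh := HK n Kn.
have p2 := pow2_gt0 (R := R) n.
have exk : exists k, t <= k%:R / 2 ^+ n.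
  exists (Num.truncn (t * 2 ^+ n)).+1.
  exact/ltW/(dyadic_up_gt n t).
case: (ex_minnP exk) => -[|k] tk kmin.
  by move: tk; rewrite mul0r leNgt t0.
have kt : k%:R / 2 ^+ n < t.
  by rewrite ltNge; apply/negP => /kmin; rewrite ltnn.
have k0 : 0 <= k%:R / 2 ^+ n :> R by rewrite divr_ge0// ltW.
exists k => /=.
  rewrite -(ltr_nat R) natrM natrX -ltr_pdivrMr//.
  by rewrite (lt_trans kt)// truncnS_gt.
rewrite /incr.
have kS : k.+1%:R / 2 ^+ n = k%:R / 2 ^+ n + (2 ^+ n)^-1 :> R by rewrite -natr1 mulrDl mul1r.
have := Hh (k.+1%:R / 2 ^+ n) tk.
have -> : k.+1%:R / 2 ^+ n < t + h by rewrite kS; lra.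
move=> /(_ isT) /(le_lt_trans (ler_norm _)).
have := before _ k0 kt.
have : (Num.truncn e^-1).+1%:R^-1 <= e.
  by rewrite invf_ple ?posrE// ltW// truncnS_gt.
rewrite /z; move: (X (k.+1%:R / 2 ^+ n) w) (X (k%:R / 2 ^+ n) w) (_.+1%:R^-1) => X1 X0 r.
have : b - (x + X t w) = 2 * e by rewrite /e /z; field.
move: (X t w) (e) => Xt e'; lra.
Qed.

End no_overshoot.

(** * Stopping the exponential martingale *)

Section step_integrals.
Context {R : realType}.
Local Notation leb := (@lebesgue_measure R).

Lemma measurable_dyadic_step n (g : nat -> R) :
  measurable_fun setT (fun s : R => g (Num.truncn (s * 2 ^+ n))).
Proof.
move=> _ B mB; rewrite setTI.
rewrite (_ : _ @^-1` B = \bigcup_k (if g k \in B then [set s : R | Num.truncn (s * 2 ^+ n) = k] else set0)).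
  by apply: bigcupT_measurable => k; case: ifP => // _; exact: measurable_dyadic_index.
apply/seteqP; split => s /=.
  by move=> Bg; exists (Num.truncn (s * 2 ^+ n)) => //; rewrite mem_set.
by move=> [k _]; case: ifPn => // /set_mem Bg /= ->.
Qed.

Definition dyadic_step (n N : nat) (g : nat -> R) (s : R) : R :=
  if (0 <= s) && (Num.truncn (s * 2 ^+ n) < N)%N then g (Num.truncn (s * 2 ^+ n)) else 0.

Lemma measurable_dyadic_step_fun n N g : measurable_fun setT (dyadic_step n N g).
Proof.
apply: measurable_fun_ifT => //; last exact: measurable_dyadic_step.
apply: measurable_and; first exact: measurable_fun_ler.
rewrite (_ : (fun t : R => _) = (fun t : R => (Num.truncn (t * 2 ^+ n))%:R < N%:R :> R)); last first.
  by apply/funext => s; rewrite ltr_nat.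
by apply: measurable_fun_ltr => //; exact: (measurable_dyadic_step n (fun k => k%:R)).
Qed.

Lemma integral_dyadic_step n N (g : nat -> R) : (forall k, 0 <= g k) ->
  (\int[leb]_s (dyadic_step n N g s)%:E = (\sum_(k < N) g k / 2 ^+ n)%:E)%E.
Proof.
move=> g0; elim: N => [|N IH].
  rewrite big_ord0 (eq_integral (cst 0%E)) ?integral0// => s _.
  by rewrite /dyadic_step ltn0 andbF.
pose D : set R := `[N%:R / 2 ^+ n, N.+1%:R / 2 ^+ n[%classic.
have mD : measurable D by exact: measurable_itv.
have p2 := pow2_gt0 (R := R) n.
have E s : (dyadic_step n N.+1 g s)%:E = ((dyadic_step n N g s)%:E + (g N)%:E * (\1_D s)%:E)%E.
  rewrite /dyadic_step indicE.
  have -> : (s \in D) = (0 <= s) && (Num.truncn (s * 2 ^+ n) == N)%N.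
    rewrite mem_setE in_itv/= ler_pdivrMr// ltr_pdivlMr//.
    have [s0|s0] := leP 0 s; last first.
      apply/negbTE; rewrite negb_and -!ltNge; apply/orP; left.
      by rewrite (lt_le_trans (_ : _ < 0))// pmulr_llt0.
    by rewrite /= truncn_eq// mulr_ge0// ltW.
  rewrite ltnS leq_eqVlt; case: (0 <= s) => /=; last by rewrite mule0 adde0.
  case: eqP => [->|_] /=; first by rewrite ltnn mule1 add0e.
  by rewrite mule0 adde0.
under eq_integral do rewrite E.
rewrite ge0_integralD//.
- rewrite IH ge0_integralZl_EFin//; last by apply/measurable_EFinP; exact: measurable_indic.
  rewrite integral_indic// setIT.
  rewrite [X in (_ + _ * X)%E](lebesgue_measure_itv `[N%:R / 2 ^+ n, N.+1%:R / 2 ^+ n[) /= lte_fin.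
  rewrite ltr_pM2r ?invr_gt0// ltr_nat ltnSn -EFinB -EFinM -EFinD big_ord_recr/=.
  by congr (_ + _)%:E; rewrite -mulrBl -natr1 addrAC subrr add0r mul1r.
- by move=> s _; rewrite lee_fin /dyadic_step; case: ifP.
- by apply/measurable_EFinP; exact: measurable_dyadic_step_fun.
- by move=> s _; rewrite -EFinM lee_fin mulr_ge0.
- by apply: measurable_funeM; apply/measurable_EFinP; exact: measurable_indic.
Qed.

Variables (z : R -> R) (b : R).
Hypothesis z_rc : forall t, 0 <= t -> z s @[s --> t^'+] --> z t.

Lemma measurable_rc : measurable_fun setT (fun s : R => z (Num.max s 0)).
Proof.
apply: (@measurable_fun_cvg _ _ _ setT (fun n (s : R) => z (dyadic_up n (Num.max s 0)))) => // [n|s _].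
  rewrite /dyadic_up.
  have : measurable_fun setT (fun s : R => z ((Num.truncn (s * 2 ^+ n)).+1%:R / 2 ^+ n)).
    exact: (measurable_dyadic_step n (fun k => z (k.+1%:R / 2 ^+ n))).
  by move/measurableT_comp; apply; exact: measurable_maxr.
have s0 : 0 <= Num.max s 0 by rewrite le_max lexx orbT.
apply: rc_cvg => //; last exact: dyadic_up_cvg.
by move=> n; exact/ltW/dyadic_up_gt.
Qed.

Lemma aliveE s : alive z b s = (s%:E <= hitting z b)%E.
Proof. by apply/idP/idP => /(aliveP z b z_rc). Qed.

Lemma measurable_alive_rc : measurable_fun setT (alive z b).
Proof.
rewrite (_ : alive z b = (fun s : R => s%:E <= hitting z b)%E); last first.
  by apply/funext => s; rewrite aliveE.
by apply: measurable_fun_lee => //; exact: measurable_cst.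
Qed.

Variables (phi : R -> R) (M T0 : R).
Hypotheses (cphi : continuous phi) (phi0 : forall y, 0 <= phi y)
  (phiM : forall y, b <= y -> phi y <= M) (T00 : 0 <= T0).

Definition alive_fun (s : R) : R :=
  if [&& 0 <= s, s < T0 & alive z b s] then phi (z s) else 0.

Lemma measurable_alive_fun : measurable_fun setT alive_fun.
Proof.
rewrite (_ : alive_fun = fun s => if [&& 0 <= s, s < T0 & alive z b s] then phi (z (Num.max s 0)) else 0).
  apply: measurable_fun_ifT => //.
    apply: measurable_and; first exact: measurable_fun_ler.
    apply: measurable_and; first exact: measurable_fun_ltr.
    exact: measurable_alive_rc.
  apply: measurableT_comp; last exact: measurable_rc.
  exact: continuous_measurable_fun.
apply/funext => s; rewrite /alive_fun; case: ifP => // /andP[s0 _].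
by rewrite max_l.
Qed.

Let g n k : R := if grid_alive z b n k.+1 then phi (z (k.+1%:R / 2 ^+ n)) else 0.

Let step_cvg s : s != T0 -> s%:E != hitting z b ->
  dyadic_step n (grid_horizon T0 n) (g n) s @[n --> \oo] --> alive_fun s.
Proof.
move=> sT sh.
have [s0|s0] := ltP s 0.
  rewrite /dyadic_step /alive_fun leNgt s0/=; exact: cvg_cst.
have [Ts|Ts] := ltP T0 s.
  rewrite /alive_fun s0 ltNge (ltW Ts)/=.
  apply: cvg_near_cst.
  have [N HN] := pow2_inv_lt (s - T0) ltac:(by rewrite subr_gt0).
  exists N => // n /= Nn; rewrite /dyadic_step.
  rewrite ifF// s0/=; apply/negbTE; rewrite -leqNgt /grid_horizon.
  have p2 := pow2_gt0 (R := R) n.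
  have T2 : 0 <= T0 * 2 ^+ n by rewrite mulr_ge0// ltW.
  have s2 : 0 <= s * 2 ^+ n by rewrite mulr_ge0// ltW.
  rewrite -[X in (X <= _)%N]addn1 -(natrK (R := R) (_ + 1)%N).
  apply: le_truncn; rewrite natrD.
  have t2 : (Num.truncn (T0 * 2 ^+ n))%:R <= T0 * 2 ^+ n by rewrite truncn_le.
  have := HN _ Nn; rewrite -[X in X < _]div1r ltr_pdivrMr// mulrBl => H.
  by move: t2 H; lra.
have {sT}sT : s < T0 by rewrite lt_neqAle sT.
have step n : dyadic_step n (grid_horizon T0 n) (g n) s = g n (Num.truncn (s * 2 ^+ n)).
  rewrite /dyadic_step s0/= ifT// ltnS le_truncn// ler_wpM2r ?(ltW (pow2_gt0 _)) ?(ltW sT)//.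
under eq_fun do rewrite step.
rewrite /alive_fun s0 sT/= aliveE.
have [hs|hs] := ltP (hitting z b) s%:E.
  apply: cvg_near_cst.
  have [u [u0 us zu]] := hitting_lt _ _ _ hs.
  have [h h0 Hh] := rc_below z b z_rc u u0 zu.
  have [|N HN] := dyadic_after u (Num.min h (s - u)) u0.
    by rewrite lt_min h0 subr_gt0.
  exists N => // n /= Nn; have [uD Du] := HN n Nn.
  rewrite /g ifF//; apply/negbTE/negP => /grid_aliveP.
  move=> /(_ (Num.truncn (u * 2 ^+ n)).+1).
  rewrite ltnS le_truncn ?ler_wpM2r ?(ltW (pow2_gt0 _)) ?(ltW us)// => /(_ isT).
  rewrite leNgt (Hh (dyadic_up n u))//.
  by rewrite (lt_le_trans Du)// lerD2l ge_min lexx.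
have {sh}sh : (s%:E < hitting z b)%E by rewrite lt_neqAle sh.
have [h h0 Hh] : exists2 h, 0 < h & ((s + h)%:E <= hitting z b)%E.
  move: sh; case: (hitting z b) => [r| |]//.
    rewrite lte_fin => sr; exists (r - s); first by rewrite subr_gt0.
    by rewrite lee_fin addrC subrK.
  by move=> _; exists 1 => //; rewrite leey.
have D : z (dyadic_up n s) @[n --> \oo] --> z s.
  apply: rc_cvg => //; last exact: dyadic_up_cvg.
  by move=> n; exact/ltW/dyadic_up_gt.
have : phi (z (dyadic_up n s)) @[n --> \oo] --> phi (z s).
  by apply: (cvg_comp _ _ D); exact: cphi.
apply: cvg_trans; apply: near_eq_cvg.
have [N HN] := dyadic_after s h s0 h0.
exists N => // n /= Nn; have [sD Ds] := HN n Nn.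
rewrite /g ifT//; apply/grid_aliveP => j jk.
move/(hitting_geP z b): Hh; apply; first by rewrite divr_ge0// ltW// pow2_gt0.
by rewrite (le_lt_trans _ Ds)// ler_pM2r ?invr_gt0 ?pow2_gt0// ler_nat.
Qed.

Lemma dyadic_step_ge0 n N k : (forall j, 0 <= k j) -> forall s, 0 <= dyadic_step n N k s.
Proof. by move=> k0 s; rewrite /dyadic_step; case: ifP. Qed.

Lemma riemann_alive :
  (\sum_(k < grid_horizon T0 n) g n k / 2 ^+ n)%:E @[n --> \oo] -->
  (\int[leb]_s (alive_fun s)%:E)%E.
Proof.
have g0 n k : 0 <= g n k by rewrite /g; case: ifP.
under eq_fun do rewrite -integral_dyadic_step//.
have M0 : 0 <= M by apply: le_trans (phiM _ (lexx b)).
pose D : set R := `[0, T0 + 1]%classic.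
have mD : measurable D by exact: measurable_itv.
have [||||| _ _ //] := @dominated_convergence _ _ _ leb setT measurableT
  (fun n s => (dyadic_step n (grid_horizon T0 n) (g n) s)%:E) (fun s => (alive_fun s)%:E)
  (fun s => (M * \1_D s)%:E).
- by move=> n; apply/measurable_EFinP; exact: measurable_dyadic_step_fun.
- by apply/measurable_EFinP; exact: measurable_alive_fun.
- exists ([set T0] `|` [set fine (hitting z b)]); split.
  + by apply: measurableU; exact: measurable_set1.
  + rewrite null_set_setU//; try exact: measurable_set1.
    * exact: lebesgue_measure_set1.
    * exact: lebesgue_measure_set1.
  + move=> s /= /not_implyP[_ ns]; apply: contrapT => /not_orP[/eqP sT /eqP sh].
    apply: ns; apply: cvg_EFin; first exact: nearW.
    apply: step_cvg => //; apply: contra sh => /eqP <- //=.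
- under eq_fun do rewrite EFinM.
  by apply: integrableZl => //; exact: integrable_indic_itv.
- apply: aeW => s n _; rewrite gee0_abs ?lee_fin ?dyadic_step_ge0//.
  rewrite /dyadic_step; case: ifPn => [/andP[s0 sN]|_]; last by rewrite mulr_ge0.
  rewrite indicE mem_set ?mulr1; last first.
    rewrite /D/= in_itv/= s0/=.
    have p2 := pow2_gt0 (R := R) n.
    apply/ltW/(@lt_le_trans _ _ (dyadic_up n T0)).
      rewrite ltr_pdivlMr//; apply: (lt_le_trans (truncnS_gt _)).
      by rewrite ler_nat.
    rewrite (le_trans (dyadic_up_le _ _ T00))// lerD2l invf_le1//.
    by rewrite exprn_ege1// ler1n.
  rewrite /g; case: ifPn => // /grid_aliveP H; apply: phiM; exact: H.
Qed.

End step_integrals.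

Section l2_convergence.
Context {R : realType} {d : measure_display} {T : measurableType d}.
Variable P : probability T R.

(* Vitali's theorem in the simplest case: L2-boundedness gives uniform
   integrability, via min (y, M) <= y <= min (y, M) + y ^ 2 / M. *)
Lemma l2_bounded_cvg (Y : nat -> T -> R) (Z : T -> R) (c : nat -> R) (l K B : R) :
  (forall n, measurable_fun setT (Y n)) -> (forall n w, 0 <= Y n w) ->
  (forall w, Y n w @[n --> \oo] --> Z w) ->
  {ae P, forall w, Z w <= B} ->
  (forall n, \int[P]_w (Y n w)%:E = (c n)%:E)%E -> c n @[n --> \oo] --> l ->
  (forall n, \int[P]_w (Y n w ^+ 2)%:E <= K%:E)%E ->
  (\int[P]_w (Z w)%:E = l%:E)%E.
Proof.
move=> mY Y0 YZ ZB Yc cl YK.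
have mZ : measurable_fun setT Z by apply: (measurable_fun_cvg mY) => w _; exact: YZ.
have Z0 w : 0 <= Z w by rewrite -(cvg_lim _ (YZ w))//; apply: limr_ge; [exact: cvgP (YZ w)|exact: nearW].
have K0 : 0 <= K.
  rewrite -lee_fin; apply: le_trans (YK 0%N); apply: integral_ge0 => w _.
  by rewrite lee_fin sqr_ge0.
pose t M n w := Num.min (Y n w) M.
have mt M n : measurable_fun setT (t M n) by apply: measurable_minr.
have lim M : 0 < M -> B < M ->
    (\int[P]_w (t M n w)%:E @[n --> \oo] --> \int[P]_w (Z w)%:E)%E.
  move=> M0 BM.
  have [||||| _ _] := @dominated_convergence _ _ _ P setT measurableT
    (fun n w => (t M n w)%:E) (fun w => (Z w)%:E) (fun=> M%:E).
  - by move=> n; apply/measurable_EFinP.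
  - exact/measurable_EFinP.
  - apply: filterS ZB => w Zw _; apply: cvg_EFin; first exact: nearW.
    apply: cvg_trans (YZ w); apply: near_eq_cvg.
    have /cvgr_lt := YZ w; move=> /(_ M (le_lt_trans Zw BM)).
    by apply: filterS => n /ltW YM; rewrite /= /t min_l.
  - exact: (@finite_measure_integrable_cst _ _ _ P setT M measurableT).
  - apply: aeW => w n _; rewrite gee0_abs ?lee_fin ?le_min ?Y0 ?(ltW M0)//.
    by rewrite ge_min lexx orbT.
  - by [].
have bnd M n : 0 < M -> (\int[P]_w (t M n w)%:E <= (c n)%:E)%E /\
    ((c n)%:E <= \int[P]_w (t M n w)%:E + (K / M)%:E)%E.
  move=> M0; rewrite -Yc; split.
    apply: ge0_le_integral => //.
    - by move=> w _; rewrite lee_fin le_min Y0 ltW.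
    - by apply/measurable_EFinP.
    - exact/measurable_EFinP.
    - by move=> w _; rewrite lee_fin ge_min lexx.
  apply: (@le_trans _ _ (\int[P]_w ((t M n w)%:E + (M^-1)%:E * (Y n w ^+ 2)%:E))%E).
    apply: ge0_le_integral => //.
    - by move=> w _; rewrite lee_fin.
    - exact/measurable_EFinP.
    - apply: emeasurable_funD; first exact/measurable_EFinP.
      by apply: measurable_funeM; apply/measurable_EFinP; exact: measurable_funX.
    - move=> w _; rewrite -EFinM -EFinD lee_fin /t.
      have [YM|MY] := leP (Y n w) M.
        by rewrite lerDl mulr_ge0 ?sqr_ge0// invr_ge0 ltW.
      rewrite (@le_trans _ _ (M^-1 * Y n w ^+ 2))//; last by rewrite lerDr ltW.
      by rewrite mulrC ler_pdivlMr// expr2 ler_wpM2l// ltW.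
  rewrite ge0_integralD//; last 4 first.
  - by move=> w _; rewrite lee_fin le_min Y0 ltW.
  - exact/measurable_EFinP.
  - by move=> w _; rewrite -EFinM lee_fin mulr_ge0 ?sqr_ge0// invr_ge0 ltW.
  - by apply: measurable_funeM; apply/measurable_EFinP; exact: measurable_funX.
  rewrite leeD2l// ge0_integralZl_EFin ?invr_ge0 ?(ltW M0)//; last 2 first.
  - by move=> w _; rewrite lee_fin sqr_ge0.
  - by apply/measurable_EFinP; exact: measurable_funX.
  by rewrite mulrC EFinM lee_wpmul2l// lee_fin invr_ge0 ltW.
have clE : ((c n)%:E @[n --> \oo] --> l%:E)%E by apply: cvg_EFin => //; exact: nearW.
have up M : 0 < M -> B < M -> (\int[P]_w (Z w)%:E <= l%:E)%E.
  move=> M0 BM; rewrite -(cvg_lim _ (lim M M0 BM))// -(cvg_lim _ clE)//.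
  apply: lee_lim; [exact: cvgP (lim M M0 BM)|exact: cvgP clE|].
  by apply: nearW => n; have [] := bnd M n M0.
have dn M : 0 < M -> B < M -> (l%:E <= \int[P]_w (Z w)%:E + (K / M)%:E)%E.
  move=> M0 BM.
  have L : ((\int[P]_w (t M n w)%:E + (K / M)%:E) @[n --> \oo] --> \int[P]_w (Z w)%:E + (K / M)%:E)%E.
    apply: cvgeD; [by rewrite fin_num_adde_defl|exact: lim|exact: cvg_cst].
  rewrite -(cvg_lim _ L)// -(cvg_lim _ clE)//.
  apply: lee_lim; [exact: cvgP clE|exact: cvgP L|].
  by apply: nearW => n; have [] := bnd M n M0.
pose M0 := Num.max (B + 1) 1.
have M00 : 0 < M0 by rewrite lt_max ltr01 orbT.
have BM0 : B < M0 by rewrite lt_max ltrDl ltr01.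
apply/eqP; rewrite eq_le (up M0 M00 BM0)/=.
apply/lee_addgt0Pr => e e0.
pose M := Num.max M0 (K / e).
have M_0 : 0 < M by rewrite lt_max M00.
have BM : B < M by rewrite lt_max BM0.
apply: (le_trans (dn M M_0 BM)); rewrite leeD2l// lee_fin ler_pdivrMr// mulrC -ler_pdivrMr//.
by rewrite le_max lexx orbT.
Qed.

End l2_convergence.

Lemma sum_shift (V : zmodType) (a : nat -> V) N :
  \sum_(k < N) a k = \sum_(k < N) a k.+1 + (a 0%N - a N).
Proof.
elim: N => [|N IH]; first by rewrite !big_ord0 subrr addr0.
by rewrite !big_ord_recr/= IH -!addrA; congr (_ + _); rewrite addNr addr0 [RHS]addrC subrK.
Qed.

Lemma subr_bounded (R : realDomainType) (u v M : R) :
  0 <= u <= M -> 0 <= v <= M -> - M <= u - v <= M.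
Proof. by move=> /andP[? ?] /andP[? ?]; lra. Qed.

Section dynkin.
Context {R : realType} {d : measure_display} {T : measurableType d}.
Variables (P : probability T R) (X : R -> T -> R) (Ps : R -> R).
Hypothesis HX : levy_process P X Ps.
Hypothesis Ps0 : forall l, 0 <= l -> 0 <= Ps l.
Local Notation path := (@path_space R R).
Local Notation leb := (@lebesgue_measure R).

Lemma measurable_grid_alive (x b : R) n k :
  measurable_fun setT (fun e : path => grid_alive (fun t => x + e t) b n k).
Proof.
apply: (measurable_fun_bool true); rewrite setTI.
rewrite (_ : _ @^-1` _ = \bigcap_j (if (j <= k)%N then
    (fun e : path => x + e (j%:R / 2 ^+ n)) @^-1` `[b, +oo[%classic else setT)).
  apply: bigcapT_measurable => j; case: ifP => // _.
  rewrite -[X in measurable X]setTI.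
  have : measurable_fun setT (fun e : path => x + e (j%:R / 2 ^+ n)).
    by apply: measurable_funD => //; exact: (measurable_eval R (j%:R / 2 ^+ n : R)).
  by apply => //; exact: measurable_itv.
apply/seteqP; split => e /=.
  by move=> /grid_aliveP H j _; case: ifP => // jk /=; rewrite in_itv/= andbT; exact: H.
move=> H; apply/grid_aliveP => j jk.
by have := H j Logic.I; rewrite jk /= in_itv/= andbT.
Qed.

Variables (x b : R).

Let z (w : T) (t : R) := x + X t w.
Let E (l : R) n k w := expR (- (l * z w (k%:R / 2 ^+ n))).
Let ga n k w := grid_alive (z w) b n k.

Let z_rc w t : 0 <= t -> z w s @[s --> t^'+] --> z w t.
Proof. exact: (levy_rc_shift _ _ _ HX). Qed.

Let mz t : measurable_fun setT (z ^~ t).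
Proof. by apply: measurable_funD => //; exact: (levy_measurable _ _ _ HX). Qed.

Let mE l n k : measurable_fun setT (E l n k).
Proof.
apply: measurableT_comp => //; apply: measurable_funN.
by apply: measurable_funM => //; exact: mz.
Qed.

Let levy_pathE w t : 0 <= t -> levy_path X w t = X t w.
Proof. by move=> t0; rewrite /levy_path max_l. Qed.

Let grid_ge0 n k : 0 <= k%:R / 2 ^+ n :> R.
Proof. by rewrite divr_ge0// ltW// pow2_gt0. Qed.

Let ga_path n k w : ga n k w = grid_alive (fun t => x + levy_path X w t) b n k.
Proof.
by apply: eq_all => j; rewrite levy_pathE.
Qed.

Let mga n k : measurable_fun setT (ga n k).
Proof.
rewrite (_ : ga n k = fun w => grid_alive (fun t => x + levy_path X w t) b n k); last first.
  by apply/funext => w; rewrite ga_path.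
exact: (measurableT_comp (measurable_grid_alive x b n k) (measurable_levy_path _ _ _ HX)).
Qed.

Let alpha l n k := (\int[P]_w (if ga n k w then E l n k w else 0)%:E)%E.

Let E_ge0 l n k w : 0 <= E l n k w. Proof. exact: expR_ge0. Qed.

Let alpha_ge0 l n k : (0 <= alpha l n k)%E.
Proof. by apply: integral_ge0 => w _; rewrite lee_fin; case: ifP. Qed.

Let E_le l n k w : 0 <= l -> ga n k w -> E l n k w <= expR (- (l * b)).
Proof.
move=> l0 /grid_aliveP/(_ k (leqnn k)) bz.
by rewrite ler_expR lerN2 ler_wpM2l.
Qed.

Let malpha l n k : measurable_fun setT (fun w => (if ga n k w then E l n k w else 0)%:E).
Proof. by apply/measurable_EFinP; apply: measurable_fun_ifT => //. Qed.

Let alpha_le l n k : 0 <= l -> (alpha l n k <= (expR (- (l * b)))%:E)%E.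
Proof.
move=> l0.
have -> : ((expR (- (l * b)))%:E = \int[P]_w (expR (- (l * b)))%:E)%E.
  by rewrite integral_cst// [X in (_ * X)%E]probability_setT mule1.
apply: ge0_le_integral => //.
- by move=> w _; rewrite lee_fin; case: ifP.
- by move=> w _; rewrite lee_fin; case: ifP => // gw; exact: E_le.
Qed.

Let alpha_fin l n k : 0 <= l -> alpha l n k \is a fin_num.
Proof.
by move=> l0; rewrite ge0_fin_numE// (le_lt_trans (alpha_le _ _ _ l0))// ltry.
Qed.

Let alpha_step l n k : 0 <= l ->
  (\int[P]_w (if ga n k w then E l n k.+1 w else 0)%:E =
   (expR ((2 ^+ n)^-1 * Ps l))%:E * alpha l n k)%E.
Proof.
move=> l0.
set s : R := k%:R / 2 ^+ n; set h : R := (2 ^+ n)^-1.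
have s0 : 0 <= s by exact: grid_ge0.
have h0 : 0 <= h by rewrite invr_ge0 ltW// pow2_gt0.
have sh : s + h = k.+1%:R / 2 ^+ n by rewrite /s /h -[k.+1%:R]natr1 mulrDl mul1r.
pose F (e : path) := (if grid_alive (fun t => x + e t) b n k then expR (- (l * (x + e s))) else 0)%:E.
have mF : measurable_fun setT F.
  apply/measurable_EFinP; apply: measurable_fun_ifT => //; first exact: measurable_grid_alive.
  apply: measurableT_comp => //; apply: measurable_funN; apply: measurable_funM => //.
  by apply: measurable_funD => //; exact: (measurable_eval R (s : R)).
have F0 e : (0 <= F e)%E by rewrite lee_fin; case: ifP.
have pastE w t : 0 <= t -> t <= s -> past X s w t = X t w.
  by move=> t0 ts; rewrite /past max_l// min_l.
have FE w : F (past X s w) = (if ga n k w then E l n k w else 0)%:E.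
  rewrite /F pastE//; have -> // : grid_alive (fun t => x + past X s w t) b n k = ga n k w.
  apply: eq_in_all => j; rewrite mem_iota add0n ltnS => jk; rewrite pastE//.
  by rewrite ler_pM2r ?invr_gt0 ?pow2_gt0// ler_nat.
have := markov_increment _ _ _ HX F l s h s0 h0 mF F0.
under [in X in _ = (X * _)%E]eq_integral do rewrite FE.
rewrite (mgf_dyadic _ _ _ HX)// muleC => <-.
apply: eq_integral => w _; rewrite FE -EFinM; congr EFin.
case: ifP => _; last by rewrite mul0r.
by rewrite -expRD sh /E /z; congr expR; ring.
Qed.

Let stop n N w := grid_stop (z w) b n N.
Let S l n N := (\int[P]_w (E l n (stop n N w) w)%:E)%E.

Let stopS n N w : stop n N.+1 w = if ga n N w then N.+1 else stop n N w.
Proof. by []. Qed.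

Let mstop l n N : measurable_fun setT (fun w => E l n (stop n N w) w).
Proof.
elim: N => [|N IH]; first exact: mE.
rewrite (_ : (fun w => _) = fun w => if ga n N w then E l n N.+1 w else E l n (stop n N w) w).
  exact: measurable_fun_ifT.
by apply/funext => w; rewrite stopS; case: ifP.
Qed.

Let S_step l n N : 0 <= l ->
  (S l n N.+1 + alpha l n N = S l n N + (expR ((2 ^+ n)^-1 * Ps l))%:E * alpha l n N)%E.
Proof.
move=> l0; rewrite -(alpha_step l n N l0).
have D (f g : T -> R) : measurable_fun setT f -> measurable_fun setT g ->
    (forall w, 0 <= f w) -> (forall w, 0 <= g w) ->
    (\int[P]_w (f w)%:E + \int[P]_w (g w)%:E = \int[P]_w (f w + g w)%:E)%E.
  move=> mf mg f0 g0; rewrite -ge0_integralD//.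
  - by move=> w _; rewrite lee_fin.
  - exact/measurable_EFinP.
  - by move=> w _; rewrite lee_fin.
  - exact/measurable_EFinP.
have mi k : measurable_fun setT (fun w => if ga n N w then E l n k w else 0).
  exact: measurable_fun_ifT.
have i0 k w : 0 <= (if ga n N w then E l n k w else 0) by case: ifP.
rewrite /S /alpha (D _ _ (mstop l n N.+1) (mi N) (fun w => E_ge0 l n _ w) (i0 N)).
rewrite (D _ _ (mstop l n N) (mi N.+1) (fun w => E_ge0 l n _ w) (i0 N.+1)).
apply: eq_integral => w _; congr EFin.
rewrite stopS; case: ifPn => gN; last by rewrite !addr0.
by rewrite /stop grid_stop_alive// addrC.
Qed.

Let S_identity l n N : 0 <= l -> S l n N =
  (expR (- (l * x)) + (expR ((2 ^+ n)^-1 * Ps l) - 1) * \sum_(k < N) fine (alpha l n k))%:E.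
Proof.
move=> l0; elim: N => [|N IH].
  rewrite /S big_ord0 mulr0 addr0.
  rewrite (eq_integral (fun=> (expR (- (l * x)))%:E)).
    by rewrite integral_cst// [X in (_ * X)%E]probability_setT mule1.
  by move=> w _; rewrite /E /z mul0r (levy0 _ _ _ HX) addr0.
have := S_step l n N l0; rewrite IH -(fineK (alpha_fin l n N l0)).
set a := fine (alpha l n N); rewrite -EFinM -EFinD.
have : (0 <= S l n N.+1)%E by apply: integral_ge0 => w _; rewrite lee_fin.
case: (S l n N.+1) => [r| |]// _ [] H; congr EFin.
rewrite big_ord_recr/= -/a; move: H; set u := \sum_(_ < _) _.
by move=> /(congr1 (fun t => t - a)); rewrite addrK => ->; ring.
Qed.

Variable T0 : R.
Hypothesis T00 : 0 <= T0.

Let N0 n := grid_horizon T0 n.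

Let sum_alpha_le l n : 0 <= l ->
  \sum_(k < N0 n) fine (alpha l n k) <= (T0 * 2 ^+ n + 1) * expR (- (l * b)).
Proof.
move=> l0.
apply: (@le_trans _ _ (\sum_(k < N0 n) expR (- (l * b)))).
  apply: ler_sum => k _; rewrite -lee_fin fineK ?alpha_fin//; exact: alpha_le.
rewrite sumr_const card_ord -[leLHS]mulr_natl; apply: ler_wpM2r; first exact: expR_ge0.
rewrite /N0 /grid_horizon -natr1 lerD2r truncn_le.
by rewrite mulr_ge0// ltW// pow2_gt0.
Qed.

Let expR_sub1_le (y : R) : 0 <= y -> expR y - 1 <= y * expR y.
Proof.
move=> y0; have := expR_ge1Dx (- y); rewrite expRN.
have e0 := expR_gt0 y.
rewrite -(ler_pM2r e0) mulVf ?gt_eqF//; lra.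
Qed.

Let S_bound l : 0 <= l -> exists K, forall n, (S l n (N0 n) <= K%:E)%E.
Proof.
move=> l0; exists (expR (- (l * x)) + Ps l * expR (Ps l) * (T0 + 1) * expR (- (l * b))) => n.
rewrite S_identity// lee_fin lerD2l.
set h : R := (2 ^+ n)^-1.
have p2 := pow2_gt0 (R := R) n.
have h0 : 0 < h by rewrite invr_gt0.
have h1 : h <= 1 by rewrite invf_le1// exprn_ege1// ler1n.
have hP : 0 <= h * Ps l by rewrite mulr_ge0// ?Ps0// ltW.
have e1 : expR (h * Ps l) - 1 <= h * Ps l * expR (Ps l).
  apply: (le_trans (expR_sub1_le _ hP)); apply: ler_wpM2l => //.
  by rewrite ler_expR ler_piMl// Ps0.
have e0 : 0 <= expR (h * Ps l) - 1 by rewrite subr_ge0 -expR0 ler_expR.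
apply: (@le_trans _ _ ((h * Ps l * expR (Ps l)) * ((T0 * 2 ^+ n + 1) * expR (- (l * b))))).
  apply: ler_pM => //; last exact: sum_alpha_le.
  by apply: sumr_ge0 => k _; exact: fine_ge0.
have -> : h * Ps l * expR (Ps l) * ((T0 * 2 ^+ n + 1) * expR (- (l * b))) =
    Ps l * expR (Ps l) * (T0 + h) * expR (- (l * b)).
  by rewrite /h; field; rewrite gt_eqF.
by apply: ler_wpM2r; rewrite ?expR_ge0// ler_wpM2l ?lerD2l// mulr_ge0 ?expR_ge0// Ps0.
Qed.

Let Y l w := expR (- (l * z w (stopped (z w) b T0))).

Let J l := (\int[P]_w \int[leb]_s (alive_fun (z w) b (fun y => expR (- (l * y))) T0 s)%:E)%E.

Let cphi (l : R) : continuous (fun y : R => expR (- (l * y))).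
Proof.
move=> y; apply: continuous_comp; last exact: continuous_expR.
by apply: continuousN; apply: continuousM => //; exact: cst_continuous.
Qed.

Let Jn l n w := \sum_(k < N0 n) (if ga n k.+1 w then E l n k.+1 w else 0) / 2 ^+ n.

Let J_cvg l : 0 <= l -> J l \is a fin_num /\
  (\sum_(k < N0 n) fine (alpha l n k.+1)) / 2 ^+ n @[n --> \oo] --> fine (J l).
Proof.
move=> l0.
have phiM y : b <= y -> expR (- (l * y)) <= expR (- (l * b)).
  by move=> bY; rewrite ler_expR lerN2 ler_wpM2l.
have phi0 y : 0 <= expR (- (l * y)) by exact: expR_ge0.
have lim w := riemann_alive (z w) b (z_rc w) _ _ T0 (cphi l) phi0 phiM T00.
have mJn n : measurable_fun setT (fun w => (Jn l n w)%:E).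
  apply/measurable_EFinP; apply: measurable_sum => k; apply: measurable_funM => //.
  exact: measurable_fun_ifT.
have Jn0 n w : 0 <= Jn l n w.
  by apply: sumr_ge0 => k _; rewrite divr_ge0// ?(ltW (pow2_gt0 _))//; case: ifP.
have JnM n w : Jn l n w <= (T0 + 1) * expR (- (l * b)).
  have p2 := pow2_gt0 (R := R) n.
  apply: (@le_trans _ _ (\sum_(k < N0 n) expR (- (l * b)) / 2 ^+ n)).
    apply: ler_sum => k _; rewrite ler_wpM2r ?invr_ge0 ?(ltW p2)//.
    by case: ifP => // gk; exact: E_le.
  rewrite sumr_const card_ord -[leLHS]mulr_natl mulrCA mulrC ler_wpM2r ?expR_ge0//.
  have := dyadic_up_le n _ T00; rewrite /dyadic_up -/(grid_horizon T0 n) => H.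
  by rewrite (le_trans H)// lerD2l invf_le1// exprn_ege1// ler1n.
have [||||| iJ _ cJ] := @dominated_convergence _ _ _ P setT measurableT
  (fun n w => (Jn l n w)%:E)
  (fun w => \int[leb]_s (alive_fun (z w) b (fun y => expR (- (l * y))) T0 s)%:E)%E
  (fun=> ((T0 + 1) * expR (- (l * b)))%:E).
- exact: mJn.
- by apply: (emeasurable_fun_cvg (fun n w => (Jn l n w)%:E)) => // w _; exact: lim.
- by apply: aeW => w _; exact: lim.
- exact: (@finite_measure_integrable_cst _ _ _ P setT _ measurableT).
- by apply: aeW => w n _; rewrite gee0_abs ?lee_fin.
have Jfin : J l \is a fin_num by exact: integrable_fin_num.
split => //.
have sumE n : (\int[P]_w (Jn l n w)%:E = ((\sum_(k < N0 n) fine (alpha l n k.+1)) / 2 ^+ n)%:E)%E.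
  transitivity (\int[P]_w (\sum_(k < N0 n) ((2 ^+ n)^-1%:E * (if ga n k.+1 w then E l n k.+1 w else 0)%:E)))%E.
    apply: eq_integral => w _; rewrite sumEFin; congr EFin; apply: eq_bigr => k _.
    by rewrite mulrC.
  rewrite ge0_integral_sum//; last 2 first.
  - by move=> k; apply: measurable_funeM; exact: malpha.
  - move=> k w _; rewrite -EFinM lee_fin mulr_ge0 ?invr_ge0 ?(ltW (pow2_gt0 _))//.
    by case: ifP.
  rewrite mulr_suml -sumEFin; apply: eq_bigr => k _.
  rewrite ge0_integralZl_EFin ?invr_ge0 ?(ltW (pow2_gt0 _))//; last first.
    by move=> w _; rewrite lee_fin; case: ifP.
  by rewrite mulrC EFinM fineK ?alpha_fin.
move: cJ; rewrite (_ : [sequence _]_n = (fun n => ((\sum_(k < N0 n) fine (alpha l n k.+1)) / 2 ^+ n)%:E)); last first.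
  by apply/funext => n; exact: sumE.
by rewrite -/(J l) -(fineK Jfin) => /fine_cvg.
Qed.

Let pow2_inv_cvg : (2 ^+ n)^-1 @[n --> \oo] --> (0 : R).
Proof.
apply/cvgrPdist_lt => e e0; have [N HN] := pow2_inv_lt _ e0.
exists N => // n /= Nn; rewrite sub0r normrN gtr0_norm ?HN//.
Qed.

Let rhs_cvg l : 0 <= l ->
  expR (- (l * x)) + (expR ((2 ^+ n)^-1 * Ps l) - 1) * \sum_(k < N0 n) fine (alpha l n k)
  @[n --> \oo] --> expR (- (l * x)) + Ps l * fine (J l).
Proof.
move=> l0; have [_ Jc] := J_cvg l l0.
have eh : expR ((2 ^+ n)^-1 * Ps l) @[n --> \oo] --> (1 : R).
  rewrite -[X in _ --> X]expR0 -[X in _ --> expR X](mul0r (Ps l)).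
  have h0 : (2 ^+ n)^-1 * Ps l @[n --> \oo] --> 0 * Ps l by apply: cvgM => //; exact: cvg_cst.
  by apply: continuous_cvg h0; exact: continuous_expR.
have ratio : (expR ((2 ^+ n)^-1 * Ps l) - 1) * 2 ^+ n @[n --> \oo] --> Ps l.
  apply: (@squeeze_cvgr _ _ _ _ (fun=> Ps l) (fun n => Ps l * expR ((2 ^+ n)^-1 * Ps l))).
  - apply: nearW => n; have p2 := pow2_gt0 (R := R) n.
    have hP : 0 <= (2 ^+ n)^-1 * Ps l by rewrite mulr_ge0 ?Ps0// invr_ge0 ltW.
    apply/andP; split.
      have := expR_ge1Dx ((2 ^+ n)^-1 * Ps l).
      by rewrite -ler_pdivrMr// [Ps l / _]mulrC; lra.
    rewrite -ler_pdivlMr//; apply: (le_trans (expR_sub1_le _ hP)).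
    by rewrite [leRHS]mulrC mulrA.
  - exact: cvg_cst.
  - by rewrite -[X in _ --> X]mulr1; apply: cvgM eh; exact: cvg_cst.
have rest : (expR ((2 ^+ n)^-1 * Ps l) - 1) * (fine (alpha l n 0) - fine (alpha l n (N0 n)))
    @[n --> \oo] --> (0 : R).
  pose M := expR (- (l * b)).
  have aM n k : 0 <= fine (alpha l n k) <= M.
    by rewrite fine_ge0//= -lee_fin fineK ?alpha_fin// alpha_le.
  have e1 : (expR ((2 ^+ n)^-1 * Ps l) - 1) * M @[n --> \oo] --> (0 : R).
    rewrite -(mul0r M) -(subrr 1); apply: cvgM; last exact: cvg_cst.
    by apply: cvgB => //; exact: cvg_cst.
  have e2 : - ((expR ((2 ^+ n)^-1 * Ps l) - 1) * M) @[n --> \oo] --> (0 : R).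
    by rewrite -oppr0; exact: cvgN.
  apply: (@squeeze_cvgr _ _ _ _ _ _ _ _ _ e2 e1).
  apply: nearW => n.
  have e0 : 0 <= expR ((2 ^+ n)^-1 * Ps l) - 1.
    by rewrite subr_ge0 -expR0 ler_expR mulr_ge0 ?Ps0// invr_ge0 ltW// pow2_gt0.
  have /andP[uM uM'] := subr_bounded _ _ _ _ (aM n 0%N) (aM n (N0 n)).
  by rewrite -mulrN; apply/andP; split; apply: ler_wpM2l.
have tot := cvgD (cvgM ratio Jc) rest.
rewrite addr0 in tot.
apply: cvgD; first exact: cvg_cst.
rewrite [X in fmap X](_ : _ = (fun n => (expR ((2 ^+ n)^-1 * Ps l) - 1) * 2 ^+ n) \*
    (fun n => (\sum_(k < N0 n) fine (alpha l n k.+1)) / 2 ^+ n) +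
    (fun n => (expR ((2 ^+ n)^-1 * Ps l) - 1) * (fine (alpha l n 0) - fine (alpha l n (N0 n)))));
  first exact: tot.
apply/funext => n.
transitivity ((expR ((2 ^+ n)^-1 * Ps l) - 1) * 2 ^+ n *
    ((\sum_(k < N0 n) fine (alpha l n k.+1)) / 2 ^+ n) +
    (expR ((2 ^+ n)^-1 * Ps l) - 1) * (fine (alpha l n 0) - fine (alpha l n (N0 n)))); last by [].
have p2 := pow2_gt0 (R := R) n.
set a := fun k => fine (alpha l n k).
have -> : \sum_(k < N0 n) fine (alpha l n k) = \sum_(k < N0 n) a k.+1 + (a 0%N - a (N0 n)).
  exact: sum_shift.
by rewrite mulrDr -mulrA [2 ^+ n * _]mulrC divfK// gt_eqF.
Qed.

Lemma measurable_stopped l :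
  measurable_fun setT (fun w => expR (- (l * (x + X (stopped (fun t => x + X t w) b T0) w)))).
Proof.
apply: (@measurable_fun_cvg _ _ _ setT (fun n w => E l n (stop n (N0 n) w) w)) => [n|w _].
  exact: mstop.
apply: (cvg_comp (fun n => z w ((stop n (N0 n) w)%:R / 2 ^+ n)) (fun y => expR (- (l * y)))).
  exact: (z_grid_stop_cvg (z w) b (z_rc w) T0 T00).
exact: cphi.
Qed.

Hypothesis no_over : {ae P, forall w, forall t, tau_below X x b w = t%:E -> x + X t w = b}.

Lemma stopped_dynkin l : 0 <= l ->
  (\int[P]_w (expR (- (l * (x + X (stopped (fun t => x + X t w) b T0) w))))%:E =
   (expR (- (l * x)))%:E + (Ps l)%:E * \int[P]_w \int[leb]_s
     (alive_fun (fun t => x + X t w) b (fun y => expR (- (l * y))) T0 s)%:E)%E.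
Proof.
move=> l0; rewrite -[X in (_ * X)%E]/(J l) -(fineK (J_cvg l l0).1) -EFinM -EFinD.
 have [K HK] := S_bound (2 * l) ltac:(lra).
apply: (@l2_bounded_cvg _ _ _ P (fun n w => E l n (stop n (N0 n) w) w) (Y l)
  (fun n => expR (- (l * x)) + (expR ((2 ^+ n)^-1 * Ps l) - 1) * \sum_(k < N0 n) fine (alpha l n k))
  _ K (expR (- (l * b)))).
- by [].
- by [].
- move=> w; apply: (cvg_comp (fun n => z w ((stop n (N0 n) w)%:R / 2 ^+ n)) (fun y => expR (- (l * y)))).
    exact: (z_grid_stop_cvg (z w) b (z_rc w) T0 T00).
  exact: cphi.
- apply: filterS no_over => w H.
  rewrite ler_expR lerN2 ler_wpM2l//.
  have [hT|hT] := leP (hitting (z w) b) T0%:E.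
    by rewrite [leRHS]H//; exact: stopped_hit.
  rewrite stopped_alive// leNgt; apply/negP => zT.
  by have := le_lt_trans (hitting_le (z w) b T0 T00 zT) hT; rewrite ltxx.
- by move=> n; rewrite -S_identity.
- exact: rhs_cvg.
- move=> n; apply: le_trans (HK n); rewrite le_eqVlt; apply/orP; left; apply/eqP.
  apply: eq_integral => w _; rewrite -expRM_natl; congr (expR _)%:E; ring.
Qed.

End dynkin.

(** * Occupation density before first passage *)

Section killed_occupation.
Context {R : realType} {d : measure_display} {T : measurableType d}.
Variables (P : probability T R) (X : R -> T -> R) (Ps : R -> R).
Hypothesis HX : levy_process P X Ps.
Local Notation path := (@path_space R R).
Local Notation leb := (@lebesgue_measure R).
Variables (b : R).

Definition killed (f : R -> \bar R) (x : R) (w : T) (s : R) : \bar R :=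
  if (0 <= s) && (s%:E <= tau_below X x b w)%E then f (x + X s w) else 0%E.

Lemma killedE f x w s : (if (0 <= s) && alive (fun t => x + levy_path X w t) b s
  then f (x + regularize (levy_path X w) s) else 0%E) = killed f x w s.
Proof.
rewrite /killed; have [s0|] //= := boolP (0 <= s).
rewrite (regularize_levy _ _ _ HX)//.
have -> // : alive (fun t => x + levy_path X w t) b s = (s%:E <= tau_below X x b w)%E.
by apply/idP/idP => /(alive_levy _ _ _ HX).
Qed.

Lemma killed_ge0 f x w s : (forall y, 0 <= f y)%E -> (0 <= killed f x w s)%E.
Proof. by rewrite /killed => f0; case: ifP. Qed.

Lemma measurable_killed f x : measurable_fun setT f ->
  measurable_fun setT (fun p : T * R => killed f x p.1 p.2).
Proof.
move=> mf.
have m : measurable_fun setT (fun p : T * R => ((x, levy_path X p.1), p.2) : (R * path) * R).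
  apply: measurable_fun_pair => //; apply: measurable_fun_pair => //.
  exact: (measurableT_comp (measurable_levy_path _ _ _ HX)).
have := measurableT_comp (measurable_occupation_integrand b f mf) m.
by apply: eq_measurable_fun => p _ /=; rewrite killedE.
Qed.

Lemma occupation_killed f x w :
  occupation b f x (levy_path X w) = (\int[leb]_s killed f x w s)%E.
Proof. by apply: eq_integral => s _; rewrite killedE. Qed.

Lemma killed_fubini f x : measurable_fun setT f -> (forall y, 0 <= f y)%E ->
  (\int[P]_w \int[leb]_s killed f x w s = \int[leb]_s \int[P]_w killed f x w s)%E.
Proof.
move=> mf f0.
exact: (@fubini_tonelli _ _ _ _ R P leb _ (measurable_killed f x mf) (fun p => killed_ge0 f x p.1 p.2 f0)).
Qed.

Lemma measurable_killed1 f x w : measurable_fun setT f ->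
  measurable_fun setT (killed f x w).
Proof.
move=> mf; exact: (measurableT_comp (measurable_killed f x mf) (measurable_pair1 w)).
Qed.

Lemma measurable_killed2 f x s : measurable_fun setT f ->
  measurable_fun setT (fun w => killed f x w s).
Proof.
move=> mf; exact: (measurableT_comp (measurable_killed f x mf) (measurable_pair2 s)).
Qed.

Lemma measurable_survival x s : measurable [set w | (s%:E <= tau_below X x b w)%E].
Proof.
have [s0|s0] := leP 0 s.
  rewrite (_ : [set w | _] = (fun w => killed (fun=> 1%E) x w s) @^-1` [set 1%E]).
    rewrite -[X in measurable X]setTI.
    exact: (measurable_killed2 (fun=> 1%E) x s).
  apply/seteqP; split => w /=; rewrite /killed s0/=.
    by move=> ->.
  by case: ifP => // _ /eqP; rewrite eqe eq_sym oner_eq0.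
rewrite (_ : [set w | _] = setT)//.
apply/seteqP; split => // w _ /=; apply: (@le_trans _ _ 0%E); first by rewrite lee_fin ltW.
exact: hitting_ge0.
Qed.

Lemma measurable_ruin x : measurable [set w | (tau_below X x b w < +oo)%E].
Proof.
rewrite (_ : [set w | _] = \bigcup_(m : nat) ~` [set w | (m%:R%:E <= tau_below X x b w)%E]).
  by apply: bigcupT_measurable => m; apply: measurableC; exact: measurable_survival.
apply/seteqP; split => w /=.
  have : (0 <= tau_below X x b w)%E by exact: hitting_ge0.
  case taur : (tau_below X x b w) => [r| |]// r0 _.
  exists (Num.truncn r).+1 => //; rewrite /setC/= taur; apply/negP.
  by rewrite -ltNge lte_fin; exact: truncnS_gt.
by move=> [m _ /negP]; rewrite -ltNge => /lt_trans; apply; rewrite ltry.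
Qed.

End killed_occupation.

Section resolvent.
Context {R : realType} {d : measure_display} {T : measurableType d}.
Variables (P : probability T R) (X : R -> T -> R) (Ps : R -> R).
Hypothesis HX : levy_process P X Ps.
Hypothesis Ps0 : forall l, 0 <= l -> 0 <= Ps l.
Hypothesis Ps_gt0 : forall l, 0 < l -> 0 < Ps l.
Local Notation leb := (@lebesgue_measure R).
Variables (x b : R).
Hypothesis bx : b <= x.
Hypothesis no_over : {ae P, forall w, forall t, tau_below X x b w = t%:E -> x + X t w = b}.

Let ph (l y : R) : \bar R := (expR (- (l * y)))%:E.
Let z (w : T) (t : R) := x + X t w.
Let Y l T0 w : R := expR (- (l * (x + X (stopped (fun t => x + X t w) b T0) w))).
Let J l T0 := (\int[P]_w \int[leb]_s (if (s < T0)%R then killed X b (ph l) x w s else 0))%E.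

Let mph l : measurable_fun setT (ph l).
Proof.
apply/measurable_EFinP; apply: measurableT_comp => //; apply: measurable_funN.
exact: measurable_funM.
Qed.

Let ph0 l y : (0 <= ph l y)%E.
Proof. by rewrite lee_fin expR_ge0. Qed.

Let mY l T0 : 0 <= T0 -> measurable_fun setT (fun w => (Y l T0 w)%:E).
Proof.
move=> T00; apply/measurable_EFinP.
exact: (measurable_stopped P X Ps HX x b T0 T00 l).
Qed.

Let EY l T0 : 0 <= l -> 0 <= T0 ->
  (\int[P]_w (Y l T0 w)%:E = (expR (- (l * x)))%:E + (Ps l)%:E * J l T0)%E.
Proof.
move=> l0 T00; rewrite (stopped_dynkin P X Ps HX Ps0 x b T0 T00 no_over l l0).
congr (_ + _ * _)%E; apply: eq_integral => w _; apply: eq_integral => s _.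
rewrite /alive_fun /killed (aliveE _ _ (levy_rc_shift _ _ _ HX x w)) andbA [(0 <= s) && (s < T0)]andbC -andbA.
by have [] := ltP s T0 => //= _; case: ifP.
Qed.

Let Y_cases : {ae P, forall w, forall l T0, 0 <= l -> 0 <= T0 ->
  Y l T0 w = if (tau_below X x b w <= T0%:E)%E then expR (- (l * b)) else expR (- (l * z w T0))}.
Proof.
apply: filterS no_over => w H l T0 l0 T00; rewrite /Y; case: ifPn => hT.
  by rewrite H//; exact: stopped_hit.
by rewrite stopped_alive// ltNge.
Qed.

Let z_alive w T0 : 0 <= T0 -> (T0%:E < tau_below X x b w)%E -> b <= z w T0.
Proof.
move=> T00 hT; rewrite leNgt; apply/negP => zT.
by have := le_lt_trans (hitting_le (z w) b T0 T00 zT) hT; rewrite ltxx.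
Qed.

Let Y_le : {ae P, forall w, forall l T0, 0 <= l -> 0 <= T0 -> Y l T0 w <= expR (- (l * b))}.
Proof.
apply: filterS Y_cases => w H l T0 l0 T00; rewrite H//; case: ifPn => // hT.
by rewrite ler_expR lerN2 ler_wpM2l// z_alive// ltNge.
Qed.

Let cstP (c : R) : (\int[P]_w c%:E = c%:E)%E.
Proof. by rewrite integral_cst// [X in (_ * X)%E]probability_setT mule1. Qed.

Let EY_le l T0 : 0 <= l -> 0 <= T0 -> (\int[P]_w (Y l T0 w)%:E <= (expR (- (l * b)))%:E)%E.
Proof.
move=> l0 T00; rewrite -[leRHS]cstP; apply: ae_ge0_le_integral => //.
- by move=> w _; rewrite lee_fin expR_ge0.
- exact: mY.
- by apply: filterS Y_le => w H _; rewrite lee_fin H.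
Qed.

Let mK l T0 : measurable_fun setT (fun p : T * R =>
  (if (p.2 < T0)%R then killed X b (ph l) x p.1 p.2 else 0)%E).
Proof.
apply: measurable_fun_ifT => //; first exact: measurable_fun_ltr.
exact: (measurable_killed _ _ _ HX).
Qed.

Let J_ge0 l T0 : (0 <= J l T0)%E.
Proof.
apply: integral_ge0 => w _; apply: integral_ge0 => s _; case: ifP => // _.
exact: killed_ge0.
Qed.

Let J_le l T0 : 0 < l -> 0 <= T0 -> (J l T0 <= (expR (- (l * b)) / Ps l)%:E)%E.
Proof.
move=> l0 T00; have P0 := Ps_gt0 _ l0.
have := EY_le l T0 (ltW l0) T00; rewrite EY ?(ltW l0)//.
have := J_ge0 l T0; case: (J l T0) => [j| |]//= j0.
  rewrite -EFinM -EFinD !lee_fin ler_pdivlMr// => H.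
  by rewrite mulrC; have := expR_ge0 (- (l * x)); lra.
by rewrite gt0_muley ?lte_fin// addey.
Qed.

Let a l s := (\int[P]_w killed X b (ph l) x w s)%E.

Let a_ge0 l s : (0 <= a l s)%E.
Proof. by apply: integral_ge0 => w _; exact: killed_ge0. Qed.

Let J_fubini l T0 : (J l T0 = \int[leb]_s (if (s < T0)%R then a l s else 0))%E.
Proof.
have f0 (p : T * R) : (0 <= (if (p.2 < T0)%R then killed X b (ph l) x p.1 p.2 else 0))%E.
  by case: ifP => // _; exact: killed_ge0.
apply: (etrans (@fubini_tonelli _ _ _ _ R P leb _ (mK l T0) f0)).
apply: eq_integral => s _ /=; case: ifP => // _.
by rewrite integral0.
Qed.

Let ruin := [set w | (tau_below X x b w < +oo)%E].

Let ma l : measurable_fun setT (a l).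
Proof.
have := @measurable_fun_fubini_tonelli_G _ _ _ _ R P _ (measurable_killed P X Ps HX b (ph l) x (mph l)).
by apply => p; exact: killed_ge0.
Qed.

Let ma_lt l m : measurable_fun setT (fun s : R => if s < m then a l s else 0%E).
Proof.
apply: measurable_fun_ifT; first exact: measurable_fun_ltr.
  exact: ma.
exact: measurable_cst.
Qed.

Let ruin_step l s : 0 <= l -> 0 <= s ->
  ((expR (- (l * x)))%:E <= (expR (- (l * b)))%:E * P ruin + a l s)%E.
Proof.
move=> l0 s0.
have mr := measurable_ruin P X Ps HX b x.
apply: (@le_trans _ _ (\int[P]_w (Y l s w)%:E)%E).
  by rewrite EY// leeDl// mule_ge0// lee_fin Ps0.
have PE : (P ruin = \int[P]_w (\1_ruin w)%:E)%E by rewrite integral_indic// setIT.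
rewrite PE -ge0_integralZl_EFin ?expR_ge0//; last first.
  exact/measurable_EFinP.
rewrite -ge0_integralD//; last 3 first.
- by apply: measurable_funeM; exact/measurable_EFinP.
- by move=> w _; exact: killed_ge0.
- exact: (measurable_killed2 _ _ _ HX).
apply: ae_ge0_le_integral => //.
- by move=> w _; rewrite lee_fin expR_ge0.
- exact: mY.
- by move=> w _; rewrite adde_ge0 ?mule_ge0 ?lee_fin ?expR_ge0//; exact: killed_ge0.
- apply: emeasurable_funD; first by apply: measurable_funeM; exact/measurable_EFinP.
  exact: (measurable_killed2 _ _ _ HX).
apply: filterS Y_cases => w H _; rewrite H//; case: ifPn => hs.
  have rw : ruin w by rewrite /ruin/= (le_lt_trans hs)// ltry.
  by rewrite indicE mem_set// mule1 leeDl//; exact: killed_ge0.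
have hs' : (s%:E < tau_below X x b w)%E by rewrite ltNge.
rewrite /killed s0 (ltW hs')/= leeDr// mule_ge0// lee_fin// expR_ge0.
Qed.

Let ruin_ge l : 0 < l -> ((expR (- (l * x)))%:E <= (expR (- (l * b)))%:E * P ruin)%E.
Proof.
move=> l0; rewrite leNgt; apply/negP.
have H := fun s => ruin_step l s (ltW l0); move: H.
rewrite -(fineK (fin_num_measure P ruin (measurable_ruin P X Ps HX b x))).
set p := fine (P ruin) => H.
rewrite -EFinM lte_fin => lt.
pose dl := expR (- (l * x)) - expR (- (l * b)) * p.
have dl0 : 0 < dl by rewrite subr_gt0.
have P0 := Ps_gt0 _ l0.
have a_dl s : 0 <= s -> (dl%:E <= a l s)%E.
  by move=> s0; have := H s s0; rewrite -EFinM -leeBlDl.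
pose m : R := (expR (- (l * b)) / Ps l + 1) / dl.
have m0 : 0 <= m by rewrite divr_ge0 ?(ltW dl0)// addr_ge0// divr_ge0 ?expR_ge0// ltW.
have : ((dl * m)%:E <= J l m)%E.
  pose D : set R := `[0, m[%classic.
  have mD : measurable D by exact: measurable_itv.
  have -> : ((dl * m)%:E = \int[leb]_(s in D) dl%:E)%E.
    rewrite integral_cst// [X in (_ * X)%E]lebesgue_measure_itv/= lte_fin.
    case: ltP => m1; first by rewrite oppr0 adde0 EFinM.
    have -> : m = 0 by apply/eqP; rewrite eq_le m0 m1.
    by rewrite mulr0 mule0.
  rewrite J_fubini [leLHS]integral_mkcond.
  apply: ge0_le_integral => //.
  - by move=> s _; rewrite patchE; case: ifP => // _; rewrite lee_fin ltW.
  - by apply/(measurable_restrictT _ mD); exact: measurable_cst.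
  - exact: ma_lt.
  - move=> s _; rewrite patchE; case: ifPn => [|_]; last by case: ifP.
    by rewrite inE/D/= in_itv/= => /andP[s0 ->]; exact: a_dl.
move=> /le_trans/(_ (J_le l m l0 m0)); rewrite lee_fin /m mulrC divfK ?gt_eqF//; lra.
Qed.

Lemma ruin_as : P ruin = 1%E.
Proof.
have H := ruin_ge; have := probability_le1 P (measurable_ruin P X Ps HX b x); move: H; rewrite -/ruin.
rewrite -(fineK (fin_num_measure P ruin (measurable_ruin P X Ps HX b x))).
set p := fine (P ruin) => H; rewrite lee_fin => p1; congr EFin.
apply/eqP; rewrite eq_le p1/= leNgt; apply/negP => plt.
pose D := x - b + 1; have D0 : 0 < D by rewrite ltr_wpDl// subr_ge0.
pose l := (1 - p) / D.
have l0 : 0 < l by rewrite divr_gt0// subr_gt0.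
have := H _ l0; rewrite -EFinM lee_fin -ler_pdivrMl ?expR_gt0// -expRN opprK -expRD.
have := expR_gt1Dx (x := l * b + - (l * x)).
have lD : l * D = 1 - p by rewrite /l divfK// gt_eqF.
have : l * (x - b) = 1 - p - l by rewrite -lD /D; ring.
move=> e; have -> : l * b + - (l * x) = - (1 - p - l) by rewrite -e; ring.
have := expR_ge1Dx (- (1 - p - l)); lra.
Qed.

Lemma ruin_ae : {ae P, forall w, (tau_below X x b w < +oo)%E}.
Proof.
have mr := measurable_ruin P X Ps HX b x.
exists (~` ruin); split => //; first exact: measurableC.
by rewrite probability_setC// ruin_as subee.
Qed.

Lemma resolvent l : 0 < l ->
  (\int[P]_w \int[leb]_s killed X b (fun y => (expR (- (l * y)))%:E) x w s =
   ((expR (- (l * b)) - expR (- (l * x))) / Ps l)%:E)%E.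
Proof.
move=> l0; have P0 := Ps_gt0 _ l0.
have cJ : J l m%:R @[m --> \oo] --> (\int[P]_w \int[leb]_s killed X b (ph l) x w s)%E.
  rewrite (killed_fubini P X Ps HX b (ph l) x (mph l) (ph0 l)).
  rewrite (_ : (fun m => J l m%:R) = fun m : nat => (\int[leb]_s (if (s < m%:R)%R then a l s else 0))%E); last first.
    by apply/funext => m; exact: J_fubini.
  pose g (m : nat) (s : R) := if s < m%:R then a l s else 0%E.
  have -> : (\int[leb]_s a l s = \int[leb]_s limn (g^~ s))%E.
    apply: eq_integral => s _; apply/esym/cvg_lim => //; apply: cvg_near_cst.
    exists (Num.truncn s).+1 => // m /= sm; rewrite /g.
    rewrite (lt_le_trans (truncnS_gt _))// ler_nat//.
  apply: cvg_monotone_convergence => //.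
  - by move=> m; exact: ma_lt.
  - by move=> m s _; rewrite /g; case: ifP.
  - move=> s _ m n mn; rewrite /g; case: ifPn => sm; last by case: ifP.
    by rewrite (lt_le_trans sm)// ler_nat.
have cY : (\int[P]_w (Y l m%:R w)%:E)%E @[m --> \oo] --> (expR (- (l * b)))%:E.
  rewrite -[X in _ --> X]cstP.
  have [||||| _ _ H] := @dominated_convergence _ _ _ P setT measurableT
    (fun m w => (Y l m%:R w)%:E) (fun=> (expR (- (l * b)))%:E) (fun=> (expR (- (l * b)))%:E) => //.
  - by move=> m; exact: mY.
  - apply: filterS2 Y_cases ruin_ae => w H hw _; apply: cvg_near_cst.
    have tf : tau_below X x b w \is a fin_num.
      by rewrite ge0_fin_numE//; exact: hitting_ge0.
    exists (Num.truncn (fine (tau_below X x b w))).+1 => // m /= rm; rewrite (H _ _ (ltW l0) (ler0n _ _)).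
    by rewrite ifT// -(fineK tf) lee_fin (le_trans (ltW (truncnS_gt _)))// ler_nat.
  - exact: (@finite_measure_integrable_cst _ _ _ P setT _ measurableT).
  - apply: filterS Y_le => w H m _.
    by rewrite gee0_abs ?lee_fin ?expR_ge0// H// ltW.
have Jv m : (J l m%:R = ((fine (\int[P]_w (Y l m%:R w)%:E) - expR (- (l * x))) / Ps l)%:E)%E.
  rewrite (EY l m%:R (ltW l0) (ler0n _ _)).
  have := J_le l m%:R l0 (ler0n _ _); have := J_ge0 l m%:R.
  case: (J l m%:R) => [j| |]// _ _.
  by rewrite -EFinM -EFinD/=; congr EFin; field; rewrite gt_eqF.
have cv : ((fine (\int[P]_w (Y l m%:R w)%:E)%E - expR (- (l * x))) / Ps l)%:E @[m --> \oo]
    --> ((expR (- (l * b)) - expR (- (l * x))) / Ps l)%:E.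
  apply: cvg_EFin; first exact: nearW.
  apply: cvgM; last exact: cvg_cst.
  by apply: cvgB; [exact: fine_cvg cY|exact: cvg_cst].
apply: (@cvg_unique _ (@ereal_hausdorff R) _ _ _ _ cJ).
by rewrite (_ : (fun m => J l m%:R) = fun m : nat =>
  ((fine (\int[P]_w (Y l m%:R w)%:E)%E - expR (- (l * x))) / Ps l)%:E)//; apply/funext => m; exact: Jv.
Qed.

End resolvent.

Section occupation_density.
Context {R : realType} {d : measure_display} {T : measurableType d}.
Variables (P : probability T R) (X : R -> T -> R) (Ps W : R -> R).
Hypothesis HX : levy_process P X Ps.
Hypothesis Ps0 : forall l, 0 <= l -> 0 <= Ps l.
Hypothesis HW : scale_function Ps W.
Local Notation leb := (@lebesgue_measure R).
Variables (x b : R).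
Hypotheses (b0 : 0 <= b) (bx : b <= x).
Hypothesis no_over : {ae P, forall w, forall t, tau_below X x b w = t%:E -> x + X t w = b}.

Lemma eq_killed : {ae P, forall w, forall s (f g : R -> \bar R),
  (forall y, b <= y -> f y = g y) -> killed X b f x w s = killed X b g x w s}.
Proof.
apply: filterS no_over => w H s f g fg; rewrite /killed.
case: ifPn => // /andP[s0]; rewrite le_eqVlt => /predU1P[st|st]; apply: fg.
  by rewrite H.
rewrite leNgt; apply/negP => zs.
by have := le_lt_trans (hitting_le (fun t => x + X t w) b s s0 zs) st; rewrite ltxx.
Qed.

Lemma measurable_integral_killed f : measurable_fun setT f -> (forall y, 0 <= f y)%E ->
  measurable_fun setT (fun w => \int[leb]_s killed X b f x w s)%E.
Proof.
move=> mf f0.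
have := @measurable_fun_fubini_tonelli_F _ _ _ _ R leb _ (measurable_killed P X Ps HX b f x mf).
by apply => p; exact: killed_ge0.
Qed.

Lemma eq_integral_killed f g : measurable_fun setT f -> (forall y, 0 <= f y)%E ->
  measurable_fun setT g -> (forall y, 0 <= g y)%E -> (forall y, b <= y -> f y = g y) ->
  (\int[P]_w \int[leb]_s killed X b f x w s = \int[P]_w \int[leb]_s killed X b g x w s)%E.
Proof.
move=> mf f0 mg g0 fg; apply: ge0_ae_eq_integral => //.
- exact: measurable_integral_killed.
- exact: measurable_integral_killed.
- by move=> w _; apply: integral_ge0 => s _; exact: killed_ge0.
- by move=> w _; apply: integral_ge0 => s _; exact: killed_ge0.
- apply: filterS eq_killed => w H _; apply: eq_integral => s _; exact: H.
Qed.

Let e1 (y : R) : \bar R := (expR (- y))%:E.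
Let me1 : measurable_fun setT e1.
Proof. by apply/measurable_EFinP; apply: measurableT_comp => //; exact: measurable_funN. Qed.

Let pos (p : T * R) : R := x + regularize (levy_path X p.1) p.2.
Let mpos : measurable_fun setT pos.
Proof.
apply: measurable_funD; first exact: measurable_cst.
have m : measurable_fun setT (fun p : T * R => (levy_path X p.1, p.2) : (@path_space R R) * R).
  apply: measurable_fun_pair => //.
  exact: (measurableT_comp (measurable_levy_path _ _ _ HX)).
exact: (measurableT_comp measurable_regularize m).
Qed.

Let weight (p : T * R) : R := fine (killed X b e1 x p.1 p.2).
Let mweight : measurable_fun setT weight.
Proof. by apply: measurableT_comp => //; exact: (measurable_killed _ _ _ HX). Qed.

Let weight_ge0 p : 0 <= weight p.
Proof. by apply: fine_ge0; apply: killed_ge0 => y; rewrite lee_fin expR_ge0. Qed.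

Local Notation mu := (density _ _ _ (P \x leb)%E weight mweight weight_ge0).

Let m1 : {measure set R -> \bar R} :=
  measure_function_pushforward__canonical__measure_function_Measure mu mpos.

Let int_m1 h : measurable_fun setT h -> (forall y, 0 <= h y)%E ->
  (\int[m1]_y h y = \int[P]_w \int[leb]_s killed X b (fun y => h y * e1 y) x w s)%E.
Proof.
move=> mh h0.
have mhp : measurable_fun setT (h \o pos) by exact: measurableT_comp.
transitivity (\int[mu]_p (h \o pos) p)%E.
  exact: (@ge0_integral_pushforward _ _ (T * measurableTypeR R)%type _ R pos mpos
    mu setT h measurableT mh (fun y _ => h0 y)).
rewrite ge0_integral_density//; last by move=> p /=.
rewrite fubini_tonelli1//; last 2 first.
- by apply: emeasurable_funM => //; exact/measurable_EFinP.
- by move=> p; rewrite mule_ge0//= lee_fin.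
apply: eq_integral => w _; apply: eq_integral => s _ /=.
rewrite /weight /pos /killed/=; case: ifP => [/andP[s0 _]|_]; last by rewrite mule0.
by rewrite (regularize_levy _ _ _ HX).
Qed.

Let G (y : R) : R := expR (- y) * (W (y - b) - W (y - x)).

Lemma scale_increment_ge0 y : 0 <= W (y - b) - W (y - x).
Proof. by rewrite subr_ge0 (scale_nondecreasing _ _ HW)// lerB. Qed.

Let G0 y : 0 <= G y.
Proof. by rewrite mulr_ge0 ?expR_ge0 ?scale_increment_ge0. Qed.

Let mshift c : measurable_fun setT (fun y : R => W (y - c)).
Proof.
apply: (measurableT_comp (measurable_scale _ _ HW Ps0)).
by apply: measurable_funB => //; exact: measurable_cst.
Qed.

Lemma measurable_scale_increment : measurable_fun setT (fun y : R => W (y - b) - W (y - x)).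
Proof. exact: measurable_funB. Qed.

Let mG : measurable_fun setT G.
Proof.
apply: measurable_funM; last exact: measurable_scale_increment.
by apply/measurable_EFinP; exact: me1.
Qed.

Let m2' : {measure set (measurableTypeR R) -> \bar R} := density _ _ _ leb G mG G0.
Let mid : measurable_fun setT (fun y : measurableTypeR R => y : R).
Proof. exact: measurable_id. Qed.
Let m2 : {measure set R -> \bar R} :=
  measure_function_pushforward__canonical__measure_function_Measure m2' mid.

Let D : set R := `[0%R, +oo[%classic.
Let mD : measurable D. Proof. exact: measurable_itv. Qed.

Let restr (h : R -> \bar R) (y : R) : \bar R := if 0 <= y then h y else 0%E.
Let mrestr h : measurable_fun setT h -> measurable_fun setT (restr h).
Proof. by move=> mh; apply: measurable_fun_ifT => //; exact: measurable_fun_ler. Qed.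
Let restr_ge0 h y : (forall y, 0 <= h y)%E -> (0 <= restr h y)%E.
Proof. by rewrite /restr => h0; case: ifP. Qed.

Let int_restr (m : {measure set R -> \bar R}) h :
  (\int[m]_(y in D) h y = \int[m]_y restr h y)%E.
Proof.
rewrite integral_mkcond; apply: eq_integral => y _; rewrite patchE /restr.
by rewrite /D mem_setE in_itv/= andbT.
Qed.

Let int_m1D h : measurable_fun setT h -> (forall y, 0 <= h y)%E ->
  (\int[m1]_(y in D) h y = \int[P]_w \int[leb]_s killed X b (fun y => h y * e1 y) x w s)%E.
Proof.
move=> mh h0; rewrite int_restr (int_m1 _ (mrestr _ mh) (fun y => restr_ge0 _ y h0)).
apply: eq_integral_killed.
- by apply: emeasurable_funM => //; exact: mrestr.
- by move=> y; rewrite mule_ge0 ?restr_ge0// lee_fin expR_ge0.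
- exact: emeasurable_funM.
- by move=> y; rewrite mule_ge0// lee_fin expR_ge0.
- by move=> y yb; rewrite /restr (le_trans b0 yb).
Qed.

Let W_lt0 y : y < 0 -> W y = 0.
Proof. by case: HW => + _; apply. Qed.

Let int_m2D h : measurable_fun setT h -> (forall y, 0 <= h y)%E ->
  (\int[m2]_(y in D) h y = \int[leb]_y (h y * (expR (- y) * (W (y - b) - W (y - x)))%:E))%E.
Proof.
move=> mh h0; rewrite int_restr.
apply: (etrans (@ge0_integral_pushforward _ _ _ _ R _ mid m2' setT (restr h) measurableT
  (mrestr _ mh) (fun y _ => restr_ge0 _ y h0))).
apply: (etrans (ge0_integral_density _ _ _ leb G mG G0 _ (mrestr _ mh) (fun y => restr_ge0 _ y h0))).
apply: eq_integral => y _; rewrite /restr; case: leP => // y0.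
have yb : y - b < 0 by rewrite subr_lt0 (lt_le_trans y0).
have yx : y - x < 0 by rewrite subr_lt0 (lt_le_trans y0)// (le_trans b0).
by rewrite mul0e (W_lt0 _ yb) (W_lt0 _ yx) subrr mulr0 mule0.
Qed.

Let mexp l : measurable_fun setT (fun y : R => (expR (- (l * y)))%:E).
Proof.
apply/measurable_EFinP; apply: measurableT_comp => //; apply: measurable_funN.
exact: measurable_funM.
Qed.

Let mom1 (k : nat) : (\int[m1]_(y in D) (expR (- (k%:R * y)))%:E =
  ((expR (- (k.+1%:R * b)) - expR (- (k.+1%:R * x))) / Ps k.+1%:R)%:E)%E.
Proof.
rewrite int_m1D//.
have k0 : 0 < k.+1%:R :> R by [].
rewrite -(resolvent P X Ps HX Ps0 (exponent_gt0 _ _ HW Ps0) x b bx no_over k.+1%:R k0).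
apply: eq_integral => w _; apply: eq_integral => s _; rewrite /killed; case: ifP => // _.
by rewrite /e1 -EFinM -expRD -natr1; congr (expR _)%:E; ring.
Qed.

Let mom2 (k : nat) : (\int[m2]_(y in D) (expR (- (k%:R * y)))%:E =
  ((expR (- (k.+1%:R * b)) - expR (- (k.+1%:R * x))) / Ps k.+1%:R)%:E)%E.
Proof.
rewrite int_m2D//.
have k0 : 0 < k.+1%:R :> R by [].
pose A c (y : R) := expR (- (k.+1%:R * y)) * W (y - c).
have mA c : measurable_fun setT (A c).
  by apply: measurable_funM => //; apply/measurable_EFinP; exact: mexp.
have A0 c y : 0 <= A c y by rewrite mulr_ge0 ?expR_ge0 ?(scale_ge0 _ _ HW Ps0).
have Ax y : A x y <= A b y.
  by rewrite ler_wpM2l ?expR_ge0// -subr_ge0 scale_increment_ge0.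
have IA c : (\int[leb]_y (A c y)%:E = (expR (- (k.+1%:R * c)) / Ps k.+1%:R)%:E)%E.
  exact: (scale_laplaceT _ _ HW Ps0).
have : (\int[leb]_y (A b y - A x y)%:E + \int[leb]_y (A x y)%:E = \int[leb]_y (A b y)%:E)%E.
  rewrite -ge0_integralD//.
  - by apply: eq_integral => y _; rewrite -EFinD subrK.
  - by move=> y _; rewrite lee_fin subr_ge0.
  - by apply/measurable_EFinP; exact: (measurable_funB (mA b) (mA x)).
  - by move=> y _; rewrite lee_fin.
  - by apply/measurable_EFinP; exact: mA.
rewrite !IA.
rewrite (_ : (\int[leb]_y (A b y - A x y)%:E)%E = (\int[leb]_y ((expR (- (k%:R * y)))%:E *
  (expR (- y) * (W (y - b) - W (y - x)))%:E))%E); last first.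
  apply: eq_integral => y _; rewrite -EFinM mulrA -expRD /A -mulrBr; congr (expR _ * _)%:E.
  by rewrite -natr1; ring.
set I := (\int[leb]_y _)%E; have : (0 <= I)%E.
  apply: integral_ge0 => y _; rewrite -EFinM lee_fin mulr_ge0 ?expR_ge0//.
  exact: G0.
case: I => [r| |]// _ [] H; congr EFin; rewrite mulrBl -H; ring.
Qed.

Lemma occupation_density f : measurable_fun setT f -> (forall y, 0 <= f y)%E ->
  (\int[P]_w \int[leb]_s killed X b f x w s =
   \int[leb]_y (f y * (W (y - b) - W (y - x))%:E))%E.
Proof.
move=> mf f0.
have mass (m : {measure set R -> \bar R}) : (m D = \int[m]_(y in D) (expR (- (0%:R * y)))%:E)%E.
  under eq_integral do rewrite mul0r oppr0 expR0.
  by rewrite integral_cst// mul1e.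
have m1D : (m1 D < +oo)%E by rewrite mass mom1 ltry.
have m2D : (m2 D < +oo)%E by rewrite mass mom2 ltry.
have m12 k : (\int[m1]_(y in D) (expR (- (k%:R * y)))%:E = \int[m2]_(y in D) (expR (- (k%:R * y)))%:E)%E.
  by rewrite mom1 mom2.
have U := laplace_unique m1 m2 m1D m2D m12.
pose fe y := (f y * (expR y)%:E)%E.
have mfe : measurable_fun setT fe by apply: emeasurable_funM => //; exact/measurable_EFinP.
have fe0 y : (0 <= fe y)%E by rewrite mule_ge0// lee_fin expR_ge0.
transitivity (\int[m1]_(y in D) fe y)%E.
  rewrite (int_m1D _ mfe fe0); apply: eq_integral => w _; apply: eq_integral => s _.
  rewrite /killed; case: ifP => // _.
  by rewrite /fe /e1 -muleA -EFinM -expRD subrr expR0 mule1.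
rewrite (@eq_measure_integral _ _ R D m2 m1); last first.
  by move=> A mA AD; have := U A mA; rewrite setIidr.
rewrite (int_m2D _ mfe fe0); apply: eq_integral => y _.
by rewrite /fe -muleA -EFinM mulrA -expRD subrr expR0 mul1r.
Qed.

End occupation_density.

(** * Feynman-Kac equation *)

Section expeR_measurability.
Context {R : realType}.

Lemma measurable_expeR : measurable_fun setT (@expeR R).
Proof.
have mpt (c : \bar R) : measurable_fun setT (fun y : \bar R => y == c).
  apply: (measurable_fun_bool true); rewrite setTI.
  rewrite (_ : _ @^-1` _ = [set c]); first exact: emeasurable_set1.
  by apply/seteqP; split => y /= /eqP.
rewrite (_ : @expeR R = fun y => if y == +oo%E then +oo%E else if y == -oo%E then 0%E
  else (expR (fine y))%:E); last by apply/funext => -[].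
apply: measurable_fun_ifT => //; apply: measurable_fun_ifT => //.
by apply/measurable_EFinP; apply: measurableT_comp => //; exact: fine_measurable.
Qed.

Lemma expeRN_le1 (y : \bar R) : (0 <= y)%E -> (expeR (- y) <= 1)%E.
Proof. by move=> y0; rewrite -expeR0 lee_expeR oppe_le0. Qed.

End expeR_measurability.

Section exponential_tail_density.
Context {R : realType}.
Local Notation leb := (@lebesgue_measure R).
Variables (k : R -> R).
Hypotheses (mk : measurable_fun setT k) (k0 : forall s, 0 <= k s).
Hypothesis ik : (\int[leb]_s (k s)%:E < +oo)%E.

Let nu' : {measure set (measurableTypeR R) -> \bar R} := density _ _ _ leb k mk k0.
Let mid : measurable_fun setT (fun y : measurableTypeR R => y : R).
Proof. exact: measurable_id. Qed.
Let nu : {measure set R -> \bar R} :=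
  measure_function_pushforward__canonical__measure_function_Measure nu' mid.

Let nu_fin : fin_num_fun nu.
Proof.
move=> A mA; rewrite ge0_fin_numE//; apply: le_lt_trans ik.
by rewrite -[leRHS]/(nu setT); apply: le_measure; rewrite ?inE.
Qed.

Let nuf : {finite_measure set R -> \bar R} :=
  HB.pack (Measure.sort nu) (Measure_isFinite.Build _ _ _ (Measure.sort nu) nu_fin).

Let nu_point c : nu [set c] = 0%E.
Proof.
apply/eqP; rewrite eq_le measure_ge0 andbT -[leLHS]/(\int[leb]_(u in [set c]) (k u)%:E)%E.
by rewrite integral_set1.
Qed.

Let nu_tail s : nuf (`[s, +oo[%classic : set R) = (\int[leb]_u (if (s <= u)%R then (k u)%:E else 0))%E.
Proof.
rewrite -[LHS]/(\int[leb]_(u in (`[s, +oo[%classic : set R)) (k u)%:E)%E.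
rewrite integral_mkcond; apply: eq_integral => u _; rewrite patchE.
by rewrite mem_setE in_itv/= andbT.
Qed.

Let mtail : measurable_fun setT (fun p : R * R => if p.1 <= p.2 then (k p.2)%:E else 0%E).
Proof.
apply: measurable_fun_ifT => //; first exact: measurable_fun_ler.
by apply/measurable_EFinP; exact: measurableT_comp.
Qed.

Let tail_ge0 (p : R * R) : (0 <= if (p.1 <= p.2)%R then (k p.2)%:E else 0)%E.
Proof. by case: ifP => // _; rewrite lee_fin. Qed.

Let mint : measurable_fun setT (fun s : R => \int[leb]_u (if (s <= u)%R then (k u)%:E else 0))%E.
Proof. exact: (@measurable_fun_fubini_tonelli_F _ _ _ _ R leb _ mtail tail_ge0). Qed.

Let expeRNE (y : \bar R) : y \is a fin_num -> expeR (- y) = (expR (- fine y))%:E.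
Proof. by case: y. Qed.

Lemma integral_expR_tail_density :
  (\int[leb]_s ((k s)%:E * expeR (- \int[leb]_u (if (s <= u)%R then (k u)%:E else 0))) =
   1 - expeR (- \int[leb]_s (k s)%:E))%E.
Proof.
have H := integral_expR_tail_measure nuf nu_point.
have nuT : nuf setT = (\int[leb]_s (k s)%:E)%E by [].
have Tfin : (\int[leb]_s (k s)%:E)%E \is a fin_num by rewrite -nuT fin_num_measure.
rewrite (expeRNE _ Tfin) -EFinB -nuT -H.
pose f (s : R) := expeR (- \int[leb]_u (if (s <= u)%R then (k u)%:E else 0))%E.
have mf : measurable_fun setT f.
  by apply: (measurableT_comp measurable_expeR); exact: measurableT_comp.
have f0 s : (0 <= f s)%E by exact: expeR_ge0.
transitivity (\int[nuf]_s f s)%E; last first.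
  apply: eq_integral => s _; rewrite /f -nu_tail expeRNE//.
  by apply: fin_num_measure; exact: measurable_itv.
apply/esym; apply: (etrans (@ge0_integral_pushforward _ _ _ _ R _ mid nu' setT f measurableT
  mf (fun y _ => f0 y))).
apply: (etrans (ge0_integral_density _ _ _ leb k mk k0 _ mf f0)).
by apply: eq_integral => s _; rewrite muleC.
Qed.

End exponential_tail_density.

Section feynman_kac.
Context {R : realType} {d : measure_display} {T : measurableType d}.
Variables (P : probability T R) (X : R -> T -> R) (Ps W : R -> R).
Hypothesis HX : levy_process P X Ps.
Hypothesis Ps0 : forall l, 0 <= l -> 0 <= Ps l.
Hypothesis HW : scale_function Ps W.
Local Notation leb := (@lebesgue_measure R).
Local Notation path := (@path_space R R).
Variables (b : R) (om : R -> R).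
Hypotheses (b0 : 0 <= b) (mom : measurable_fun setT om) (om0 : forall y, 0 <= om y).

Let F (y : R) : \bar R := (om y)%:E.

Let F0 y : (0 <= F y)%E. Proof. by rewrite lee_fin. Qed.
Let mF : measurable_fun setT F. Proof. exact/measurable_EFinP. Qed.

Definition clock (x : R) (w : T) : \bar R := (\int[leb]_s killed X b F x w s)%E.

Lemma clock_ge0 x w : (0 <= clock x w)%E.
Proof. by apply: integral_ge0 => s _; exact: killed_ge0. Qed.

Lemma clockE x w : clock x w = occupation b F x (levy_path X w).
Proof. by rewrite (occupation_killed _ _ _ HX). Qed.

Definition laplace_clock (x : R) : \bar R := (\int[P]_w expeR (- clock x w))%E.

Let mexp_occ : measurable_fun setT (fun p : R * path => expeR (- occupation b F p.1 p.2)).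
Proof.
apply: (measurableT_comp measurable_expeR); apply: measurableT_comp => //.
exact: measurable_occupation.
Qed.

Lemma measurable_exp_clock x : measurable_fun setT (fun w => expeR (- clock x w)).
Proof.
rewrite (_ : (fun w => _) = fun w => expeR (- occupation b F x (levy_path X w))); last first.
  by apply/funext => w; rewrite clockE.
have m : measurable_fun setT (fun w : T => (x, levy_path X w) : R * path).
  by apply: measurable_fun_pair => //; exact: (measurable_levy_path _ _ _ HX).
exact: (measurableT_comp mexp_occ m).
Qed.

Lemma laplace_clock_ge0 x : (0 <= laplace_clock x)%E.
Proof. by apply: integral_ge0 => w _; exact: expeR_ge0. Qed.

Lemma laplace_clock_le1 x : (laplace_clock x <= 1)%E.
Proof.
have E1 : (\int[P]_w 1%:E = 1 :> \bar R)%E.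
  by rewrite integral_cst// [X in (_ * X)%E]probability_setT mule1.
rewrite -E1; apply: ge0_le_integral => //.
- by move=> w _; exact: expeR_ge0.
- exact: measurable_exp_clock.
- by move=> w _; apply: expeRN_le1; exact: clock_ge0.
Qed.

Lemma measurable_laplace_clock : measurable_fun setT laplace_clock.
Proof.
have m : measurable_fun setT (fun p : R * T => (p.1, levy_path X p.2) : R * path).
  apply: measurable_fun_pair => //.
  exact: (measurableT_comp (measurable_levy_path _ _ _ HX)).
have := @measurable_fun_fubini_tonelli_F _ _ _ _ R P _ (measurableT_comp mexp_occ m) (fun p => expeR_ge0 _).
apply: eq_measurable_fun => x _; apply: eq_integral => w _ /=.
by rewrite -clockE.
Qed.

Variable x : R.

Let future_rc s w t : 0 <= s -> 0 <= t ->
  future X s w u @[u --> t^'+] --> future X s w t.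
Proof.
move=> s0 t0; apply: cvgB; last exact: cvg_cst.
rewrite max_l//; apply/cvgrPdist_lt => ep ep0.
have [h h0 H] := rc_dist _ (levy_rc _ _ _ HX w) (s + t) ep (addr_ge0 s0 t0) ep0.
near=> u; rewrite distrC; apply: H.
  by rewrite lerD2l le_max; apply/orP; left; near: u; exact: nbhs_right_ge.
rewrite max_l; last by apply: (le_trans t0); near: u; exact: nbhs_right_ge.
by rewrite -addrA ltrD2l; near: u; apply: nbhs_right_lt; rewrite ltrDl.
Unshelve. all: by end_near. Qed.

Let shifted_rc s w : 0 <= s -> forall t, 0 <= t ->
  (x + X s w) + future X s w u @[u --> t^'+] --> (x + X s w) + future X s w t.
Proof. by move=> s0 t t0; apply: cvgD; [exact: cvg_cst|exact: future_rc]. Qed.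

Let futureE s w v : 0 <= v -> (x + X s w) + future X s w v = x + X (s + v) w.
Proof. by move=> v0; rewrite /future max_l//; ring. Qed.

Lemma killed_shift s w v : 0 <= s -> (s%:E <= tau_below X x b w)%E -> 0 <= v ->
  killed X b F x w (v + s) = if alive (fun t => (x + X s w) + future X s w t) b v
    then F ((x + X s w) + regularize (future X s w) v) else 0%E.
Proof.
move=> s0 sa v0; rewrite /killed addr_ge0//=.
have -> : ((v + s)%:E <= tau_below X x b w)%E = alive (fun t => (x + X s w) + future X s w t) b v.
  apply/idP/idP.
    move=> /hitting_geP H; apply/(aliveP _ b (shifted_rc s w s0))/hitting_geP => u u0 uv.
    rewrite futureE// H ?addr_ge0//; lra.
  move=> /(aliveP _ b (shifted_rc s w s0))/hitting_geP H.
  apply/hitting_geP => u u0 uv; have [us|su] := ltP u s; first by move/hitting_geP : sa; exact.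
  have := H (u - s); rewrite futureE ?subr_ge0// (addrC s) subrK; apply => //; lra.
case: ifP => // _; rewrite regularizeE//; last by move=> t; exact: future_rc.
by rewrite futureE// (addrC v).
Qed.

Let mkilled w : measurable_fun setT (killed X b F x w).
Proof. exact: (measurable_killed1 P X Ps HX). Qed.

Let mkilled_ge w s : measurable_fun setT (fun u : R => if s <= u then killed X b F x w u else 0%E).
Proof. by apply: measurable_fun_ifT => //; exact: measurable_fun_ler. Qed.

Let tail (w : T) (s : R) : \bar R :=
  (\int[leb]_u (if (s <= u)%R then killed X b F x w u else 0))%E.

Let tail_future w s : 0 <= s -> (s%:E <= tau_below X x b w)%E ->
  tail w s = occupation b F (x + X s w) (future X s w).
Proof.
move=> s0 sa; rewrite /tail -(ge0_integral_shift s _ (mkilled_ge w s)); last first.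
  by move=> u; case: ifP => // _; exact: killed_ge0.
apply: eq_integral => v _; rewrite lerDr.
by have [v0|//] := boolP (0 <= v); rewrite killed_shift.
Qed.

Let mtail : measurable_fun setT (fun p : T * R => killed X b F x p.1 p.2 * expeR (- tail p.1 p.2))%E.
Proof.
have mk := measurable_killed P X Ps HX b F x mF.
apply: emeasurable_funM => //; apply: (measurableT_comp measurable_expeR).
apply: measurableT_comp => //.
have mq : measurable_fun setT (fun q : (T * R) * R =>
    if q.1.2 <= q.2 then killed X b F x q.1.1 q.2 else 0%E).
  apply: measurable_fun_ifT => //.
    by apply: measurable_fun_ler => //; exact: measurableT_comp.
  have m : measurable_fun setT (fun q : (T * R) * R => (q.1.1, q.2)).
    by apply: measurable_fun_pair => //; exact: measurableT_comp.
  exact: (measurableT_comp mk m).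
have q0 (q : (T * R) * R) : (0 <= if (q.1.2 <= q.2)%R then killed X b F x q.1.1 q.2 else 0)%E.
  by case: ifP => // _; exact: killed_ge0.
exact: (@measurable_fun_fubini_tonelli_F _ _ _ _ R leb _ mq q0).
Qed.

Let clock_tail w : (clock x w < +oo)%E ->
  (\int[leb]_s (killed X b F x w s * expeR (- tail w s)) = 1 - expeR (- clock x w))%E.
Proof.
move=> wfin; pose k s := fine (killed X b F x w s).
have kE s : (k s)%:E = killed X b F x w s by rewrite /k /killed; case: ifP.
have mk : measurable_fun setT k by apply: measurableT_comp => //; exact: fine_measurable.
have k0 s : 0 <= k s by apply: fine_ge0; exact: killed_ge0.
have kc : (\int[leb]_s (k s)%:E)%E = clock x w by apply: eq_integral => s _; rewrite kE.
have := integral_expR_tail_density k mk k0; rewrite kc => /(_ wfin) <-.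
apply: eq_integral => s _; rewrite kE; congr (_ * expeR (- _))%E.
by apply: eq_integral => u _; rewrite kE.
Qed.

Let g (s : R) (p : path * path) : \bar R :=
  if alive (fun t => x + p.1 t) b s
  then (F (x + p.1 s)%R * expeR (- occupation b F (x + p.1 s) p.2))%E else 0%E.

Let mg s : measurable_fun setT (g s).
Proof.
have me : measurable_fun setT (fun p : path * path => x + p.1 s).
  apply: measurable_funD => //.
  by apply: (measurableT_comp (measurable_eval R (s : R))).
apply: measurable_fun_ifT => //.
  have m : measurable_fun setT (fun p : path * path => ((x, p.1), s) : (R * path) * R).
    by apply: measurable_fun_pair => //; apply: measurable_fun_pair.
  exact: (measurableT_comp (measurable_alive b) m).
apply: emeasurable_funM; first exact: measurableT_comp.
have m : measurable_fun setT (fun p : path * path => (x + p.1 s, p.2) : R * path).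
  exact: measurable_fun_pair.
exact: (measurableT_comp mexp_occ m).
Qed.

Let g0 s p : (0 <= g s p)%E.
Proof. by rewrite /g; case: ifP => // _; rewrite mule_ge0// expeR_ge0. Qed.

Let alive_past s w : 0 <= s ->
  alive (fun t => x + past X s w t) b s = (s%:E <= tau_below X x b w)%E.
Proof.
move=> s0; rewrite -(aliveE _ b (levy_rc_shift _ _ _ HX x w)).
apply: asbool_equiv_eq; split => H q q0 qs; have := H q q0 qs;
  by rewrite /past max_l// min_l// ltW.
Qed.

Let pastE s w : 0 <= s -> past X s w s = X s w.
Proof. by move=> s0; rewrite /past max_l// min_l. Qed.

Let g_path s w : 0 <= s ->
  g s (past X s w, future X s w) = (killed X b F x w s * expeR (- tail w s))%E.
Proof.
move=> s0; rewrite /g/= alive_past// pastE// /killed s0/=.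
by case: ifPn => [sa|_]; [rewrite tail_future|rewrite mul0e].
Qed.

Let g_mean s w : 0 <= s ->
  (\int[P]_w' g s (past X s w, levy_path X w') =
   killed X b (fun y => F y * laplace_clock y)%E x w s)%E.
Proof.
move=> s0; rewrite /g /killed s0/=.
under eq_integral do rewrite alive_past// pastE//.
case: ifP => _; last by rewrite integral0.
have m : measurable_fun setT (fun w' : T => (x + X s w, levy_path X w') : R * path).
  by apply: measurable_fun_pair => //; exact: (measurable_levy_path _ _ _ HX).
apply: (etrans (@ge0_integralZl_EFin _ _ R P setT measurableT
  (fun w' => expeR (- occupation b F (x + X s w) (levy_path X w')))
  (fun w' _ => expeR_ge0 _) (measurableT_comp mexp_occ m) _ (om0 _))).
by congr (_ * _)%E; apply: eq_integral => w' _; rewrite clockE.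
Qed.

Hypothesis bx : b <= x.
Hypothesis no_over : {ae P, forall w, forall t, tau_below X x b w = t%:E -> x + X t w = b}.

Lemma integral_clock :
  (\int[P]_w clock x w = \int[leb]_y (F y * (W (y - b) - W (y - x))%:E))%E.
Proof. exact: (occupation_density P X Ps W HX Ps0 HW x b b0 bx no_over). Qed.

Lemma feynman_kac : (\int[P]_w clock x w < +oo)%E ->
  (laplace_clock x +
   \int[leb]_y (F y * laplace_clock y * (W (y - b) - W (y - x))%:E) = 1)%E.
Proof.
move=> Cfin.
have mC : measurable_fun setT (clock x).
  exact: (measurable_integral_killed P X Ps HX).
have clock_fin : {ae P, forall w, (clock x w < +oo)%E}.
  have : P.-integrable setT (clock x).
    apply/integrableP; split => //.
    by under eq_integral do rewrite gee0_abs ?clock_ge0//.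
  move=> /(integrable_ae measurableT); apply: filterS => w /(_ Logic.I).
  by rewrite ge0_fin_numE// clock_ge0.
rewrite -(occupation_density P X Ps W HX Ps0 HW x b b0 bx no_over); last 2 first.
- by apply: emeasurable_funM => //; exact: measurable_laplace_clock.
- by move=> y; rewrite mule_ge0// laplace_clock_ge0.
have m2 : measurable_fun setT (fun y => F y * laplace_clock y)%E.
  by apply: emeasurable_funM => //; exact: measurable_laplace_clock.
rewrite (killed_fubini P X Ps HX)//; last by move=> y; rewrite mule_ge0// laplace_clock_ge0.
have step s : (\int[P]_w killed X b (fun y => F y * laplace_clock y)%E x w s =
    \int[P]_w (killed X b F x w s * expeR (- tail w s)))%E.
  have [s0|s0] := boolP (0 <= s); last first.
    by apply: eq_integral => w _; rewrite /killed (negbTE s0)/= mul0e.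
  transitivity (\int[P]_w g s (past X s w, future X s w))%E.
    rewrite (markov_property P X Ps HX s (g s) s0 (mg s) (g0 s)).
    by apply: eq_integral => w _; rewrite g_mean.
  by apply: eq_integral => w _; rewrite g_path.
under [X in (_ + X)%E]eq_integral do rewrite step.
have t0 (p : T * R) : (0 <= killed X b F x p.1 p.2 * expeR (- tail p.1 p.2))%E.
  by rewrite mule_ge0 ?expeR_ge0//; exact: killed_ge0.
rewrite -(@fubini_tonelli _ _ _ _ R P leb _ mtail t0)/=.
rewrite /laplace_clock -ge0_integralD//; last first.
- exact: (@measurable_fun_fubini_tonelli_F _ _ _ _ R leb _ mtail t0).
- by move=> w _; apply: integral_ge0 => s _; exact: (t0 (w, s)).
- exact: measurable_exp_clock.
- by move=> w _; exact: expeR_ge0.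
transitivity (\int[P]_w 1%:E)%E; last first.
  by rewrite integral_cst// [X in (_ * X)%E]probability_setT mule1.
apply: ge0_ae_eq_integral => //.
- apply: emeasurable_funD; first exact: measurable_exp_clock.
  exact: (@measurable_fun_fubini_tonelli_F _ _ _ _ R leb _ mtail t0).
- move=> w _; rewrite adde_ge0 ?expeR_ge0//.
  by apply: integral_ge0 => s _; exact: (t0 (w, s)).
- apply: filterS clock_fin => w wfin _; rewrite clock_tail//.
  have := clock_ge0 x w; move: wfin; case: (clock x w) => [r| |]//= _ _.
  by rewrite -EFinD; congr EFin; ring.
Qed.

End feynman_kac.

(** * Iteration of the renewal equation *)

Section renewal.
Context {R : realType}.
Local Notation leb := (@lebesgue_measure R).
Variables (W om : R -> R).
Hypotheses (mW : measurable_fun setT W) (W0 : forall y, 0 <= W y)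
  (W_incr : {homo W : y z / y <= z}) (W_neg : forall y, y < 0 -> W y = 0).
Hypotheses (mom : measurable_fun setT om) (om0 : forall y, 0 <= om y).

Definition renewal (phi : R -> \bar R) (x : R) : \bar R :=
  (\int[leb]_z ((W (z - x) * om z)%:E * phi z))%E.

Let kernel_ge0 x z : 0 <= W (z - x) * om z.
Proof. exact: mulr_ge0. Qed.

Let mkernel2 : measurable_fun setT (fun p : R * R => W (p.2 - p.1) * om p.2).
Proof.
apply: measurable_funM; apply: measurableT_comp => //.
exact: measurable_funB.
Qed.

Let mkernel x : measurable_fun setT (fun z : R => W (z - x) * om z).
Proof. exact: (measurableT_comp mkernel2 (measurable_pair1 x)). Qed.

Let integrand_ge0 phi x z : (forall y, 0 <= phi y)%E -> (0 <= (W (z - x) * om z)%:E * phi z)%E.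
Proof. by move=> phi0; rewrite mule_ge0// lee_fin. Qed.

Lemma renewal_ge0 phi x : (forall y, 0 <= phi y)%E -> (0 <= renewal phi x)%E.
Proof. by move=> phi0; apply: integral_ge0 => z _; exact: integrand_ge0. Qed.

Lemma measurable_renewal_integrand phi x : measurable_fun setT phi ->
  measurable_fun setT (fun z : R => ((W (z - x) * om z)%:E * phi z)%E).
Proof. by move=> mphi; apply: emeasurable_funM => //; apply/measurable_EFinP; exact: mkernel. Qed.

Lemma measurable_renewal phi : measurable_fun setT phi -> (forall y, 0 <= phi y)%E ->
  measurable_fun setT (renewal phi).
Proof.
move=> mphi phi0.
have m : measurable_fun setT (fun p : R * R => ((W (p.2 - p.1) * om p.2)%:E * phi p.2)%E).
  apply: emeasurable_funM; first by apply/measurable_EFinP; exact: mkernel2.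
  exact: measurableT_comp.
have f0 (p : R * R) : (0 <= (W (p.2 - p.1) * om p.2)%:E * phi p.2)%E.
  by rewrite mule_ge0// lee_fin.
exact: (@measurable_fun_fubini_tonelli_F _ _ _ _ R leb _ m f0).
Qed.

Lemma le_renewal phi psi x : measurable_fun setT phi -> measurable_fun setT psi ->
  (forall y, 0 <= phi y)%E -> (forall y, phi y <= psi y)%E ->
  (renewal phi x <= renewal psi x)%E.
Proof.
move=> mphi mpsi phi0 le; apply: ge0_le_integral => //.
- by move=> z _; exact: integrand_ge0.
- exact: measurable_renewal_integrand.
- exact: measurable_renewal_integrand.
- by move=> z _; rewrite lee_wpmul2l // lee_fin.
Qed.

Lemma renewal_nonincreasing phi x x' : measurable_fun setT phi -> (forall y, 0 <= phi y)%E ->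
  x <= x' -> (renewal phi x' <= renewal phi x)%E.
Proof.
move=> mphi phi0 xx; apply: ge0_le_integral => //.
- by move=> z _; exact: integrand_ge0.
- exact: measurable_renewal_integrand.
- exact: measurable_renewal_integrand.
- by move=> z _; rewrite lee_wpmul2r// lee_fin ler_wpM2r// W_incr// lerB.
Qed.

Lemma eq_renewal b phi psi x : b <= x -> (forall y, b <= y -> phi y = psi y) ->
  renewal phi x = renewal psi x.
Proof.
move=> bx e; apply: eq_integral => z _.
have [zx|xz] := ltP z x; first by rewrite W_neg ?subr_lt0// mul0r !mul0e.
by rewrite e// (le_trans bx).
Qed.

Lemma renewalD phi psi x : measurable_fun setT phi -> measurable_fun setT psi ->
  (forall y, 0 <= phi y)%E -> (forall y, 0 <= psi y)%E ->
  (renewal (fun y => phi y + psi y) x = renewal phi x + renewal psi x)%E.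
Proof.
move=> mphi mpsi phi0 psi0; rewrite /renewal -ge0_integralD//.
- by apply: eq_integral => z _; rewrite ge0_muleDr.
- by move=> z _; exact: integrand_ge0.
- exact: measurable_renewal_integrand.
- by move=> z _; exact: integrand_ge0.
- exact: measurable_renewal_integrand.
Qed.

Lemma renewalZ c phi x : 0 <= c -> measurable_fun setT phi -> (forall y, 0 <= phi y)%E ->
  (renewal (fun y => c%:E * phi y) x = c%:E * renewal phi x)%E.
Proof.
move=> c0 mphi phi0; rewrite /renewal.
rewrite -(@ge0_integralZl_EFin _ _ R leb setT measurableT _ _ (measurable_renewal_integrand _ x mphi))//; last first.
  by move=> z _; exact: integrand_ge0.
by apply: eq_integral => z _; rewrite muleCA.
Qed.

Definition renewals n : R -> \bar R := iter n renewal (fun=> 1%E).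

Lemma iter_renewal_ge0 n phi : (forall y, 0 <= phi y)%E -> forall y, (0 <= iter n renewal phi y)%E.
Proof. by move=> phi0; elim: n => //= n IH y; exact: renewal_ge0. Qed.

Lemma measurable_iter_renewal n phi : measurable_fun setT phi -> (forall y, 0 <= phi y)%E ->
  measurable_fun setT (iter n renewal phi).
Proof.
move=> mphi phi0; elim: n => //= n IH; apply: measurable_renewal => // y.
exact: iter_renewal_ge0.
Qed.

Lemma renewals_ge0 n y : (0 <= renewals n y)%E.
Proof. exact: iter_renewal_ge0. Qed.

Lemma measurable_renewals n : measurable_fun setT (renewals n).
Proof. exact: measurable_iter_renewal. Qed.

Lemma renewals_nonincreasing n x x' : x <= x' -> (renewals n x' <= renewals n x)%E.
Proof.
case: n => [|n] xx //=; apply: renewal_nonincreasing => //.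
  exact: measurable_renewals.
by move=> y; exact: renewals_ge0.
Qed.

Variables (b : R) (H : R -> \bar R).
Hypotheses (mH : measurable_fun setT H) (H0 : forall y, (0 <= H y)%E)
  (H1 : forall y, (H y <= 1)%E).
Hypothesis Heq : forall x, b <= x ->
  (H x + \int[leb]_y ((om y)%:E * H y * (W (y - b) - W (y - x))%:E) = 1)%E.
Hypothesis sum_fin : (\sum_(0 <= n <oo) renewals n b < +oo)%E.

Let r n := iter n renewal H.

Let r_ge0 n y : (0 <= r n y)%E. Proof. exact: iter_renewal_ge0. Qed.
Let mr n : measurable_fun setT (r n). Proof. exact: measurable_iter_renewal. Qed.

Let r_le n y : (r n y <= renewals n y)%E.
Proof.
elim: n y => [|n IH] y; first exact: H1.
exact: (le_renewal _ _ y (mr n) (measurable_renewals n) (r_ge0 n) IH).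
Qed.

Lemma renewals_lty n x : b <= x -> (renewals n x < +oo)%E.
Proof.
move=> bx; apply: le_lt_trans (renewals_nonincreasing n _ _ bx) _.
apply: le_lt_trans sum_fin.
have := @nneseries_lim_ge R (fun k => renewals k b) xpredT 0%N n.+1 (fun k _ _ => renewals_ge0 k b).
apply: le_trans.
by rewrite big_nat_recr//= leeDr//; apply: sume_ge0 => k _; exact: renewals_ge0.
Qed.

Let v n x := fine (renewals n x).
Let vE n x : b <= x -> renewals n x = (v n x)%:E.
Proof. by move=> bx; rewrite fineK// ge0_fin_numE ?renewals_lty// renewals_ge0. Qed.

Let q n x := fine (r n x).
Let qE n x : b <= x -> r n x = (q n x)%:E.
Proof.
by move=> bx; rewrite fineK// ge0_fin_numE// (le_lt_trans (r_le n x))// renewals_lty.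
Qed.

Let dl := q 1 b.
Let dl0 : 0 <= dl. Proof. exact: fine_ge0. Qed.

Let base x : b <= x -> (H x + dl%:E = 1 + r 1 x)%E.
Proof.
move=> bx; rewrite -(qE 1 b (lexx b)) -[in RHS](Heq x bx) -addeA; congr (_ + _)%E.
rewrite /r/= /renewal -ge0_integralD//; last first.
- exact: measurable_renewal_integrand.
- by move=> z _; exact: integrand_ge0.
- apply: emeasurable_funM; first by apply: emeasurable_funM => //; exact/measurable_EFinP.
  apply/measurable_EFinP; apply: measurable_funB;
    by apply: measurableT_comp => //; apply: measurable_funB.
- move=> z _; have : 0 <= W (z - b) - W (z - x) by rewrite subr_ge0 W_incr// lerB.
  by move=> w0; apply: mule_ge0; rewrite ?lee_fin//; apply: mule_ge0; rewrite ?lee_fin.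
apply: eq_integral => z _.
have : (0 <= H z)%E by []; have := H1 z; case: (H z) => [h| |]//= _ _.
by rewrite -!EFinM -EFinD; congr EFin; ring.
Qed.

Let step n x : b <= x -> (r n x + dl%:E * renewals n x = renewals n x + r n.+1 x)%E.
Proof.
elim: n x => [|n IH] x bx; first by rewrite mule1 -base.
have mdl k : measurable_fun setT (fun y => dl%:E * renewals k y)%E.
  by apply: measurable_funeM; exact: measurable_renewals.
have dlr k y : (0 <= dl%:E * renewals k y)%E by rewrite mule_ge0 ?renewals_ge0.
have := @eq_renewal b _ _ x bx IH.
rewrite (renewalD _ _ x (mr n) (mdl n) (r_ge0 n) (dlr n)).
rewrite (renewalD _ _ x (measurable_renewals n) (mr n.+1) (renewals_ge0 n) (r_ge0 n.+1)).
by rewrite (renewalZ _ _ x dl0 (measurable_renewals n) (renewals_ge0 n)).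
Qed.

Let partial n x : b <= x -> q 0 x - q n x = (1 - dl) * \sum_(0 <= k < n) v k x.
Proof.
move=> bx; elim: n => [|n IH]; first by rewrite subrr big_geq// mulr0.
rewrite big_nat_recr//= mulrDr -IH.
have := step n x bx; rewrite !qE// !vE// -!EFinM -!EFinD => -[] e.
have -> : q n.+1 x = q n x + dl * v n x - v n x by rewrite e [v n x + _]addrC addrK.
by ring.
Qed.

Let Sfin x : b <= x -> (\sum_(0 <= n <oo) renewals n x)%E \is a fin_num.
Proof.
move=> bx; rewrite ge0_fin_numE; last by apply: nneseries_ge0 => k _ _; exact: renewals_ge0.
apply: le_lt_trans sum_fin; apply: lee_nneseries => [k _ _|k _]; first exact: renewals_ge0.
exact: renewals_nonincreasing.
Qed.

Let series_v x : b <= x -> \sum_(0 <= k < n) v k x @[n --> \oo] -->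
  fine (\sum_(0 <= n <oo) renewals n x)%E.
Proof.
move=> bx.
have c : (\sum_(0 <= k < n) renewals k x)%E @[n --> \oo] --> (\sum_(0 <= n <oo) renewals n x)%E.
  exact: (@is_cvg_nneseries R (fun n => renewals n x) xpredT 0%N (fun n _ _ => renewals_ge0 n x)).
move: c; rewrite -[X in _ --> X -> _](fineK (Sfin x bx)).
rewrite (_ : (fun n => _) = fun n => (\sum_(0 <= k < n) v k x)%:E); first by move/fine_cvg.
by apply/funext => n; rewrite -sumEFin; apply: eq_bigr => k _; rewrite vE.
Qed.

Let q_cvg0 x : b <= x -> q n x @[n --> \oo] --> (0 : R).
Proof.
move=> bx; apply: (@squeeze_cvgr _ _ _ _ (fun=> 0) (fun n => v n x)).
- apply: nearW => n; rewrite fine_ge0//= -lee_fin -qE// -vE//; exact: r_le.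
- exact: cvg_cst.
- apply: cvg_series_cvg_0; apply: cvgP (series_v x bx).
Qed.

Let q_series x : b <= x -> q 0 x = (1 - dl) * fine (\sum_(0 <= n <oo) renewals n x)%E.
Proof.
move=> bx.
have c1 : q 0 x - q n x @[n --> \oo] --> q 0 x.
  by rewrite -[X in _ --> X]subr0; apply: cvgB; [exact: cvg_cst|exact: q_cvg0].
have c2 : (1 - dl) * \sum_(0 <= k < n) v k x @[n --> \oo] -->
    (1 - dl) * fine (\sum_(0 <= n <oo) renewals n x)%E.
  by apply: cvgM; [exact: cvg_cst|exact: series_v].
apply: (@cvg_unique _ (@Rhausdorff R) _ _ _ _ c1) => /=.
by rewrite (_ : (fun n => _) = fun n => (1 - dl) * \sum_(0 <= k < n) v k x)//;
  apply/funext => n; exact: partial.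
Qed.

Let H_b : H b = 1%E.
Proof.
rewrite -(Heq b (lexx b)) integral0_eq ?adde0// => y _.
by rewrite subrr mule0.
Qed.

Lemma renewal_solution x : b <= x ->
  H x = ((\sum_(0 <= n <oo) renewals n x) * ((fine (\sum_(0 <= n <oo) renewals n b))^-1)%:E)%E.
Proof.
move=> bx.
rewrite -[H x]/(r 0 x) qE// -(fineK (Sfin x bx)) -EFinM q_series//; congr EFin.
have : q 0 b = 1 by rewrite /q /r/= H_b.
rewrite q_series//; set S := fine _ => e.
have S0 : S != 0 by apply/eqP => S0; move: e; rewrite S0 mulr0 => /eqP; rewrite eq_sym oner_eq0.
by rewrite mulrC -[1 - dl](mulfK S0) e mul1r.
Qed.

End renewal.

Section conclusion.
Context {R : realType} {d : measure_display} {T : measurableType d}.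
Variables (P : probability T R) (X : R -> T -> R) (Ps W om : R -> R).
Hypothesis HX : levy_process P X Ps.
Hypothesis Ps0 : forall l, 0 <= l -> 0 <= Ps l.
Hypothesis HW : scale_function Ps W.
Hypotheses (mom : measurable_fun setT om) (om_ge0 : forall z, 0 < z -> 0 <= om z).
Local Notation leb := (@lebesgue_measure R).

(* [om] may be negative on (-oo, 0]; neither side of the theorem sees these values. *)
Definition rate_on_pos (y : R) : R := if 0 < y then om y else 0.
Local Notation om' := rate_on_pos.

Lemma measurable_rate_on_pos : measurable_fun setT om'.
Proof. by apply: measurable_fun_ifT => //; exact: measurable_fun_ltr. Qed.

Lemma rate_on_pos_ge0 y : 0 <= om' y.
Proof. by rewrite /om'; case: ifP => // /om_ge0. Qed.

Let W_neg y : y < 0 -> W y = 0.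
Proof. by case: HW => + _; apply. Qed.

Let mW : measurable_fun setT W. Proof. exact: (measurable_scale _ _ HW Ps0). Qed.
Let W_ge0 y : 0 <= W y. Proof. exact: (scale_ge0 _ _ HW Ps0). Qed.

Lemma Wom_renewals n x : 0 <= x -> Wom W om n x = renewals W om' n x.
Proof.
elim: n x => [//|n IH] x x0.
have mren : measurable_fun setT (renewals W om' n).
  exact: (measurable_renewals _ _ mW W_ge0 measurable_rate_on_pos rate_on_pos_ge0).
have mshift : measurable_fun setT (fun z : R => W (z - x)).
  by apply: measurableT_comp => //; exact: measurable_funB.
have mG (f : R -> R) : measurable_fun setT f ->
    measurable_fun setT (fun z : R => ((W (z - x) * f z)%:E * renewals W om' n z)%E).
  move=> mf; apply: emeasurable_funM => //; apply/measurable_EFinP; exact: measurable_funM.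
pose Dc : set R := `[x, +oo[%classic; pose Do : set R := `]x, +oo[%classic.
have oc (f : R -> \bar R) : measurable_fun setT f ->
    (\int[leb]_(z in Do) f z = \int[leb]_(z in Dc) f z)%E.
  move=> mf; apply: integral_itv_obnd_cbnd; exact: measurable_funTS.
have inD z : (z \in Dc) = (x <= z) by rewrite mem_setE in_itv/= andbT.
have inDo z : (z \in Do) = (x < z) by rewrite mem_setE in_itv/= andbT.
rewrite /= -/Dc.
transitivity (\int[leb]_(z in Dc) ((W (z - x) * om z)%:E * renewals W om' n z))%E.
  by apply: eq_integral => z; rewrite inD => xz; rewrite IH// (le_trans x0).
rewrite -(oc _ (mG om mom)).
transitivity (\int[leb]_(z in Do) ((W (z - x) * om' z)%:E * renewals W om' n z))%E.
  by apply: eq_integral => z; rewrite inDo => xz; rewrite /om' (le_lt_trans x0 xz).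
rewrite (oc _ (mG om' measurable_rate_on_pos)) integral_mkcond.
apply: eq_integral => z _; rewrite patchE inD; case: leP => // zx.
by rewrite W_neg ?subr_lt0// mul0r mul0e.
Qed.

Variables (x b : R).
Hypotheses (b0 : 0 <= b) (bx : b <= x).
Hypothesis no_over : {ae P, forall w, forall t, tau_below X x b w = t%:E -> x + X t w = b}.

Let F (y : R) : \bar R := (om y)%:E.
Let mF : measurable_fun setT F. Proof. exact/measurable_EFinP. Qed.

Let A (w : T) : \bar R := (\int[leb]_s killed X b F x w s)%E.

Let mA : measurable_fun setT A.
Proof.
have mk := measurable_killed P X Ps HX b F x mF.
rewrite (_ : A = fun w => (\int[leb]_s ((fun p : T * R => killed X b F x p.1 p.2)^\+ (w, s)) -
    \int[leb]_s ((fun p : T * R => killed X b F x p.1 p.2)^\- (w, s)))%E); last first.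
  apply/funext => w; rewrite /A integralE.
  by congr (_ - _)%E; apply: eq_integral => s _; rewrite ?funeposE ?funenegE.
apply: emeasurable_funB.
- apply: (@measurable_fun_fubini_tonelli_F _ _ _ _ R leb); first exact: measurable_funepos.
  by move=> p; exact: funepos_ge0.
- apply: (@measurable_fun_fubini_tonelli_F _ _ _ _ R leb); first exact: measurable_funeneg.
  by move=> p; exact: funeneg_ge0.
Qed.

Let occ_integral w : (tau_below X x b w < +oo)%E ->
  (\int[leb]_(s in occ_set X x b w) (om (x + X s w))%:E = A w)%E.
Proof.
move=> wfin; have tau0 : (0 <= tau_below X x b w)%E by exact: hitting_ge0.
have tauE := fineK (etrans (ge0_fin_numE tau0) wfin).
rewrite /occ_set; set t := fine _.
pose Do : set R := `[0%R, t[%classic; pose Dc : set R := `[0%R, t]%classic.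
have inDo s : (s \in Do) = (0 <= s < t) by rewrite mem_setE in_itv.
have inDc s : (s \in Dc) = (0 <= s <= t) by rewrite mem_setE in_itv.
transitivity (\int[leb]_(s in Do) killed X b F x w s)%E.
  apply: eq_integral => s; rewrite inDo => /andP[s0 st].
  by rewrite /killed s0 -tauE lee_fin -/t (ltW st).
rewrite [LHS]integral_itv_bndo_bndc; last first.
  apply: measurable_funTS; exact: (measurable_killed1 P X Ps HX).
rewrite -/Dc integral_mkcond; apply: eq_integral => s _.
by rewrite patchE inDc /killed -tauE lee_fin -/t; case: (_ && _).
Qed.

Let no_time_at0 : {ae P, forall w, (\int[leb]_s killed X b (\1_[set 0%R] \; EFin) x w s)%E = 0%E}.
Proof.
set f : R -> \bar R := (\1_[set 0%R] \; EFin).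
have mf : measurable_fun setT f.
  by apply/measurable_EFinP; exact: measurable_indic.
have f0 y : (0 <= f y)%E by rewrite lee_fin.
have E0 : (\int[P]_w \int[leb]_s killed X b f x w s = 0)%E.
  rewrite (occupation_density P X Ps W HX Ps0 HW x b b0 bx no_over)//.
  transitivity (\int[leb]_(y in [set (0 : R)%R]) (f y * (W (y - b) - W (y - x))%:E))%E.
    rewrite [RHS]integral_mkcond; apply: eq_integral => y _.
    rewrite patchE; have [->|y0] := eqVneq y 0; first by rewrite mem_set.
    have yn : ~ [set 0%R] y by move=> /eqP; exact/negP.
    by rewrite memNset// /f/= indicE memNset// mul0e.
  exact: (integral_set1 (fun y : R => f y * (W (y - b) - W (y - x))%:E)%E 0).
have := (@ae_eq_integral_abs _ _ _ P setT measurableT _ (measurable_integral_killed P X Ps HX x b f mf f0)).1.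
move=> /(_ _)[|N [mN N0 H]].
  rewrite -[RHS]E0; apply: eq_integral => w _; rewrite gee0_abs//.
  by apply: integral_ge0 => s _; exact: killed_ge0.
exists N; split => // w /= nw; apply: H => /= /(_ Logic.I) H; exact: nw.
Qed.

Let A_clock : {ae P, forall w, A w = clock X b om' x w}.
Proof.
apply: filterS2 (eq_killed P X x b no_over) no_time_at0 => w Hk H0.
pose f : R -> \bar R := (\1_[set 0%R] \; EFin).
have mf : measurable_fun setT f by apply/measurable_EFinP; exact: measurable_indic.
have mk f' : measurable_fun setT f' -> measurable_fun setT (killed X b f' x w).
  exact: (measurable_killed1 P X Ps HX).
have [N [mN N0 HN]] : ae_eq leb setT (killed X b f x w) (cst 0%E).
  apply: (@ae_eq_integral_abs _ _ R leb setT measurableT _ (mk f mf)).1; rewrite -[RHS]H0.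
  apply: eq_integral => s _; rewrite gee0_abs//; apply: killed_ge0 => y.
  by rewrite lee_fin.
have mF' : measurable_fun setT (fun y => (om' y)%:E).
  by apply/measurable_EFinP; exact: measurable_rate_on_pos.
apply: ae_eq_integral => //; [exact: mk|exact: mk|].
exists N; split => // s /= ns; apply: HN => /= Hs; apply: ns => _.
pose G (y : R) : \bar R := if y == 0 then F y else (om' y)%:E.
rewrite (Hk s F G); last first.
  move=> y yb; rewrite /G /F /om'; case: eqP => // /eqP y0.
  by rewrite lt_neqAle eq_sym y0 (le_trans b0 yb).
move: (Hs Logic.I); rewrite /killed; case: ifP => // _; rewrite /f/= indicE /G.
case: eqP => // ->; rewrite mem_set// => /eqP.
by rewrite eqe oner_eq0.
Qed.

Lemma killed_laplace_clock : {ae P, forall w, (tau_below X x b w < +oo)%E} ->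
  killed_laplace P X om x b = laplace_clock P X b om' x.
Proof.
move=> ruin; rewrite /killed_laplace.
set D := [set w | _].
have mD : measurable D by exact: (measurable_ruin P X Ps HX).
have me : measurable_fun setT (fun w => expeR (- A w)).
  by apply: (measurableT_comp measurable_expeR); exact: measurableT_comp.
transitivity (\int[P]_(w in D) expeR (- A w))%E.
  by apply: eq_integral => w; rewrite inE => wD; rewrite occ_integral.
rewrite integral_mkcond; apply: ge0_ae_eq_integral => //.
- by apply/(measurable_restrictT _ mD); exact: measurable_funTS.
- exact: (measurable_exp_clock P X Ps HX b om' measurable_rate_on_pos rate_on_pos_ge0).
- by move=> w _; rewrite patchE; case: ifP => // _; exact: expeR_ge0.
- by move=> w _; exact: expeR_ge0.
- apply: filterS2 ruin A_clock => w wD AE _.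
  by rewrite patchE mem_set// AE.
Qed.

End conclusion.

Theorem theorem2p7 (R : realType) (g s : R) (pi : {measure set R -> \bar R})
  (d : measure_display) (T : measurableType d) (P : probability T R)
  (X : R -> T -> R) (W om : R -> R) (b : R) :
  levy_triplet g s pi ->
  levy_process P X (Psi g s pi) ->
  scale_function (Psi g s pi) W ->
  measurable_fun setT om ->
  (forall z, 0 < z -> 0 <= om z) ->
  (forall u v, 0 < u -> u <= v -> exists M : R, forall z, u <= z <= v -> om z <= M) ->
  0 <= b ->
  (\sum_(0 <= n <oo) Wom W om n b < +oo)%E ->
  forall x, b <= x ->
    killed_laplace P X om x b =
    ((\sum_(0 <= n <oo) Wom W om n x) * ((fine (\sum_(0 <= n <oo) Wom W om n b))^-1)%:E)%E.

Proof.
move=> Htri HX HW mom om0 _ b0 Sfin x bx.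
set Ps := Psi g s pi in HX HW *.
have Ps0 l : 0 <= l -> 0 <= Ps l by exact: Psi_ge0.
have Ps_gt0 l : 0 < l -> 0 < Ps l by exact: (exponent_gt0 _ _ HW Ps0).
have [C PsC] := Psi_le_sqr _ _ _ Htri.
have no_over y : b <= y ->
    {ae P, forall w, forall t, tau_below X y b w = t%:E -> y + X t w = b}.
  by move=> yb; apply: filterS (no_overshoot P X Ps C HX PsC) => w Hw t; exact: Hw.
pose om' := rate_on_pos om.
have mom' : measurable_fun setT om' by exact: measurable_rate_on_pos.
have om'0 y : 0 <= om' y by exact: rate_on_pos_ge0.
have mW : measurable_fun setT W by exact: (measurable_scale _ _ HW Ps0).
have W0 y : 0 <= W y by exact: (scale_ge0 _ _ HW Ps0).
have Wle : {homo W : y z / y <= z} by exact: (scale_nondecreasing _ _ HW).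
have Wneg y : y < 0 -> W y = 0 by case: HW => + _; apply.
have WomE y : 0 <= y ->
    (\sum_(0 <= n <oo) Wom W om n y = \sum_(0 <= n <oo) renewals W om' n y)%E.
  move=> y0; apply: eq_eseriesr => n _.
  exact: (Wom_renewals Ps W om Ps0 HW mom om0).
rewrite WomE// in Sfin; rewrite !WomE ?(le_trans b0)//.
rewrite (killed_laplace_clock P X Ps W om HX Ps0 HW mom om0 x b b0 bx (no_over x bx)); last first.
  exact: (ruin_ae P X Ps HX Ps0 Ps_gt0 x b bx (no_over x bx)).
apply: (renewal_solution W om' mW W0 Wle Wneg mom' om'0 b (laplace_clock P X b om')) => //.
- exact: (measurable_laplace_clock P X Ps HX).
- by move=> y; exact: laplace_clock_ge0.
- by move=> y; exact: (laplace_clock_le1 P X Ps HX).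
move=> y yb; apply: (feynman_kac P X Ps W HX Ps0 HW b om' b0 mom' om'0 y yb (no_over y yb)).
rewrite (integral_clock P X Ps W HX Ps0 HW b om' b0 mom' om'0 y yb (no_over y yb)).
have := renewals_lty W om' mW W0 Wle mom' om'0 b Sfin 1 b (lexx b).
apply: le_lt_trans; apply: ge0_le_integral => //.
- by move=> z _; rewrite mule_ge0// lee_fin// subr_ge0 Wle// lerB.
- apply: emeasurable_funM; first exact/measurable_EFinP.
  by apply/measurable_EFinP; exact: (measurable_scale_increment Ps W Ps0 HW y b).
- exact: (measurable_renewal_integrand W om' mW mom').
- move=> z _; rewrite mule1 -EFinM lee_fin mulrC ler_wpM2r//.
  by rewrite lerBlDr lerDl.
Qed.
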